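(* The inverse 2-maxian problem on trees with $n$ vertices under the bottleneck Hamming distance, i.e. with cost function $\max_{e\in E} c_e H(x_e)$, where $H(0)=0$ and $H(\theta)=1$ for $\theta\neq 0$, can be solved in $O(n\log n)$ time.
   Context: Let $T=(V,E)$ be a tree with $|V|=n$, vertex weights $w_i\ge 0$ ($v_i \in V$) and edge lengths $\ell_e\ge 0$ ($e\in E$). A point of $T$ is a vertex or a point in the interior of an edge; $d$ is the shortest-path distance and $P(u,v)$ the path joining $u$ and $v$. A set $X=\{x_1,x_2\}$ of two points of $T$ is a 2-maxian of $T$ if it maximizes $F(X)=\sum_{i=1}^n w_i\max\{d(v_i,x_1),d(v_i,x_2)\}$ over all sets of two points of $T$. Inverse 2-maxian problem: given two prespecified leaves $a,b$ of $T$, modification bounds $\bar x_e\ge 0$ and modification costs $c_e\ge 0$ for $e\in E$, choose modifications $x_e$ with $0\le x_e\le \bar x_e$ and set new lengths $\tilde\ell_e=\ell_e+x_e$ for $e\in P(a,b)$ and $\tilde\ell_e=\ell_e-x_e$ for $e\notin P(a,b)$. The new lengths must be non-negative, and $\{a,b\}$ must be a 2-maxian of $T$ with respect to the lengths $\tilde\ell$. The goal is to minimize the given cost function of $x$. To solve the problem means to compute an optimal solution or report infeasibility. Running time is counted in elementary operations (arithmetic operations and comparisons) on the input numbers. *)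

(* Defs.v *)
From HB Require Import structures.
From mathcomp Require Import all_boot all_order all_algebra.

Set Implicit Arguments.
Unset Strict Implicit.
Unset Printing Implicit Defensive.

Import Order.TTheory GRing.Theory Num.Theory.
Local Open Scope ring_scope.

(** * Trees given by an edge list *)

Section Graph.
Variables (n m : nat) (ends : 'I_m -> 'I_n * 'I_n).

Definition joins (e : 'I_m) (u v : 'I_n) : bool :=
  (ends e == (u, v)) || (ends e == (v, u)).

Definition adj : rel 'I_n := fun u v => [exists e, joins e u v].

Definition simple_graph : Prop :=
  (forall e, (ends e).1 != (ends e).2) /\
  (forall e e' u v, joins e u v -> joins e' u v -> e = e').

Definition connected_graph : Prop := forall u v, connect adj u v.

(* In a simple graph a cycle has at least three vertices; the vertex sequences
   [:: u] and [:: u; v] must not count as cycles. *)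
Definition acyclic_graph : Prop :=
  forall c : seq 'I_n, (2 < size c)%N -> ~ ucycle adj c.

Definition is_tree : Prop :=
  [/\ simple_graph, connected_graph & acyclic_graph].

Definition is_leaf (u : 'I_n) : bool := #|[set v | adj u v]| == 1%N.

Definition is_path (u : 'I_n) (p : seq 'I_n) (v : 'I_n) : bool :=
  [&& path adj u p, uniq (u :: p) & last u p == v].

Definition path_edges (u : 'I_n) (p : seq 'I_n) : {set 'I_m} :=
  [set e | has (fun xy => joins e xy.1 xy.2) (zip (u :: p) p)].

(* A path has at most n vertices, so bounding the size of p by n loses
   nothing. *)
Definition path_set (u v : 'I_n) : {set 'I_m} :=
  [set e | [exists k : 'I_n, [exists p : k.-tuple 'I_n,
     is_path u p v && (e \in path_edges u p)]]].

Section Metric.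
Variables (R : realFieldType) (l : 'I_m -> R).

Definition path_length (u : 'I_n) (p : seq 'I_n) : R :=
  \sum_(e in path_edges u p) l e.

(* The neutral element of the minimum is harmless: for l >= 0 it is an upper
   bound of the length of every path. *)
Definition dist (u v : 'I_n) : R :=
  let total := \sum_e l e in
  \big[Num.min/total]_(k < n)
    \big[Num.min/total]_(p : k.-tuple 'I_n | is_path u p v)
      path_length u p.

(* Edge_point e t is the point of e at distance t from (ends e).1. *)
Inductive point :=
  | Vertex of 'I_n
  | Edge_point of 'I_m & R.

Definition in_tree (x : point) : Prop :=
  match x with
  | Vertex _ => True
  | Edge_point e t => 0 < t < l e
  end.

Definition vdist (v : 'I_n) (x : point) : R :=
  match x with
  | Vertex u => dist v u
  | Edge_point e t =>
      Num.min (dist v (ends e).1 + t) (dist v (ends e).2 + (l e - t))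
  end.

Variable w : 'I_n -> R.

Definition sum_of_max (x1 x2 : point) : R :=
  \sum_v w v * Num.max (vdist v x1) (vdist v x2).

Definition is_2maxian (x1 x2 : point) : Prop :=
  [/\ in_tree x1, in_tree x2, x1 <> x2 &
      forall y1 y2, in_tree y1 -> in_tree y2 -> y1 <> y2 ->
        sum_of_max y1 y2 <= sum_of_max x1 x2].

End Metric.
End Graph.

Arguments Vertex {n m R} _.
Arguments Edge_point {n m R} _ _.

(** * The inverse 2-maxian problem under the bottleneck Hamming distance *)

Record instance (R : realFieldType) := Instance {
  nv : nat;
  ne : nat;
  ends : 'I_ne -> 'I_nv * 'I_nv;
  wgt : 'I_nv -> R;
  len : 'I_ne -> R;
  ubd : 'I_ne -> R;
  cst : 'I_ne -> R;
  pa : 'I_nv;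
  pb : 'I_nv
}.

Section Problem.
Variables (R : realFieldType) (I : instance R).
Implicit Type x : 'I_(ne I) -> R.

Definition valid_instance : Prop :=
  [/\ is_tree (@ends R I),
      [/\ forall v, 0 <= @wgt R I v, forall e, 0 <= @len R I e,
          forall e, 0 <= @ubd R I e & forall e, 0 <= @cst R I e],
      is_leaf (@ends R I) (pa I), is_leaf (@ends R I) (pb I) &
      pa I != pb I].

Definition new_len x (e : 'I_(ne I)) : R :=
  if e \in path_set (@ends R I) (pa I) (pb I) then len e + x e else len e - x e.

Definition feasible x : Prop :=
  [/\ forall e, 0 <= x e <= ubd e,
      forall e, 0 <= new_len x e &
      is_2maxian (@ends R I) (new_len x) (@wgt R I)
        (Vertex (pa I)) (Vertex (pb I))].

Definition nonzero_ind (t : R) : R := if t == 0 then 0 else 1.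

(* The neutral element 0 is harmless: costs are non-negative and a tree with
   two leaves has an edge. *)
Definition hamming_cost x : R := \big[Num.max/0]_e (cst e * nonzero_ind (x e)).

Definition optimal x : Prop :=
  feasible x /\ forall y, feasible y -> hamming_cost x <= hamming_cost y.

End Problem.

(** * Machine model: a unit-cost real RAM

   A program is one fixed command, the same for all inputs. Its memory consists
   of arrays of natural numbers (addresses, counters, flags) and arrays of
   numbers in R; array names are fixed in the program text, cell indices are
   computed, and scalar variables are arrays used at one cell. The numbers in R
   are accessible only through field operations and comparison. Naturals
   have neither multiplication nor bit operations, so that no parallelism can
   be packed into large integers. *)

Inductive nexp :=
  | NConst of nat
  | NGet of nat & nexp
  | NAdd of nexp & nexp
  | NSub of nexp & nexp.

Inductive rexp :=
  | RZero
  | ROne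
  | RGet of nat & nexp
  | RAdd of rexp & rexp
  | RSub of rexp & rexp
  | RMul of rexp & rexp
  | RDiv of rexp & rexp.

Inductive bexp :=
  | BLeN of nexp & nexp
  | BLeR of rexp & rexp
  | BNot of bexp
  | BAnd of bexp & bexp.

Inductive cmd :=
  | Skip
  | NSet of nat & nexp & nexp
  | RSet of nat & nexp & rexp
  | Seq of cmd & cmd
  | If of bexp & cmd & cmd
  | While of bexp & cmd.

(* Number of operations performed when evaluating an expression: one for every
   constant, memory access, arithmetic operation, comparison and connective. *)
Fixpoint ncost (e : nexp) : nat :=
  match e with
  | NConst _ => 1
  | NGet _ i => (ncost i).+1
  | NAdd e1 e2 | NSub e1 e2 => (ncost e1 + ncost e2).+1
  end.

Fixpoint rcost (e : rexp) : nat :=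
  match e with
  | RZero | ROne => 1
  | RGet _ i => (ncost i).+1
  | RAdd e1 e2 | RSub e1 e2 | RMul e1 e2 | RDiv e1 e2 =>
      (rcost e1 + rcost e2).+1
  end.

Fixpoint bcost (b : bexp) : nat :=
  match b with
  | BLeN e1 e2 => (ncost e1 + ncost e2).+1
  | BLeR e1 e2 => (rcost e1 + rcost e2).+1
  | BNot b1 => (bcost b1).+1
  | BAnd b1 b2 => (bcost b1 + bcost b2).+1
  end.

Section Semantics.
Variable R : realFieldType.

(* nmem s k i is cell i of the array k. *)
Record state := State {
  nmem : nat -> nat -> nat;
  rmem : nat -> nat -> R
}.

Definition update (T : Type) (f : nat -> nat -> T) (k i : nat) (x : T) :
    nat -> nat -> T :=
  fun k' i' => if (k' == k) && (i' == i) then x else f k' i'.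

Fixpoint neval (s : state) (e : nexp) : nat :=
  match e with
  | NConst k => k
  | NGet k i => nmem s k (neval s i)
  | NAdd e1 e2 => (neval s e1 + neval s e2)%N
  | NSub e1 e2 => (neval s e1 - neval s e2)%N
  end.

(* Division by 0 returns 0. *)
Fixpoint reval (s : state) (e : rexp) : R :=
  match e with
  | RZero => 0
  | ROne => 1
  | RGet k i => rmem s k (neval s i)
  | RAdd e1 e2 => reval s e1 + reval s e2
  | RSub e1 e2 => reval s e1 - reval s e2
  | RMul e1 e2 => reval s e1 * reval s e2
  | RDiv e1 e2 => reval s e1 / reval s e2
  end.

Fixpoint beval (s : state) (b : bexp) : bool :=
  match b with
  | BLeN e1 e2 => (neval s e1 <= neval s e2)%N
  | BLeR e1 e2 => reval s e1 <= reval s e2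
  | BNot b1 => ~~ beval s b1
  | BAnd b1 b2 => beval s b1 && beval s b2
  end.

(* exec c s s' t: started in s, the command c halts in s' after t operations. *)
Inductive exec : cmd -> state -> state -> nat -> Prop :=
  | ExecSkip s : exec Skip s s 1
  | ExecNSet s k i e :
      exec (NSet k i e) s
        (State (update (nmem s) k (neval s i) (neval s e)) (rmem s))
        (ncost i + ncost e).+1
  | ExecRSet s k i e :
      exec (RSet k i e) s
        (State (nmem s) (update (rmem s) k (neval s i) (reval s e)))
        (ncost i + rcost e).+1
  | ExecSeq c1 c2 s s' s'' t1 t2 :
      exec c1 s s' t1 -> exec c2 s' s'' t2 ->
      exec (Seq c1 c2) s s'' (t1 + t2)
  | ExecIf b c1 c2 s s' t :
      exec (if beval s b then c1 else c2) s s' t ->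
      exec (If b c1 c2) s s' (bcost b + t).+1
  | ExecWhileFalse b c s :
      beval s b = false -> exec (While b c) s s (bcost b).+1
  | ExecWhileTrue b c s s' s'' t1 t2 :
      beval s b = true -> exec c s s' t1 -> exec (While b c) s' s'' t2 ->
      exec (While b c) s s'' (bcost b + t1 + t2).+1.

End Semantics.

(** * Input and output conventions *)

Definition array_of (T : Type) (x0 : T) (k : nat) (f : 'I_k -> T) (i : nat) :
    T :=
  if insub i is Some j then f j else x0.

Section InputOutput.
Variables (R : realFieldType) (I : instance R).

(* Array 0 of naturals holds |V|, |E|, a, b; arrays 1 and 2 hold the end
   vertices of the edges. Arrays 0 to 3 of numbers hold w, l, the bounds and the
   costs. All other cells are 0. *)
Definition input : state R :=
  State
    (fun k i =>
       match k with
       | 0 => nth 0%N [:: nv I; ne I; pa I : nat; pb I : nat] i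
       | 1 => array_of 0%N (fun e => (@ends R I e).1 : nat) i
       | 2 => array_of 0%N (fun e => (@ends R I e).2 : nat) i
       | _ => 0%N
       end)
    (fun k i =>
       match k with
       | 0 => array_of 0 (@wgt R I) i
       | 1 => array_of 0 (@len R I) i
       | 2 => array_of 0 (@ubd R I) i
       | 3 => array_of 0 (@cst R I) i
       | _ => 0
       end).

(* The answer is read from cell 0 of the array 3 of naturals (1: solution found,
   0: infeasible) and from the array 4 of numbers (the modifications). *)
Definition solved_by (s : state R) : Prop :=
  (nmem s 3 0 = 1%N /\ optimal (fun e : 'I_(ne I) => rmem s 4 e)) \/
  (nmem s 3 0 = 0%N /\ forall x : 'I_(ne I) -> R, ~ feasible x).

End InputOutput.

(* Main.v *)
Require Import Defs.
From mathcomp Require Import all_boot all_order all_algebra.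
From mathcomp Require Import zify lra.

Set Implicit Arguments.
Unset Strict Implicit.
Unset Printing Implicit Defensive.

Import Order.TTheory GRing.Theory Num.Theory.
Local Open Scope ring_scope.

(** The ends of a longest path offer every vertex a farthest vertex. Hence
    [{a, b}] is a 2-maxian if and only if every vertex of positive weight has [a]
    or [b] as a farthest vertex ([is_2maxianP]). As weights may be zero, this does
    not force the path from [a] to [b] to be a longest path. The four-point
    condition of tree metrics turns it into an alternative of three cases
    ([is_2maxian_cases]): [b] is farthest from the vertex [cb] where paths from
    [b] enter the subtree spanned by the positive weights, or [a] is farthest from
    the corresponding vertex [ca], or [a] and [b] are farthest from each other.

    Each case consists of conditions that [t] be farthest from [c]. Such a
    condition is favoured by long edges on the path from [c] to [t] and by short
    edges elsewhere ([farthest_mono]), while the edges of the path from [a] to [b]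
    can only grow and the others can only shrink. So, for a bound [theta] on the
    cost, each case has a best modification [plan]: the edges of cost at most
    [theta] whose permitted change helps are changed as much as possible, and all
    others are left alone. The optimal cost is the least [theta], among 0 and the
    costs of the edges, for which one of the three plans attains its case
    ([achieves_optimal]), and this property of [theta] is monotone
    ([solvable_mono]).

    The algorithm sorts these [n] values and searches for the least good one by
    bisection, with a test that takes linear time. Adjacency lists are avoided:
    for each vertex the program keeps its degree, the sum of its neighbours and
    the sum of its edges. For a leaf these sums are its only neighbour and its
    only edge ([star_childless]), so removing leaves one after the other, and
    subtracting them from the sums of their neighbours, yields parents and an
    order of the vertices ([root_treeP]). The vertex [cb] is the lowest common
    ancestor of the positive weights when [b] is the root ([gate_lca]), and up to
    a constant the distances from a vertex [c] are sums of signed lengths along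
    the paths from the root ([potential]).

    The program is written with counted loops only. Its meaning is then a
    function on states, about which loop invariants are proved ([for_ind]), and
    its running time is bounded by an expression that depends on the loop bounds
    only ([code_exec]). Loops over vertices or edges are nested at most in a loop
    of logarithmic length ([weight_solve]), which gives the time bound. *)

(** * Rooted trees *)

Section Rooting.
Variables (n m : nat) (ends : 'I_m -> 'I_n * 'I_n).

Record rooting (t : 'I_n) (par : 'I_n -> 'I_n) (pe : 'I_n -> 'I_m)
    (depth : 'I_n -> nat) : Prop := Rooting {
  par_root : par t = t;
  pe_joins : forall v, v != t -> joins ends (pe v) v (par v);
  depth_par : forall v, v != t -> (depth (par v) < depth v)%N;
  pe_onto : forall e, exists2 v, v != t & e = pe v
}.

Lemma joinsC e u v : joins ends e u v = joins ends e v u.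
Proof. by rewrite /joins orbC. Qed.

Lemma joins_ends e : joins ends e (ends e).1 (ends e).2.
Proof. by rewrite /joins -surjective_pairing eqxx. Qed.

Lemma joins_inj e u v u' v' : joins ends e u v -> joins ends e u' v' ->
  (u = u' /\ v = v') \/ (u = v' /\ v = u').
Proof.
by rewrite /joins => /orP[]/eqP-> /orP[]/eqP[]-> ->; auto.
Qed.

Lemma tree_ne_gt0 (u v : 'I_n) : is_tree ends -> u != v -> (0 < m)%N.
Proof.
move=> [_ conn _]; case/connectP: (conn u v) => -[|x p] /=.
  by move=> _ ->; rewrite eqxx.
by case/andP=> /existsP[[k Hk] _] *; apply: leq_ltn_trans Hk.
Qed.

(** A neighbour that is nearer to [t] serves as parent. Acyclicity forces every
    edge to be a parent edge, since an edge [uv] left over would close a cycle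
    with a simple path of parent edges from [u] to [v]. *)
Lemma rooting_exists (t : 'I_n) : is_tree ends -> (0 < m)%N ->
  exists par pe depth, rooting t par pe depth.
Proof.
move=> Htree m0; have [[loopless simple] conn acyc] := Htree.
have exD v : exists k, [exists p : k.-tuple 'I_n,
    path (adj ends) t p && (last t p == v)].
  case/connectP: (conn t v) => p Hp Hl.
  by exists (size p); apply/existsP; exists (in_tuple p); rewrite Hp -Hl eqxx.
pose D v := ex_minn (exD v).
have Dprop v : exists2 p, path (adj ends) t p & last t p = v /\ size p = D v.
  rewrite /D; case: ex_minnP => k /existsP[p /andP[Hp /eqP Hl]] _.
  by exists p => //; rewrite size_tuple.
have Dmin v p : path (adj ends) t p -> last t p = v -> (D v <= size p)%N.
  move=> Hp Hl; rewrite /D; case: ex_minnP => k _; apply.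
  by apply/existsP; exists (in_tuple p); rewrite Hp /= Hl eqxx.
pose Q (v : 'I_n) (ue : 'I_n * 'I_m) := joins ends ue.2 v ue.1 && (D ue.1 < D v)%N.
have exQ v : v != t -> exists ue, Q v ue.
  move=> vt; have [p Hp [Hl Hs]] := Dprop v.
  case/lastP: p Hp Hl Hs => [|p y]; first by move=> _ /= E; rewrite E eqxx in vt.
  rewrite rcons_path last_rcons size_rcons => /andP[Hp /existsP[e He]] Ey Hs.
  exists (last t p, e); rewrite /Q /= -Ey joinsC He /= Ey -Hs ltnS.
  exact: Dmin.
pose f v := odflt (t, Ordinal m0) [pick ue | Q v ue].
have fQ v : v != t -> Q v (f v).
  move=> vt; rewrite /f; case: pickP => [//|H].
  by case: (exQ v vt) => ue; rewrite H.
pose par v := if v == t then t else (f v).1.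
have parE v : v != t -> par v = (f v).1 by rewrite /par => /negPf->.
exists par, (fun v => (f v).2), D; split.
- by rewrite /par eqxx.
- by move=> v vt; rewrite parE //; case/andP: (fQ v vt).
- by move=> v vt; rewrite parE //; case/andP: (fQ v vt).
move=> e.
pose T := [rel x y | (x != t) && (par x == y) || (y != t) && (par y == x)].
have Tsym : symmetric T by move=> x y /=; rewrite orbC.
have Tadj x y : T x y -> adj ends x y.
  case/orP=> /andP[xt /eqP<-]; apply/existsP.
    by exists (f x).2; rewrite parE //; case/andP: (fQ x xt).
  by exists (f y).2; rewrite joinsC parE //; case/andP: (fQ y xt).
have Tconn_t x : connect T x t.
  have [k] := ubnP (D x); elim: k x => // k IHk x; rewrite ltnS => Hk.
  have [->|xt] := eqVneq x t; first exact: connect0.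
  apply: (@connect_trans _ _ (par x)).
    by apply: connect1; rewrite /= xt eqxx.
  apply: IHk; apply: leq_trans Hk.
  by rewrite parE //; case/andP: (fQ x xt).
have Tconn x y : connect T x y.
  apply: connect_trans (Tconn_t x) _.
  by rewrite (sym_connect_sym Tsym).
set u := (ends e).1; set v := (ends e).2.
have Huv : joins ends e u v := joins_ends e.
have uv : u != v := loopless e.
have use x y : joins ends e x y -> x != t -> par x = y -> e = (f x).2.
  move=> Hj xt Hy; apply: (simple _ _ x y) => //.
  by rewrite -Hy parE //; case/andP: (fQ x xt).
have [/orP[]/andP[H1 /eqP H2]|nT] := boolP (T u v).
- by exists u => //; apply: (use _ v).
- by exists v => //; apply: (use _ u) => //; rewrite joinsC.
exfalso.
case/connectP: (Tconn u v) => p0 Hp0 Hl0.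
case/shortenP: Hp0 Hl0 => p Hp Up _ Hl.
have Hsz : (2 < size (u :: p))%N.
  case: p Hp Hl Up => [|x [|y p]] //=.
  - by move=> _ E; rewrite -E eqxx in uv.
  - by rewrite andbT => Hx E; move: nT; rewrite E /= Hx.
apply: (acyc (u :: p) Hsz); rewrite /ucycle Up andbT /= rcons_path.
rewrite -Hl (sub_path Tadj Hp) /=; apply/existsP; exists e.
by rewrite joinsC.
Qed.

Lemma path_setP u v e : reflect
  (exists2 p, is_path ends u p v & e \in path_edges ends u p)
  (e \in path_set ends u v).
Proof.
rewrite inE; apply: (iffP existsP) => [[k /existsP[p /andP[Hp He]]]|[p Hp He]].
  by exists p.
case/and3P: (Hp) => _ U _.
have Hs : (size p < n)%N.
  by have := max_card (mem (u :: p)); rewrite (card_uniqP U) card_ord.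
exists (Ordinal Hs); apply/existsP; exists (in_tuple p).
by rewrite /= Hp He.
Qed.

Lemma path_edges_mem u p e x y :
  e \in path_edges ends u p -> joins ends e x y -> x \in u :: p.
Proof.
rewrite inE; elim: p u => [|z p IH] u //= /orP[/= H1 H2|H1 H2].
  by case: (joins_inj H1 H2) => -[Ex Ey]; rewrite !inE ?Ex ?Ey eqxx ?orbT.
by rewrite inE (IH z) ?orbT.
Qed.

Section Rooted.
Hypothesis Htree : is_tree ends.
Variables (t : 'I_n) (par : 'I_n -> 'I_n) (pe : 'I_n -> 'I_m).
Variable depth : 'I_n -> nat.
Hypothesis HR : rooting t par pe depth.

Local Notation anc x v := (fconnect par v x).

Lemma depth_anc x v : anc x v -> (depth x <= depth v)%N.
Proof.
move/iter_findex<-; elim: (findex _ _ _) => //= k /(leq_trans _); apply.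
have [->|/(depth_par HR)/ltnW//] := eqVneq (iter k par v) t.
by rewrite (par_root HR).
Qed.

Lemma anc_root x : anc x t = (x == t).
Proof.
apply/idP/eqP => [/iter_findex<-|->]; last exact: connect0.
by elim: (findex _ _ _) => //= k ->; exact: par_root HR.
Qed.

Lemma anc_par x v : anc x v = (x == v) || anc x (par v).
Proof. by rewrite fconnect_eqVf eq_sym. Qed.

Lemma not_anc_par v : v != t -> anc v (par v) = false.
Proof.
move=> vt; apply/negP => /depth_anc; rewrite leqNgt.
by rewrite (depth_par HR).
Qed.

Lemma root_anc v : anc t v.
Proof.
have [k] := ubnP (depth v); elim: k v => // k IHk v; rewrite ltnS => Hk.
rewrite anc_par; have [<-|/= vt] := eqVneq; first by [].
apply: IHk; apply: leq_trans Hk; apply: (depth_par HR).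
by rewrite eq_sym.
Qed.

Lemma anc_chain x y v : anc x v -> anc y v -> anc x y || anc y x.
Proof.
move=> /iter_findex<- /iter_findex<-.
set i := findex _ _ _; set j := findex _ _ _.
have go p q : (p <= q)%N -> anc (iter q par v) (iter p par v).
  by move=> Hpq; rewrite -(subnK Hpq) iterD; exact: fconnect_iter.
by case: (leqP i j) => [/go->|/ltnW/go->]; rewrite ?orbT.
Qed.

Definition root_edges v : {set 'I_m} :=
  [set pe x | x : 'I_n & (x != t) && anc x v].

Lemma pe_inj x y : x != t -> y != t -> pe x = pe y -> x = y.
Proof.
move=> xt yt E; have Hx := pe_joins HR xt; have Hy := pe_joins HR yt.
rewrite E in Hx; case: (joins_inj Hx Hy) => -[// E1 E2].
have := depth_par HR xt; have := depth_par HR yt.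
by rewrite E2 -E1 => /ltnW; rewrite leqNgt => /negPf->.
Qed.

Lemma mem_root_edges x v : x != t -> (pe x \in root_edges v) = anc x v.
Proof.
move=> xt; apply/imsetP/idP => [[y]|H]; last by exists x; rewrite // inE xt.
by rewrite inE => /andP[yt Hy] /(pe_inj xt yt)->.
Qed.

Lemma root_edges_root : root_edges t = set0.
Proof.
apply/setP => e; rewrite inE; have [x xt ->] := pe_onto HR e.
by rewrite mem_root_edges // anc_root (negPf xt).
Qed.

Lemma root_edges_par e v : v != t ->
  (e \in root_edges v) = (e == pe v) || (e \in root_edges (par v)).
Proof.
move=> vt; have [x xt ->] := pe_onto HR e; rewrite !mem_root_edges // anc_par.
by congr (_ || _); apply/eqP/eqP => [->|/(pe_inj xt vt)].
Qed.

Lemma pe_notin_root_edges v : v != t -> (pe v \in root_edges (par v)) = false.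
Proof. by move=> vt; rewrite mem_root_edges // not_anc_par. Qed.

Lemma root_edges_step e f u v : joins ends e u v ->
  (f \in root_edges u) (+) (f \in root_edges v) = (f == e).
Proof.
have aux x : x != t ->
    (f \in root_edges x) (+) (f \in root_edges (par x)) = (f == pe x).
  move=> xt; rewrite (root_edges_par _ xt); have [->|_] := eqVneq f (pe x).
    by rewrite pe_notin_root_edges.
  by rewrite addbb.
move=> Hj; have [x xt Ee] := pe_onto HR e; rewrite Ee.
have Hx := pe_joins HR xt; rewrite -Ee in Hx.
by case: (joins_inj Hj Hx) => -[-> ->]; last rewrite addbC; rewrite aux.
Qed.

(** Walking along an edge [e] toggles membership in [root_edges] for [e] only,
    and a simple path uses each of its edges once. *)
Lemma path_edgesE u p v f : is_path ends u p v ->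
  (f \in path_edges ends u p) = (f \in root_edges u) (+) (f \in root_edges v).
Proof.
elim: p u => [|x p IH] u; first by case/and3P => _ _ /eqP<-; rewrite addbb inE.
case/and3P => /= /andP[/existsP[e He] Hp] /andP[Hu U] Hl.
have Hpath : is_path ends x p v by apply/and3P.
have -> : (f \in path_edges ends u (x :: p)) =
          (f == e) || (f \in path_edges ends x p).
  rewrite !inE /=; congr (_ || _); apply/idP/eqP => [|-> //].
  by case: Htree => -[_ S] _ _ /S; apply.
have := root_edges_step f He; rewrite (IH x Hpath).
have [E H|_ /eqP] := eqVneq f e.
  subst e.
  have /negP : ~ f \in path_edges ends x p.
    by move=> /path_edges_mem/(_ He); rewrite (negPf Hu).
  by rewrite (IH x Hpath) => /negPf; move: H; do 3!case: (_ \in _).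
by do 3!case: (_ \in _).
Qed.

Lemma mem_path_set_root u v f :
  (f \in path_set ends u v) = (f \in root_edges u) (+) (f \in root_edges v).
Proof.
have [_ /(_ u v)/connectP[p0 Hp0 Hl0] _] := Htree.
case/shortenP: Hp0 Hl0 => p Hp Up _ Hl.
have Hpath : is_path ends u p v by apply/and3P; rewrite -Hl.
rewrite -(path_edgesE f Hpath).
apply/path_setP/idP => [[q Hq]|Hf]; last by exists p.
by rewrite (path_edgesE _ Hq) -(path_edgesE _ Hpath).
Qed.

Lemma mem_path_set_from_root v f :
  (f \in path_set ends t v) = (f \in root_edges v).
Proof. by rewrite mem_path_set_root root_edges_root inE. Qed.

End Rooted.
End Rooting.

(** * Distances in a tree *)

Section TreePaths.
Variables (n m : nat) (ends : 'I_m -> 'I_n * 'I_n).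
Hypothesis Htree : is_tree ends.
Hypothesis m0 : (0 < m)%N.

Local Notation P := (path_set ends).

Lemma mem_path_set r u v e : (e \in P u v) = (e \in P r u) (+) (e \in P r v).
Proof.
have [par [pe [D HR]]] := rooting_exists r Htree m0.
by rewrite (mem_path_set_root Htree HR) !(mem_path_set_from_root Htree HR).
Qed.

Lemma mem_path_set_refl u e : (e \in P u u) = false.
Proof. by rewrite (mem_path_set u) addbb. Qed.

Lemma mem_path_setC u v e : (e \in P u v) = (e \in P v u).
Proof. by rewrite (mem_path_set u v u) mem_path_set_refl addbF. Qed.

Lemma path_setC u v : P u v = P v u.
Proof. by apply/setP => e; rewrite mem_path_setC. Qed.

Lemma mem_path_set_joins e f u v : joins ends e u v ->
  (f \in P u v) = (f == e).
Proof.
have [par [pe [D HR]]] := rooting_exists u Htree m0 => He.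
by rewrite (mem_path_set_root Htree HR) (root_edges_step HR _ He).
Qed.

(** Removing [e] leaves two components; a path that avoids [e] stays in one of
    them, and so do the ends of each of its edges. *)
Lemma edge_side e f p q x z : joins ends f p q ->
  f \in P x z -> e \notin P x z -> e \notin P x p.
Proof.
move=> Hj; have [par [pe [D HR]]] := rooting_exists x Htree m0.
rewrite !(mem_path_set_from_root Htree HR).
have [y yx Ef] := pe_onto HR f; rewrite Ef (mem_root_edges HR) // => Hy.
have [v vx Ee] := pe_onto HR e; rewrite Ee !(mem_root_edges HR) // => Hv.
apply: contra Hv => Hv.
have Hyp : fconnect par y p.
  have Hpe := pe_joins HR yx; rewrite -Ef in Hpe.
  by case: (joins_inj Hj Hpe) => -[-> _]; rewrite ?connect0 ?fconnect1.
by apply: connect_trans Hy _; apply: connect_trans Hyp _.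
Qed.

Section Metric.
Variable R : realFieldType.
Implicit Types l : 'I_m -> R.

Definition tdist l u v : R := \sum_(e in P u v) l e.

Lemma tdist_if l u v : tdist l u v = \sum_e if e \in P u v then l e else 0.
Proof. exact: big_mkcond. Qed.

Lemma tdistC l u v : tdist l u v = tdist l v u.
Proof. by rewrite /tdist path_setC. Qed.

Lemma tdist_refl l u : tdist l u u = 0.
Proof. by rewrite /tdist big_pred0 // => e; rewrite mem_path_set_refl. Qed.

Lemma tdist_ge0 l u v : (forall e, 0 <= l e) -> 0 <= tdist l u v.
Proof. by move=> l0; apply: sumr_ge0. Qed.

Lemma tdist_joins l e u v : joins ends e u v -> tdist l u v = l e.
Proof.
move=> He; rewrite /tdist (big_pred1 e) // => f.
by rewrite (mem_path_set_joins _ He).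
Qed.

Lemma distE l u v : (forall e, 0 <= l e) -> dist ends l u v = tdist l u v.
Proof.
move=> l0; have [par [pe [D HR]]] := rooting_exists u Htree m0.
have all_len p : is_path ends u p v -> path_length ends l u p = tdist l u v.
  move=> Hp; apply: eq_bigl => e.
  by rewrite (path_edgesE Htree HR _ Hp) (mem_path_set_root Htree HR).
have le_total : tdist l u v <= \sum_e l e.
  rewrite tdist_if; apply: ler_sum => e _; case: ifP => // _.
have [_ /(_ u v)/connectP[p0 Hp0 Hl0] _] := Htree.
case/shortenP: Hp0 Hl0 => p Hp Up _ Hl.
have Hpath : is_path ends u p v by apply/and3P; rewrite -Hl.
have Hs : (size p < n)%N.
  by have := max_card (mem (u :: p)); rewrite (card_uniqP Up) card_ord.
apply/eqP; rewrite eq_le; apply/andP; split; last first.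
  apply: le_bigmin => // k _; apply: le_bigmin => // q Hq.
  by rewrite all_len.
apply: (bigmin_inf (Ordinal Hs)) => //.
apply: (bigmin_inf (in_tuple p)) => //.
by rewrite all_len.
Qed.

(** The paths from [u] to [c] and from [c] to [v] share no edge, which says that
    [c] lies on the path from [u] to [v]. *)
Definition between u c v := forall e, e \in P u c -> e \notin P c v.

Lemma tdist_between l u c v : between u c v ->
  tdist l u v = tdist l u c + tdist l c v.
Proof.
move=> B; rewrite !tdist_if -big_split; apply: eq_bigr => e _ /=.
have := B e; rewrite (mem_path_set c u v) (mem_path_setC c u).
by case: (e \in P u c); case: (e \in P c v) => H //=; rewrite ?addr0 ?add0r //;
   have := H isT.
Qed.

Lemma tdist_triangle l u c v : (forall e, 0 <= l e) ->
  tdist l u v <= tdist l u c + tdist l c v.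
Proof.
move=> l0; rewrite !tdist_if -big_split; apply: ler_sum => e _ /=.
rewrite (mem_path_set c u v) (mem_path_setC c u); have := l0 e.
by case: (e \in P u c); case: (e \in P c v) => /=; lra.
Qed.

(** An edge that splits [{x,y,z,w}] as [xz|yw] and an edge that splits it as
    [xw|yz] cannot coexist in a tree; if, say, the former kind is absent then
    the inequality holds edge by edge. *)
Lemma four_point l x y z w : (forall e, 0 <= l e) ->
  tdist l x y + tdist l z w <=
    Num.max (tdist l x z + tdist l y w) (tdist l x w + tdist l y z).
Proof.
move=> l0.
have half z' w' :
    ~~ [exists e, [&& e \in P x y, e \in P z' w' & e \notin P x z']] ->
    tdist l x y + tdist l z' w' <= tdist l x z' + tdist l y w'.
  move=> /existsPn H; rewrite !tdist_if -!big_split /=.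
  apply: ler_sum => e _; have := H e; have := l0 e.
  rewrite (mem_path_set x z' w') (mem_path_set x y w').
  by case: (e \in P x y); case: (e \in P x z'); case: (e \in P x w') => //=; lra.
rewrite le_max; have [/existsP[e /and3P[e1 e2 e3]]|/half->//] := boolP [exists e,
  [&& e \in P x y, e \in P z w & e \notin P x z]].
apply/orP; right; rewrite (tdistC l z w); apply: half; apply/existsP.
move=> [f /and3P[f1 f2 f3]].
have Hj := joins_ends ends f.
have fxz : f \in P x z by move: f2 f3; rewrite (mem_path_set x); do 2!case: (_ \in _).
have fyw : f \in P y w by move: f1 f3; rewrite (mem_path_set x y w); do 2!case: (_ \in _).
have eyw : e \notin P y w.
  move: e1 e2 e3; rewrite (mem_path_set x y w) (mem_path_set x z w).
  by do 3!case: (_ \in _).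
have e4 := edge_side Hj fxz e3; have e5 := edge_side Hj fyw eyw.
move: e1 e4 e5; rewrite (mem_path_set x y).
by do 2!case: (_ \in _).
Qed.

End Metric.

(** * When two vertices form a 2-maxian *)

Section Maxian.
Variables (R : realFieldType) (l : 'I_m -> R) (w : 'I_n -> R).
Hypotheses (l0 : forall e, 0 <= l e) (w0 : forall v, 0 <= w v).
Local Notation d := (tdist l).
Implicit Types (a b c t u v : 'I_n) (x y : point n m R).

Definition farthest (l' : 'I_m -> R) c t := forall u, tdist l' c u <= tdist l' c t.

(** A point in an edge is never farther from a vertex than the more distant
    end of this edge. *)
Lemma vdist_le v x (M : R) : in_tree l x -> (forall u, d v u <= M) ->
  vdist ends l v x <= M.
Proof.
case: x => [u _ H|e s /= /andP[s0 sl] H]; first by rewrite /= distE.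
rewrite ge_min !distE //; have Hj := joins_ends ends e.
have D1 := tdist_triangle v (ends e).1 (ends e).2 l0.
have D2 := tdist_triangle v (ends e).2 (ends e).1 l0.
rewrite (tdist_joins l Hj) in D1; rewrite (tdistC _ (ends e).2) (tdist_joins _ Hj) in D2.
have M1 := H (ends e).1; have M2 := H (ends e).2.
have [par [pe [D HR]]] := rooting_exists v Htree m0.
have [y yv Ee] := pe_onto HR e; have Hy := pe_joins HR yv.
have dy : d v y = l e + d v (par y).
  rewrite /tdist (bigD1 e) /=; last first.
    by rewrite (mem_path_set_from_root Htree HR) Ee (mem_root_edges HR) ?connect0.
  congr (_ + _); apply: eq_bigl => f.
  rewrite !(mem_path_set_from_root Htree HR) (root_edges_par HR f yv) -Ee.
  have [->|_] := eqVneq f e; last by rewrite andbT.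
  by rewrite Ee (pe_notin_root_edges HR yv) andbF.
rewrite -Ee in Hy; have M3 := H y.
case: (joins_inj Hj Hy) => -[E1 E2]; apply/orP.
  by right; rewrite E2; lra.
by left; rewrite E1; lra.
Qed.

Lemma sum_of_max_le x y (M : 'I_n -> R) : in_tree l x -> in_tree l y ->
  (forall v u, 0 < w v -> d v u <= M v) ->
  sum_of_max ends l w x y <= \sum_v w v * M v.
Proof.
move=> Hx Hy H; apply: ler_sum => v _; have := w0 v.
rewrite le_eqVlt => /orP[/eqP<-|wv]; first by rewrite !mul0r.
rewrite ler_pM2l // ge_max !vdist_le // => u; exact: H.
Qed.

(** Every vertex has one of the ends of a longest path as a farthest vertex, so
    these ends reach the upper bound [sum_of_max_le] and a 2-maxian must reach
    it term by term. *)
Lemma is_2maxianP a b : a != b ->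
  is_2maxian ends l w (Vertex a) (Vertex b) <->
  (forall v u, 0 < w v -> d v u <= Num.max (d v a) (d v b)).
Proof.
move=> ab; have somE u1 u2 : sum_of_max ends l w (Vertex u1) (Vertex u2) =
    \sum_v w v * Num.max (d v u1) (d v u2).
  by apply: eq_bigr => v _; rewrite /= !distE.
split=> [[_ _ _ Hmax] v u wv|H]; last first.
  split=> // [[E]|x y Hx Hy _]; first by rewrite E eqxx in ab.
  by rewrite somE; apply: sum_of_max_le.
pose Q (p : 'I_n * 'I_n) := p.1 != p.2.
have [[u1 u2] /= u12 Hdiam] := @arg_maxP _ _ _ (a, b) Q (fun p => d p.1 p.2) ab.
have diam p q : d p q <= d u1 u2.
  have [->|pq] := eqVneq p q; first by rewrite tdist_refl tdist_ge0.
  exact: (Hdiam (p, q)).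
have ecc p q : d p q <= Num.max (d p u1) (d p u2).
  have := four_point p q u1 u2 l0; rewrite !le_max.
  have := diam q u1; have := diam q u2 => D1 D2 /orP[] H; apply/orP.
    by left; lra.
  by right; lra.
have u12' : Vertex u1 <> Vertex u2 :> point n m R.
  by case=> E; move: u12; rewrite /Q /= E eqxx.
have := Hmax (Vertex u1) (Vertex u2) I I u12'; rewrite !somE => Hle.
apply: contraTT Hle; rewrite -!ltNge gt_max => /andP[Ha Hb].
rewrite (bigD1 v) // [ltRHS](bigD1 v) //=; apply: ltr_leD.
  rewrite ltr_pM2l //; apply: lt_le_trans (ecc v u).
  by rewrite gt_max Ha Hb.
apply: ler_sum => z _; apply: ler_wpM2l => //.
by rewrite ge_max !ecc.
Qed.

(** [c] is where the paths from [t] enter the subtree spanned by the vertices of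
    positive weight. *)
Definition gate c t := (forall v, 0 < w v -> between v c t) /\
  (forall u, exists2 v, 0 < w v & between v c u).

Lemma gate_farthest c t : gate c t ->
  (forall v, 0 < w v -> farthest l v t) <-> farthest l c t.
Proof.
case=> Ht Hu; split=> [H u|H v wv u].
  have [v wv Hv] := Hu u; have := H v wv u.
  by rewrite (tdist_between _ Hv) (tdist_between _ (Ht v wv)) lerD2l.
rewrite (tdist_between _ (Ht v wv)).
apply: le_trans (tdist_triangle v c u l0) _; by rewrite lerD2l.
Qed.

(** If all positive weights are at vertices for which [b] is at least as far as
    [a], then [b] alone has to be farthest, and symmetrically. Otherwise
    positive weights on both sides of the midpoint force the path from [a] to
    [b] to be a longest path. *)
Lemma is_2maxian_cases a b ca cb : a != b -> gate ca a -> gate cb b ->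
  is_2maxian ends l w (Vertex a) (Vertex b) <->
  [\/ farthest l cb b, farthest l ca a | farthest l a b /\ farthest l b a].
Proof.
move=> ab Ga Gb; rewrite is_2maxianP //; split; last first.
  case=> [/(gate_farthest Gb)H|/(gate_farthest Ga)H|[Hab Hba]] v u wv.
  - by rewrite le_max (H v wv u) orbT.
  - by rewrite le_max (H v wv u).
  have := four_point v u a b l0; rewrite !le_max.
  have := Hab u; have := Hba u; rewrite !(tdistC l u) (tdistC l b a).
  by move=> D1 D2 /orP[] D3; apply/orP; [left|right]; lra.
move=> H.
have [/forallP Hb|/forallPn[v2]] :=
    boolP [forall v, (0 < w v) ==> (d v a <= d v b)].
  apply: Or31; apply/(gate_farthest Gb) => v wv u.
  have /implyP/(_ wv) := Hb v; have := H v u wv; rewrite le_max.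
  by case/orP => // D1 D2; lra.
rewrite negb_imply -ltNge => /andP[w2 D2].
have [/forallP Ha|/forallPn[v1]] :=
    boolP [forall v, (0 < w v) ==> (d v b <= d v a)].
  apply: Or32; apply/(gate_farthest Ga) => v wv u.
  have /implyP/(_ wv) := Ha v; have := H v u wv; rewrite le_max.
  by case/orP => // D1 D3; lra.
rewrite negb_imply -ltNge => /andP[w1 D1].
apply: Or33.
have far2 u : d v2 u <= d v2 a.
  by have := H v2 u w2; rewrite le_max => /orP[] // D; lra.
have far1 u : d v1 u <= d v1 b.
  by have := H v1 u w1; rewrite le_max => /orP[] // D; lra.
have A u : d a u <= d a b \/ d a u < d b u.
  have := four_point a u v1 b l0; rewrite le_max (tdistC l a v1) (tdistC l u b).
  rewrite (tdistC l u v1); have := far1 u.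
  by move=> F /orP[] D; [right|left]; lra.
have B u : d b u <= d a b \/ d b u < d a u.
  have := four_point b u v2 a l0; rewrite le_max (tdistC l b v2) (tdistC l u a).
  rewrite (tdistC l u v2) (tdistC l b a); have := far2 u.
  by move=> F /orP[] D; [right|left]; lra.
by split=> u; have := A u; have := B u; rewrite ?(tdistC l b a);
   case=> ? [] ?; lra.
Qed.

End Maxian.
End TreePaths.

(** In a tree rooted at [t] the gate is the lowest common ancestor of the
    vertices of positive weight. *)
Lemma gate_lca (n m : nat) (ends : 'I_m -> 'I_n * 'I_n) (R : realFieldType)
    (w : 'I_n -> R) (t c : 'I_n) par pe depth :
  is_tree ends -> rooting ends t par pe depth -> (exists v, 0 < w v) ->
  (forall v, 0 < w v -> fconnect par v c) ->
  (forall x, x != t -> par x = c -> exists2 v, 0 < w v & ~~ fconnect par v x) ->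
  gate ends w c t.
Proof.
move=> Htree HR [v0 wv0] Hc Hch; split=> [v wv e|u].
  rewrite !(mem_path_set_root Htree HR) (root_edges_root HR) inE addbF.
  have [y yt ->] := pe_onto HR e; rewrite !(mem_root_edges HR) //.
  apply: contraL => Hy; rewrite Hy addbT negbK.
  exact: connect_trans (Hc v wv) Hy.
(* [v] is chosen outside the branch below [c] that contains [u], if any. *)
have [v wv Hv] : exists2 v, 0 < w v & forall x, x != t -> par x = c ->
    fconnect par u x -> ~~ fconnect par v x.
  have [/existsP[x /and3P[xt /eqP xc xu]]|/existsPn no] := boolP
    [exists x, [&& x != t, par x == c & fconnect par u x]].
    have [v wv vx] := Hch x xt xc; exists v => // x' x't x'c x'u.
    suff -> : x' = x by [].
    have sib p q : p != t -> q != t -> par p = c -> par q = c ->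
        fconnect par p q -> q = p.
      move=> pt qt pc qc; rewrite (anc_par par) => /orP[/eqP//|].
      by rewrite pc -qc (not_anc_par HR).
    by case/orP: (anc_chain x'u xu) => /sib -> //.
  exists v0 => // x xt xc xu; have := no x.
  by rewrite xt xc xu eqxx.
exists v => // e; rewrite !(mem_path_set_root Htree HR).
have [y yt ->] := pe_onto HR e; rewrite !(mem_root_edges HR) //.
have [cy|ncy] /= := boolP (fconnect par c y).
  by rewrite (connect_trans (Hc v wv) cy).
rewrite addbF => vy; apply/negP => uy.
have : fconnect par y c.
  by have := anc_chain (Hc v wv) vy; rewrite (negPf ncy) orbF.
have [k] := ubnP (depth y); elim: k y yt ncy vy uy => // k IHk y yt ncy vy uy Hk.
rewrite (anc_par par) => /orP[/eqP cy|pyc].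
  by rewrite cy connect0 in ncy.
have [Ep|npc] := eqVneq (par y) c.
  by have := Hv y yt Ep uy; rewrite vy.
have pyt : par y != t.
  by apply: contraNneq npc => E; move: pyc; rewrite E (anc_root HR) eq_sym.
have up z : fconnect par z y -> fconnect par z (par y).
  by move=> zy; apply: connect_trans zy _; exact: fconnect1.
apply: (IHk (par y)) => //; try exact: up.
  apply/negP => /(depth_anc HR).
  move: pyc; rewrite (anc_par par) eq_sym (negPf npc) /= => /(depth_anc HR).
  by have := depth_par HR pyt; lia.
by have := depth_par HR yt; lia.
Qed.

(** * Reduction of the inverse problem to thresholds *)

Section Inverse.
Variables (R : realFieldType) (I : instance R).
Hypothesis Hvalid : valid_instance I.
Local Notation n := (nv I).
Local Notation m := (ne I).
Local Notation P := (path_set (@ends R I)).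
Local Notation a := (pa I).
Local Notation b := (pb I).
Local Notation farther l := (farthest (@ends R I) l).
Implicit Types (x y : 'I_m -> R) (theta : R).

Lemma valid_tree : is_tree (@ends R I). Proof. by case: Hvalid. Qed.
Lemma valid_ne0 : (0 < m)%N.
Proof. by case: Hvalid => Ht _ _ _ /(tree_ne_gt0 Ht). Qed.
Lemma valid_ab : a != b. Proof. by case: Hvalid. Qed.
Lemma wgt_ge0 v : 0 <= @wgt R I v. Proof. by case: Hvalid => _ []. Qed.
Lemma len_ge0 e : 0 <= @len R I e. Proof. by case: Hvalid => _ []. Qed.
Lemma ubd_ge0 e : 0 <= @ubd R I e. Proof. by case: Hvalid => _ []. Qed.
Lemma cst_ge0 e : 0 <= @cst R I e. Proof. by case: Hvalid => _ []. Qed.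

(** A goal [((c1, t1), (c2, t2))] asks that [t1] be farthest from [c1] and [t2]
    from [c2], where both pairs are joined by the same path. *)
Definition goal := (('I_n * 'I_n) * ('I_n * 'I_n))%type.
Implicit Type g : goal.

Definition one_path g := P g.1.1 g.1.2 = P g.2.1 g.2.2.

Definition reached g (l : 'I_m -> R) :=
  farther l g.1.1 g.1.2 /\ farther l g.2.1 g.2.2.

(** The largest modifications of edges of cost at most [theta] that bring [g]
    nearer. An edge of the path from [a] to [b] can only grow, which helps on
    the path of the goal and is harmful elsewhere; for the other edges it is
    the converse. *)
Definition plan theta g e : R :=
  if cst e <= theta then
    if e \in P a b then if e \in P g.1.1 g.1.2 then ubd e else 0
    else if e \in P g.1.1 g.1.2 then 0 else Num.min (ubd e) (len e)
  else 0.

Definition achieves theta g := reached g (new_len (plan theta g)).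

Lemma plan_bounds theta g e : 0 <= plan theta g e <= ubd e.
Proof.
rewrite /plan; have u0 := ubd_ge0 e; have l0 := len_ge0 e.
by do 3?case: ifP => _; rewrite ?lexx ?u0 //= ?le_min ?ge_min ?lexx ?u0 ?l0.
Qed.

Lemma new_len_plan_ge0 theta g e : 0 <= new_len (plan theta g) e.
Proof.
rewrite /new_len /plan; have u0 := ubd_ge0 e; have l0 := len_ge0 e.
have lm : 0 <= len e - Num.min (ubd e) (len e).
  by rewrite subr_ge0 ge_min lexx orbT.
by case: (cst e <= theta); case: (e \in P a b); case: (e \in P g.1.1 g.1.2); lra.
Qed.

Lemma hamming_cost_plan theta g : 0 <= theta ->
  hamming_cost (plan theta g) <= theta.
Proof.
move=> t0; apply/bigmax_leP; split=> // e _; rewrite /nonzero_ind.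
case: eqP => [_|]; first by rewrite mulr0.
by rewrite mulr1 /plan; case: ifP.
Qed.

Lemma hamming_cost_eq0 y theta (e : 'I_m) : hamming_cost y <= theta ->
  theta < cst e -> y e = 0.
Proof.
move=> /bigmax_leP[_ /(_ e isT)]; rewrite /nonzero_ind; case: eqP => // _.
by rewrite mulr1 => /le_lt_trans H /H; rewrite ltxx.
Qed.

Lemma hamming_cost_threshold y :
  hamming_cost y = 0 \/ exists e : 'I_m, hamming_cost y = cst e.
Proof.
rewrite /hamming_cost; elim/big_ind: _ => [|s t Hs Ht|e _]; first by left.
  by rewrite /Num.max; case: ifP.
by rewrite /nonzero_ind; case: eqP => _; rewrite ?mulr0 ?mulr1; [left|right; exists e].
Qed.

(** Longer edges on the path from [c] to [t] and shorter ones elsewhere keep [t]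
    farthest from [c]. *)
Lemma farthest_mono (l l' : 'I_m -> R) c t :
  (forall e, if e \in P c t then l e <= l' e else l' e <= l e) ->
  farther l c t -> farther l' c t.
Proof.
move=> H F u; rewrite -(lerD2r (tdist (@ends R I) l c t)).
apply: (@le_trans _ _ (tdist (@ends R I) l' c t + tdist (@ends R I) l c u)).
  rewrite !tdist_if -!big_split; apply: ler_sum => e _ /=.
  by have := H e; case: (_ \in P c t); case: (_ \in P c u); lra.
by rewrite lerD2l.
Qed.

(** A goal that some modification [y] of cost at most [theta] reaches is also
    reached by the plan, which dominates [y] edge by edge. *)
Lemma achieves_le y theta g : one_path g ->
  (forall e, 0 <= y e <= ubd e) -> (forall e, 0 <= new_len y e) ->
  hamming_cost y <= theta -> reached g (new_len y) -> achieves theta g.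
Proof.
move=> Hg yb y0 yc [F1 F2].
have dom e : if e \in P g.1.1 g.1.2 then new_len y e <= new_len (plan theta g) e
             else new_len (plan theta g) e <= new_len y e.
  have := y0 e; have /andP[ye0 yeu] := yb e.
  have := @hamming_cost_eq0 y theta e yc.
  rewrite /new_len /plan ltNge.
  have [Ht _|_ /(_ isT)->] := boolP (cst e <= theta); last first.
    by case: (e \in P g.1.1 g.1.2); case: (e \in P a b); lra.
  case: (e \in P g.1.1 g.1.2); case: (e \in P a b) => ?; try lra.
  by rewrite lerD2l lerN2 le_min yeu; lra.
split; first exact: farthest_mono F1.
by apply: farthest_mono F2 => e; rewrite -Hg; exact: dom.
Qed.

Lemma achieves_mono theta theta' g : one_path g -> 0 <= theta ->
  theta <= theta' -> achieves theta g -> achieves theta' g.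
Proof.
move=> Hg t0 tt; apply: achieves_le => //.
- exact: plan_bounds.
- exact: new_len_plan_ge0.
- exact: le_trans (hamming_cost_plan _ t0) tt.
Qed.

Definition threshold theta := theta = 0 \/ exists e : 'I_m, theta = cst e.

Lemma threshold_ge0 theta : threshold theta -> 0 <= theta.
Proof. by case=> [->//|[e ->]]; exact: cst_ge0. Qed.

Section Gates.
Variables ca cb : 'I_n.
Hypotheses (Ga : gate (@ends R I) (@wgt R I) ca a)
           (Gb : gate (@ends R I) (@wgt R I) cb b).

Definition goals : seq goal :=
  [:: ((cb, b), (cb, b)); ((ca, a), (ca, a)); ((a, b), (b, a))].

Lemma goals_one_path g : g \in goals -> one_path g.
Proof.
rewrite !inE => /or3P[]/eqP-> //.
exact: (path_setC valid_tree valid_ne0).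
Qed.

Lemma maxian_goals l : (forall e, 0 <= l e) ->
  is_2maxian (@ends R I) l (@wgt R I) (Vertex a) (Vertex b) <->
  exists2 g, g \in goals & reached g l.
Proof.
move=> l0.
rewrite (is_2maxian_cases valid_tree valid_ne0 l0 wgt_ge0 valid_ab Ga Gb).
split=> [[F|F|F]|[g]].
- by exists ((cb, b), (cb, b)); rewrite ?inE ?eqxx.
- by exists ((ca, a), (ca, a)); rewrite ?inE ?eqxx ?orbT.
- by exists ((a, b), (b, a)); rewrite ?inE ?eqxx ?orbT.
by rewrite !inE => /or3P[]/eqP-> [? ?]; [apply: Or31|apply: Or32|apply: Or33].
Qed.

Definition solvable theta := exists2 g, g \in goals & achieves theta g.

Lemma solvable_mono theta theta' : 0 <= theta -> theta <= theta' ->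
  solvable theta -> solvable theta'.
Proof.
move=> t0 tt [g Hg H]; exists g => //.
exact: achieves_mono (goals_one_path Hg) t0 tt H.
Qed.

Lemma feasible_solvable y : feasible y -> solvable (hamming_cost y).
Proof.
case=> yb y0 /(maxian_goals y0)[g Hg H]; exists g => //.
exact: achieves_le (goals_one_path Hg) yb y0 (lexx _) H.
Qed.

Section Achieved.
Variables (theta : R) (g : goal) (x : 'I_m -> R).
Hypotheses (Hg : g \in goals) (ach : achieves theta g) (xE : x =1 plan theta g).

Lemma achieves_feasible : feasible x.
Proof.
have lE e : new_len x e = new_len (plan theta g) e by rewrite /new_len xE.
have l0 e : 0 <= new_len x e by rewrite lE new_len_plan_ge0.
split=> //; first by move=> e; rewrite xE plan_bounds.
apply/(maxian_goals l0); exists g => //.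
by case: ach => F1 F2; split; [move: F1|move: F2]; apply: farthest_mono => e;
   rewrite lE lexx if_same.
Qed.

Lemma achieves_optimal : threshold theta ->
  (forall theta', threshold theta' -> theta' < theta -> ~ solvable theta') ->
  optimal x.
Proof.
move=> Ht least; split; first exact: achieves_feasible.
have xc : hamming_cost x = hamming_cost (plan theta g).
  by apply: eq_bigr => e _; rewrite xE.
move=> y Hy; rewrite xc.
apply: le_trans (hamming_cost_plan _ (threshold_ge0 Ht)) _.
rewrite leNgt; apply/negP => /(least _ (hamming_cost_threshold y)); apply.
exact: feasible_solvable.
Qed.

End Achieved.

Lemma unsolvable_infeasible y :
  (forall theta, threshold theta -> ~ solvable theta) -> ~ feasible y.
Proof.
move=> no /feasible_solvable; exact: no (hamming_cost_threshold y).
Qed.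

End Gates.

Lemma weightless_optimal x : (forall v, ~ 0 < @wgt R I v) ->
  (forall e, x e = 0) -> optimal x.
Proof.
move=> W0 x0; have nl e : new_len x e = len e.
  by rewrite /new_len x0 addr0 subr0 if_same.
split.
  split=> [e|e|]; first by rewrite x0 lexx ubd_ge0.
    by rewrite nl len_ge0.
  have nl0 e : 0 <= new_len x e by rewrite nl len_ge0.
  apply/(is_2maxianP valid_tree valid_ne0 nl0 wgt_ge0 valid_ab) => v u wv.
  by case: (W0 v).
move=> y _; have y0 : 0 <= hamming_cost y by exact: bigmax_ge_id.
apply/bigmax_leP; split=> // e _.
by rewrite /nonzero_ind x0 eqxx mulr0.
Qed.

End Inverse.

Close Scope ring_scope.
Local Open Scope nat_scope.

(** * Programs with counted loops *)

(** [PFor K kb ib p] runs [p] as many times as cell [ib] of array [kb] says on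
    entry, with cell 0 of array [K] counting down to 0. Such programs halt on
    every input, so their meaning is a function on states, and their running
    time is bounded by an expression in the values of the loop bounds. *)
Inductive prog :=
  | PSkip
  | PN of nat & nexp & nexp
  | PR of nat & nexp & rexp
  | PSeq of prog & prog
  | PIf of bexp & prog & prog
  | PFor of nat & nat & nat & prog.

Definition at0 (k : nat) : nexp := NGet k (NConst 0).

Fixpoint code (p : prog) : cmd :=
  match p with
  | PSkip => Skip
  | PN k i e => NSet k i e
  | PR k i e => RSet k i e
  | PSeq p q => Seq (code p) (code q)
  | PIf b p q => If b (code p) (code q)
  | PFor k kb ib p =>
      Seq (NSet k (NConst 0) (NGet kb (NConst ib)))
        (While (BLeN (NConst 1) (at0 k))
           (Seq (NSet k (NConst 0) (NSub (at0 k) (NConst 1))) (code p)))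
  end.

Fixpoint nwrites (p : prog) : seq nat :=
  match p with
  | PSkip | PR _ _ _ => [::]
  | PN k _ _ => [:: k]
  | PSeq p q | PIf _ p q => nwrites p ++ nwrites q
  | PFor k _ _ p => k :: nwrites p
  end.

Fixpoint rwrites (p : prog) : seq nat :=
  match p with
  | PSkip | PN _ _ _ => [::]
  | PR k _ _ => [:: k]
  | PSeq p q | PIf _ p q => rwrites p ++ rwrites q
  | PFor _ _ _ p => rwrites p
  end.

Fixpoint bounds (p : prog) : seq nat :=
  match p with
  | PSkip | PN _ _ _ | PR _ _ _ => [::]
  | PSeq p q | PIf _ p q => bounds p ++ bounds q
  | PFor _ kb _ p => kb :: bounds p
  end.

Fixpoint counters_safe (p : prog) : bool :=
  match p with
  | PSkip | PN _ _ _ | PR _ _ _ => true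
  | PSeq p q | PIf _ p q => counters_safe p && counters_safe q
  | PFor k _ _ p => (k \notin nwrites p) && counters_safe p
  end.

Definition bounds_safe (p : prog) : bool :=
  all (fun k => k \notin nwrites p) (bounds p).

Section Meaning.
Variable R : realFieldType.
Local Notation state := (state R).
Implicit Types (s : state) (p : prog).

Definition setn k i x s : state := State (update (nmem s) k i x) (rmem s).
Definition setr k i x s : state := State (nmem s) (update (rmem s) k i x).

Fixpoint countdown (f : state -> state) k j s : state :=
  if j is j'.+1 then countdown f k j' (f (setn k 0 j' s)) else s.

Fixpoint sem (p : prog) (s : state) : state :=
  match p with
  | PSkip => s
  | PN k i e => setn k (neval s i) (neval s e) s
  | PR k i e => setr k (neval s i) (reval s e) s
  | PSeq p q => sem q (sem p s)
  | PIf b p q => if beval s b then sem p s else sem q s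
  | PFor k kb ib p =>
      countdown (sem p) k (nmem s kb ib) (setn k 0 (nmem s kb ib) s)
  end.

Lemma sem_seq p q s : sem (PSeq p q) s = sem q (sem p s).
Proof. by []. Qed.

Lemma sem_ifT b p q s : beval s b -> sem (PIf b p q) s = sem p s.
Proof. by move=> /= ->. Qed.

Lemma sem_ifF b p q s : ~~ beval s b -> sem (PIf b p q) s = sem q s.
Proof. by move=> /= /negPf->. Qed.

Definition unchanged p s s' : Prop :=
  (forall k i, k \notin nwrites p -> nmem s' k i = nmem s k i) /\
  (forall k i, k \notin rwrites p -> rmem s' k i = rmem s k i).

Lemma update_neq (T : Type) (f : nat -> nat -> T) k i x k' i' :
  k' != k -> update f k i x k' i' = f k' i'.
Proof. by rewrite /update => /negPf->. Qed.

Lemma sem_unchanged p s : unchanged p s (sem p s).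
Proof.
elim: p s => [|k i e|k i e|p IHp q IHq|b p IHp q IHq|k kb ib p IHp] s /=.
- by split.
- by split=> k' i' //; rewrite inE => kk; exact: update_neq.
- by split=> k' i' //; rewrite inE => kk; exact: update_neq.
- split=> k' i'; rewrite mem_cat negb_or => /andP[kp kq].
    by rewrite (IHq _).1 // (IHp _).1.
  by rewrite (IHq _).2 // (IHp _).2.
- split=> k' i'; rewrite mem_cat negb_or => /andP[kp kq]; case: ifP => _.
  + by rewrite (IHp _).1.
  + by rewrite (IHq _).1.
  + by rewrite (IHp _).2.
  + by rewrite (IHq _).2.
move: (nmem s kb ib) => j.
split=> k' i'.
  rewrite inE negb_or => /andP[kk kp].
  have E x s1 : nmem (setn k 0 x s1) k' i' = nmem s1 k' i' by exact: update_neq.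
  rewrite -[RHS](E j); move: (setn k 0 j s) => {}s.
  by elim: j s => //= j IHj s; rewrite IHj (IHp _).1.
move=> kp; rewrite -[RHS]/(rmem (setn k 0 j s) k' i'); move: (setn k 0 j s) => {}s.
by elim: j s => //= j IHj s; rewrite IHj (IHp _).2.
Qed.

(** Induction over the iterations of a loop: [Inv j] holds when [j] of them
    remain. *)
Lemma for_ind (Inv : nat -> state -> Prop) k kb ib p s :
  k \notin nwrites p ->
  Inv (nmem s kb ib) (setn k 0 (nmem s kb ib) s) ->
  (forall j x s', Inv j s' -> Inv j (setn k 0 x s')) ->
  (forall j s', j < nmem s kb ib -> unchanged (PFor k kb ib p) s s' ->
     nmem s' k 0 = j -> Inv j.+1 s' -> Inv j (sem p s')) ->
  Inv 0 (sem (PFor k kb ib p) s).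
Proof.
move=> kp H0 Hk Hstep /=.
have Hu : unchanged (PFor k kb ib p) s (setn k 0 (nmem s kb ib) s).
  by split=> k' i' //=; rewrite inE negb_or => /andP[kk _]; exact: update_neq.
have trans s1 s2 : unchanged (PFor k kb ib p) s s1 ->
    unchanged p s1 s2 -> unchanged (PFor k kb ib p) s s2.
  move=> [u1 u2] [v1 v2]; split=> k' i' Hk'; last by rewrite v2 // u2.
  by rewrite v1 ?u1 //; move: Hk'; rewrite /= inE negb_or => /andP[].
suff go j s1 : j <= nmem s kb ib -> Inv j s1 ->
    unchanged (PFor k kb ib p) s s1 -> Inv 0 (countdown (sem p) k j s1).
  exact: go.
elim: j s1 => //= j IHj s1 Hj H1 U1; set s2 := setn k 0 j s1.
have U2 : unchanged (PFor k kb ib p) s s2.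
  split=> k' i' Hk'; last exact: U1.2.
  rewrite -U1.1 //; apply: update_neq.
  by move: Hk'; rewrite /= inE negb_or => /andP[].
apply: IHj; first exact: ltnW.
  by apply: Hstep => //; [rewrite /= /update !eqxx|exact: Hk].
exact: trans U2 (sem_unchanged p s2).
Qed.

(** [env] gives the values of the loop bounds. Of the 9 operations of a loop 4
    load the counter and 5 make the last test; of the 11 operations that each
    iteration adds to its body 4 test the counter, 6 decrease it, and the last
    one is the step of the loop itself. *)
Fixpoint time_bound (env : nat -> nat -> nat) (p : prog) : nat :=
  match p with
  | PSkip => 1
  | PN _ i e => (ncost i + ncost e).+1
  | PR _ i e => (ncost i + rcost e).+1
  | PSeq p q => time_bound env p + time_bound env q
  | PIf b p q => (bcost b + (time_bound env p + time_bound env q)).+1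
  | PFor _ kb ib p => 9 + env kb ib * (11 + time_bound env p)
  end.

(** [ws] contains the arrays that some enclosing program writes, none of which
    may serve as a loop bound. *)
Lemma code_exec_within (ws : seq nat) (env : nat -> nat -> nat) p s :
  counters_safe p -> {subset nwrites p <= ws} ->
  all (fun k => k \notin ws) (bounds p) ->
  (forall k i, k \in bounds p -> nmem s k i = env k i) ->
  exists2 t, exec (code p) s (sem p s) t & t <= time_bound env p.
Proof.
elim: p s => [|k i e|k i e|p IHp q IHq|b p IHp q IHq|k kb ib p IHp] s /=.
- by move=> *; exists 1 => //; exact: ExecSkip.
- by move=> *; exists (ncost i + ncost e).+1 => //; exact: ExecNSet.
- by move=> *; exists (ncost i + rcost e).+1 => //; exact: ExecRSet.
- move=> /andP[cp cq] sub; rewrite all_cat => /andP[bp bq] Henv.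
  have subp k : k \in nwrites p -> k \in ws.
    by move=> kp; apply: sub; rewrite mem_cat kp.
  have subq k : k \in nwrites q -> k \in ws.
    by move=> kq; apply: sub; rewrite mem_cat kq orbT.
  have [tp ep lp] : exists2 t, exec (code p) s (sem p s) t & t <= time_bound env p.
    by apply: (IHp _ cp subp bp) => k i kp; apply: Henv; rewrite mem_cat kp.
  have [tq eq lq] : exists2 t, exec (code q) (sem p s) (sem q (sem p s)) t &
      t <= time_bound env q.
    apply: (IHq _ cq subq bq) => k i kq.
    rewrite (sem_unchanged p s).1 ?Henv ?mem_cat ?kq ?orbT //.
    by apply: contra (allP bq k kq) => /subp.
  by exists (tp + tq); [exact: ExecSeq ep eq|exact: leq_add].
- move=> /andP[cp cq] sub; rewrite all_cat => /andP[bp bq] Henv.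
  have [t et lt] : exists2 t, exec (if beval s b then code p else code q) s
      (if beval s b then sem p s else sem q s) t &
      t <= time_bound env p + time_bound env q.
    case: (beval s b).
      case: (IHp s cp _ bp) => [k kp|k i kp|t et lt].
      - by apply: sub; rewrite mem_cat kp.
      - by apply: Henv; rewrite mem_cat kp.
      by exists t; last exact: leq_trans lt (leq_addr _ _).
    case: (IHq s cq _ bq) => [k kq|k i kq|t et lt].
    - by apply: sub; rewrite mem_cat kq orbT.
    - by apply: Henv; rewrite mem_cat kq orbT.
    by exists t; last exact: leq_trans lt (leq_addl _ _).
  by exists (bcost b + t).+1; [exact: ExecIf|rewrite ltnS leq_add2l].
move=> /andP[kp cp] sub /andP[kbw bp] Henv.
have subp k' : k' \in nwrites p -> k' \in ws.
  by move=> kk; apply: sub; rewrite inE kk orbT.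
set j := nmem s kb ib.
have [t et lt] : exists2 t, exec (While (BLeN (NConst 1) (at0 k))
      (Seq (NSet k (NConst 0) (NSub (at0 k) (NConst 1))) (code p)))
    (setn k 0 j s) (countdown (sem p) k j (setn k 0 j s)) t &
    t <= 5 + j * (11 + time_bound env p).
  have Hk : nmem (setn k 0 j s) k 0 = j by rewrite /= /update !eqxx.
  have Hs1 k' i : k' \in bounds p -> nmem (setn k 0 j s) k' i = env k' i.
    move=> kb'; rewrite /= update_neq; first by rewrite Henv // inE kb' orbT.
    by apply: contraNneq (allP bp k' kb') => ->; apply: sub; rewrite mem_head.
  elim: j (setn k 0 j s) Hk Hs1 => [|j IHj] s1 Hk Hs1.
    exists 5 => //; apply: (@ExecWhileFalse _ (BLeN (NConst 1) (at0 k))).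
    by rewrite /= Hk.
  set s2 := setn k 0 j s1.
  have Hs2 k' i : k' \in bounds p -> nmem s2 k' i = env k' i.
    move=> kb'; rewrite /= update_neq ?Hs1 //.
    by apply: contraNneq (allP bp k' kb') => ->; apply: sub; rewrite mem_head.
  have [tb eb lb] : exists2 t, exec (code p) s2 (sem p s2) t & t <= time_bound env p.
    by apply: (IHp _ cp subp bp).
  have [|k' i kb'|tr er lr] := IHj (sem p s2).
  - by rewrite (sem_unchanged p s2).1 //= /update !eqxx.
  - rewrite (sem_unchanged p s2).1 ?Hs2 //.
    by apply: contra (allP bp k' kb') => /subp.
  exists (4 + (6 + tb) + tr).+1; last first.
    by rewrite mulSn; lia.
  apply: (@ExecWhileTrue _ (BLeN (NConst 1) (at0 k)) _ _ (sem p s2)) => //=.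
    by rewrite Hk.
  apply: ExecSeq eb.
  have := ExecNSet s1 k (NConst 0) (NSub (at0 k) (NConst 1)).
  by rewrite /= Hk subn1.
have El : env kb ib = j by rewrite -Henv // mem_head.
exists (4 + t); last by rewrite El; lia.
apply: ExecSeq et.
exact: (ExecNSet s k (NConst 0) (NGet kb (NConst ib))).
Qed.

Lemma code_exec p s : counters_safe p -> bounds_safe p ->
  exists2 t, exec (code p) s (sem p s) t & t <= time_bound (nmem s) p.
Proof. by move=> cp bp; apply: (code_exec_within cp (fun _ => id) bp). Qed.

(** The largest product of the bounds of nested loops, which is the order of
    magnitude of the running time. *)
Fixpoint weight (env : nat -> nat -> nat) (p : prog) : nat :=
  match p with
  | PSkip | PN _ _ _ | PR _ _ _ => 1
  | PSeq p q | PIf _ p q => maxn (weight env p) (weight env q)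
  | PFor _ kb ib p => env kb ib * weight env p
  end.

Lemma weight_gt0 env p : (forall k i, 0 < env k i) -> 0 < weight env p.
Proof.
move=> env0; elim: p => //= [p IHp q _|_ p IHp q _|_ kb ib p IHp].
- by rewrite leq_max IHp.
- by rewrite leq_max IHp.
- by rewrite muln_gt0 env0.
Qed.

Lemma time_bound_weight (env env' : nat -> nat -> nat) p :
  (forall k i, k \in bounds p -> env k i <= env' k i) ->
  (forall k i, 0 < env' k i) ->
  time_bound env p <= weight env' p * time_bound (fun _ _ => 1) p.
Proof.
move=> le_env env0.
elim: p le_env => /= [|k i e|k i e|p IHp q IHq|b p IHp q IHq|k kb ib p IHp] le_env;
  rewrite ?mul1n //.
- have Hp : time_bound env p <= weight env' p * time_bound (fun _ _ => 1) p.
    by apply: IHp => k i kp; apply: le_env; rewrite mem_cat kp.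
  have Hq : time_bound env q <= weight env' q * time_bound (fun _ _ => 1) q.
    by apply: IHq => k i kq; apply: le_env; rewrite mem_cat kq orbT.
  have := weight_gt0 p env0; have := weight_gt0 q env0; nia.
- have Hp : time_bound env p <= weight env' p * time_bound (fun _ _ => 1) p.
    by apply: IHp => k i kp; apply: le_env; rewrite mem_cat kp.
  have Hq : time_bound env q <= weight env' q * time_bound (fun _ _ => 1) q.
    by apply: IHq => k i kq; apply: le_env; rewrite mem_cat kq orbT.
  have := weight_gt0 p env0; have := weight_gt0 q env0; nia.
have Hp : time_bound env p <= weight env' p * time_bound (fun _ _ => 1) p.
  by apply: IHp => k' i kp; apply: le_env; rewrite inE kp orbT.
have := le_env kb ib (mem_head _ _); have := env0 kb ib.
have := weight_gt0 p env0; set w := weight _ _ in Hp *.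
move: (env kb ib) (env' kb ib) (time_bound env p) (time_bound (fun _ _ => 1) p) Hp.
move=> x y z u Hz w0 y0 xy.
apply: (@leq_trans (9 + y * (11 + w * u))); first by rewrite leq_add2l leq_mul ?leq_add2l.
nia.
Qed.

End Meaning.

Arguments setn {R} _ _ _ _ /.
Arguments setr {R} _ _ _ _ /.
Arguments update {T} _ _ _ _ _ _ /.

(** * Memory layout *)

(** Every variable of the program is an array; scalars use cell 0 of theirs.
    Natural numbers and numbers of the field live in separate memories, so that
    the same array number may occur in both. *)

Notation SIZES := 0 (only parsing).
Notation END1 := 1 (only parsing).
Notation END2 := 2 (only parsing).
Notation FLAG := 3 (only parsing).
Notation J := 5 (only parsing).
Notation JJ := 6 (only parsing).
Notation TOTAL := 7 (only parsing).
Notation DEG := 10 (only parsing).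
Notation NBR := 11 (only parsing).
Notation INC := 12 (only parsing).
Notation CNT := 13 (only parsing).
Notation QUEUE := 14 (only parsing).
Notation PAR := 15 (only parsing).
Notation PE := 16 (only parsing).
Notation TAIL := 17 (only parsing).
Notation LCA := 18 (only parsing).
Notation ROOT := 20 (only parsing).
Notation U := 21 (only parsing).
Notation V := 22 (only parsing).

Declare Scope prog_scope.
Delimit Scope prog_scope with prog.
Notation "p ;; q" := (PSeq p q) (at level 60, right associativity) : prog_scope.
Notation "k ::= e" := (PN k (NConst 0) e) (at level 50) : prog_scope.
Local Open Scope prog_scope.
Notation incr k i e := (PN k i (NAdd (NGet k i) e)).
Notation decr k i e := (PN k i (NSub (NGet k i) e)).
Notation BEqN x y := (BAnd (BLeN x y) (BLeN y x)).
Notation for_vertices p := (PFor J SIZES 0 p).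
Notation for_edges p := (PFor J SIZES 1 p).

(** Loops count down, so the iterations that are over are those for the indices
    from [j] on. *)
Lemma sum_from (N j : nat) (F : 'I_N -> nat) (Hj : j < N) :
  \sum_(i < N | j <= i) F i = F (Ordinal Hj) + \sum_(i < N | j.+1 <= i) F i.
Proof.
rewrite (bigD1 (Ordinal Hj)) //=; congr (_ + _); apply: eq_bigl => i.
by rewrite ltn_neqAle andbC eq_sym -val_eqE.
Qed.

Lemma sum_from_end (N : nat) (F : 'I_N -> nat) : \sum_(i < N | N <= i) F i = 0.
Proof. by apply: big_pred0 => i; rewrite leqNgt ltn_ord. Qed.

Lemma array_of_ord (T : Type) (x0 : T) k (f : 'I_k -> T) (i : 'I_k) :
  array_of x0 f i = f i.
Proof. by rewrite /array_of valK. Qed.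

Section Reads.
Variables (R : realFieldType) (I : instance R).
Local Notation state := (state R).
Implicit Types s : state.

Definition reads s : Prop :=
  (forall k i, k < 3 -> nmem s k i = nmem (input I) k i) /\
  (forall k i, k < 4 -> rmem s k i = rmem (input I) k i).

Definition keeps_input p := all (leq 3) (nwrites p) && all (leq 4) (rwrites p).

Lemma reads_unchanged p s s' : keeps_input p -> unchanged p s s' ->
  reads s -> reads s'.
Proof.
case/andP=> /allP Hn /allP Hr [un ur] [rn rr]; split=> k i Hk.
  by rewrite un ?rn //; apply: contraTN Hk => /Hn; rewrite -leqNgt.
by rewrite ur ?rr //; apply: contraTN Hk => /Hr; rewrite -leqNgt.
Qed.

Lemma reads_sem p s : keeps_input p -> reads s -> reads (sem p s).
Proof. by move=> kp; apply: (reads_unchanged kp) (sem_unchanged p s). Qed.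

Section Values.
Variable s : state.
Hypothesis Hs : reads s.
Lemma read_nv : nmem s SIZES 0 = nv I. Proof. by rewrite Hs.1. Qed.
Lemma read_ne : nmem s SIZES 1 = ne I. Proof. by rewrite Hs.1. Qed.
Lemma read_pa : nmem s SIZES 2 = pa I. Proof. by rewrite Hs.1. Qed.
Lemma read_pb : nmem s SIZES 3 = pb I. Proof. by rewrite Hs.1. Qed.
Lemma read_end1 (e : 'I_(ne I)) : nmem s END1 e = (@ends R I e).1.
Proof. by rewrite Hs.1 //= array_of_ord. Qed.
Lemma read_end2 (e : 'I_(ne I)) : nmem s END2 e = (@ends R I e).2.
Proof. by rewrite Hs.1 //= array_of_ord. Qed.
Lemma read_wgt (v : 'I_(nv I)) : rmem s 0 v = wgt v.
Proof. by rewrite Hs.2 //= array_of_ord. Qed.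
Lemma read_len (e : 'I_(ne I)) : rmem s 1 e = len e.
Proof. by rewrite Hs.2 //= array_of_ord. Qed.
Lemma read_ubd (e : 'I_(ne I)) : rmem s 2 e = ubd e.
Proof. by rewrite Hs.2 //= array_of_ord. Qed.
Lemma read_cst (e : 'I_(ne I)) : rmem s 3 e = cst e.
Proof. by rewrite Hs.2 //= array_of_ord. Qed.
End Values.

(** * Counting the positive weights *)

Definition positive (v : 'I_(nv I)) : bool := (0 < wgt v)%R.

Definition count_positive : prog :=
  TOTAL ::= NConst 0;;
  for_vertices (PIf (BLeR (RGet 0 (at0 J)) RZero) PSkip
                    (incr TOTAL (NConst 0) (NConst 1))).

Lemma count_positiveP s : reads s ->
  nmem (sem count_positive s) TOTAL 0 = \sum_(v < nv I) positive v.
Proof.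
rewrite /count_positive sem_seq => Hs; set s0 := sem (_ ::= _) s.
have H1 : reads s0 by exact: reads_sem.
set s1 := sem _ s0.
pose Inv j s' := nmem s' TOTAL 0 = \sum_(v < nv I | j <= v) positive v.
suff : Inv 0 s1 by move=> ->; apply: eq_bigl => v.
apply: (@for_ind _ Inv) => //; first by rewrite /Inv (read_nv H1) sum_from_end.
move=> j s'; rewrite (read_nv H1) => Hj un EJ; rewrite /Inv.
have H' : reads s' by exact: reads_unchanged un H1.
rewrite (sum_from _ Hj) /= EJ (read_wgt H' (Ordinal Hj)) /positive ltNge.
by case: ifP => _ /= ->; rewrite ?addn1.
Qed.

End Reads.

(** * Rooting a tree by removing leaves *)

Section Peeling.
Variables (n m : nat) (ends : 'I_m -> 'I_n * 'I_n).
Hypothesis Htree : is_tree ends.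
Variables (t : 'I_n) (par : 'I_n -> 'I_n) (pe : 'I_n -> 'I_m).
Variable depth : 'I_n -> nat.
Hypothesis HR : rooting ends t par pe depth.
Implicit Types (S : {set 'I_n}) (u v x y : 'I_n).

Lemma par_neq v : v != t -> par v != v.
Proof.
by move=> /(depth_par HR) H; apply: contraTneq H => ->; rewrite ltnn.
Qed.

Lemma card_edges : n = m.+1.
Proof.
have E : [set pe x | x in [set~ t]] = setT.
  apply/setP => e; rewrite in_setT; have [x xt ->] := pe_onto HR e.
  by apply: imset_f; rewrite !inE.
have : #|[set pe x | x in [set~ t]]| = #|[set~ t]|.
  by apply: card_in_imset => x y; rewrite !inE; exact: (pe_inj HR).
rewrite E cardsT card_ord => ->; have := cardsC1 t; rewrite card_ord => ->.
by rewrite prednK // (leq_trans _ (ltn_ord t)).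
Qed.

(** What the edges that join the vertices of [S] to their parents contribute to
    [v], when an edge [e] contributes [F e u] to the end opposite to [u]. *)
Definition star (F : 'I_m -> 'I_n -> nat) S v :=
  \sum_(x in S) ((x == v) * F (pe x) (par x) + (par x == v) * F (pe x) x).

Lemma star_edges F v : star F [set~ t] v =
  \sum_e (((ends e).1 == v) * F e (ends e).2 + ((ends e).2 == v) * F e (ends e).1).
Proof.
have pe_img : [set pe x | x in [set~ t]] = setT.
  apply/setP => e; rewrite in_setT; have [x xt ->] := pe_onto HR e.
  by apply: imset_f; rewrite !inE.
rewrite [RHS](eq_bigl (mem [set pe x | x in [set~ t]])); last first.
  by move=> e; rewrite /= pe_img in_setT.
rewrite big_imset /=; last by move=> x y; rewrite !inE; exact: (pe_inj HR).
apply: eq_bigr => x; rewrite !inE => xt.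
have [[<- <-]//|[<- <-]] := joins_inj (pe_joins HR xt) (joins_ends ends (pe x)).
by rewrite addnC.
Qed.

Lemma star_remove F S v x : x \in S -> v != x ->
  star F S v = (par x == v) * F (pe x) x + star F (S :\ x) v.
Proof.
by move=> xS vx; rewrite /star (big_setD1 x) //= eq_sym (negPf vx) mul0n.
Qed.

(** A leaf of what remains receives a contribution from one edge only. This is
    why sums identify its neighbour. *)
Definition childless S v := [forall x in S, par x != v].

Lemma star_childless F S v : childless S v ->
  star F S v = (v \in S) * F (pe v) (par v).
Proof.
move/forall_inP => H; rewrite /star.
have [vS|vS] := boolP (v \in S); last first.
  rewrite big1 // => x xS; rewrite (negPf (H x xS)).
  by case: eqVneq xS => [->|]; rewrite ?(negPf vS).
rewrite (big_setD1 v) //= eqxx (negPf (H v vS)) big1 ?addn0 ?mul1n //.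
move=> x; rewrite !inE => /andP[xv xS].
by rewrite (negPf xv) (negPf (H x xS)).
Qed.

Lemma star_eq1 S v : v \in S -> (star (fun _ _ => 1) S v == 1) = childless S v.
Proof.
move=> vS; apply/idP/idP => [|/star_childless->]; last by rewrite vS.
rewrite /star big_split /= (bigD1 v) //= eqxx big1 ?addn0; last first.
  by move=> x /andP[_ /negPf->].
rewrite mul1n -[X in _ == X]addn0 eqn_add2l sum_nat_eq0 => /forall_inP H.
by apply/forall_inP => x /H; case: (par x == v).
Qed.

(** A vertex of maximal depth in [S] has no child in [S]. *)
Lemma exists_childless S : t \notin S -> 0 < #|S| ->
  exists2 v, v \in S & childless S v.
Proof.
move=> tS /card_gt0P[v0 v0S]; pose P := [pred v | v \in S].
have [v /= vS Hmax] := @arg_maxnP _ v0 P depth v0S.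
exists v => //; apply/forall_inP => x xS; apply/negP => /eqP E.
have xt : x != t by apply: contraNneq tS => <-.
by have := depth_par HR xt; rewrite E ltnNge Hmax.
Qed.

Section Descendants.
Variable W : pred 'I_n.

Definition descendants v := \sum_y W y * fconnect par y v.

Lemma fconnect_children y v :
  fconnect par y v = (y == v) + \sum_(x | (x != t) && (par x == v)) fconnect par y x
  :> nat.
Proof.
have [k] := ubnP (depth y); elim: k y => // k IHk y; rewrite ltnS => Hk.
have [->|yt] := eqVneq y t.
  rewrite (anc_root HR) eq_sym big1 ?addn0 // => x /andP[xt _].
  by rewrite (anc_root HR) (negPf xt).
have E z : fconnect par y z = (y == z) + fconnect par (par y) z :> nat.
  rewrite (anc_par par) eq_sym; case: eqVneq => //= <-.
  by rewrite (not_anc_par HR).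
rewrite (eq_bigr (fun x => (y == x) + fconnect par (par y) x)); last by move=> x _.
rewrite E big_split /= IHk; last by apply: leq_trans (depth_par HR yt) Hk.
congr (_ + (_ + _)); rewrite big_mkcond (bigD1 y) //= yt eqxx /= big1 ?addn0.
  by case: (par y == v).
by move=> x xy; rewrite (eq_sym y) (negPf xy) if_same.
Qed.

Lemma descendants_children v :
  descendants v = W v + \sum_(x | (x != t) && (par x == v)) descendants x.
Proof.
rewrite /descendants exchange_big /=.
under eq_bigr => y _ do rewrite fconnect_children mulnDr big_distrr /=.
rewrite big_split /= (bigD1 v) //= eqxx muln1 big1 ?addn0 //.
by move=> y /negPf->; rewrite muln0.
Qed.

(** The number of elements of [W] that are [v] or below a child of [v] outside
    of [S]. *)
Definition counted S v := W v +
  \sum_(x | (x != t) && (par x == v)) (x \notin S) * descendants x.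

Lemma counted_childless S v : childless S v -> counted S v = descendants v.
Proof.
move/forall_inP=> H; rewrite descendants_children; congr (_ + _).
apply: eq_bigr => x /andP[_ xv]; case: (boolP (x \in S)) => [/H|_].
  by rewrite xv.
by rewrite mul1n.
Qed.

Lemma counted_remove S v x : x != t -> x \in S ->
  counted (S :\ x) v = (par x == v) * descendants x + counted S v.
Proof.
move=> xt xS; rewrite /counted addnCA; congr (_ + _).
have [E|pxv] := eqVneq (par x) v; last first.
  rewrite mul0n; apply: eq_bigr => y /andP[_ yv].
  have yx : y != x by apply: contraNneq pxv => <-.
  by rewrite !inE yx.
rewrite mul1n (bigD1 x) /= ?E ?xt ?eqxx // [in RHS](bigD1 x) /= ?E ?xt ?eqxx //.
rewrite setD11 xS mul1n mul0n add0n; congr (_ + _).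
by apply: eq_bigr => y /andP[_ yx]; rewrite !inE yx.
Qed.

Lemma counted_all v : counted [set~ t] v = W v.
Proof.
by rewrite /counted big1 ?addn0 // => x /andP[xt _]; rewrite !inE xt.
Qed.

Lemma counted_none v : counted set0 v = descendants v.
Proof. by apply: counted_childless; apply/forall_inP => x; rewrite inE. Qed.

Lemma descendants_full v :
  (descendants v == \sum_y W y) = [forall y, W y ==> fconnect par y v].
Proof.
apply/eqP/forallP => [E y|H].
  apply/implyP => Wy; apply: contraLR isT => ny.
  suff : descendants v < \sum_y W y by rewrite E ltnn.
  rewrite /descendants (bigD1 y) // [X in _ < X](bigD1 y) //= Wy (negPf ny).
  rewrite ltnS; apply: leq_sum => x _.
  by case: (W x); case: (fconnect _ _ _).
by apply: eq_bigr => y _; have := H y; case: (W y) => //= ->.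
Qed.

End Descendants.
End Peeling.

(* DEG, NBR and INC hold the number and the sum of the neighbours and the sum of
   the edges of each vertex; CNT counts the positive weights at the vertex and in
   the branches already removed below it. *)
Definition clear_stars : prog :=
  for_vertices
    (PN DEG (at0 J) (NConst 0);; PN NBR (at0 J) (NConst 0);;
     PN INC (at0 J) (NConst 0);;
     PIf (BLeR (RGet 0 (at0 J)) RZero) (PN CNT (at0 J) (NConst 0))
         (PN CNT (at0 J) (NConst 1))).

Definition fill_stars : prog :=
  for_edges
    (U ::= NGet END1 (at0 J);; V ::= NGet END2 (at0 J);;
     incr DEG (at0 U) (NConst 1);; incr DEG (at0 V) (NConst 1);;
     incr NBR (at0 U) (at0 V);; incr NBR (at0 V) (at0 U);;
     incr INC (at0 U) (at0 J);; incr INC (at0 V) (at0 J)).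

Definition push_if_leaf k : prog :=
  PIf (BAnd (BEqN (NGet DEG (at0 k)) (NConst 1)) (BNot (BEqN (at0 k) (at0 ROOT))))
      (decr TAIL (NConst 0) (NConst 1);; PN QUEUE (at0 TAIL) (at0 k)) PSkip.

Definition queue_leaves : prog :=
  TAIL ::= NGet SIZES (NConst 1);; for_vertices (push_if_leaf J).

Definition remove_leaf : prog :=
  V ::= NGet QUEUE (at0 J);; U ::= NGet NBR (at0 V);;
  PN PAR (at0 V) (at0 U);; PN PE (at0 V) (NGet INC (at0 V));;
  decr DEG (at0 U) (NConst 1);; decr NBR (at0 U) (at0 V);;
  decr INC (at0 U) (NGet INC (at0 V));;
  incr CNT (at0 U) (NGet CNT (at0 V)).

(* The queue fills array QUEUE downwards, so that the counter of the loop is the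
   position of the next leaf. *)
Definition remove_leaves : prog :=
  for_edges (remove_leaf;; push_if_leaf U);; PN PAR (at0 ROOT) (at0 ROOT).

(* Position 0 of QUEUE holds the vertex removed last, a neighbour of the root, so
   reading the queue from this end visits parents before children. *)
Definition rev_index : nexp :=
  NSub (NSub (NGet SIZES (NConst 1)) (NConst 1)) (at0 J).

Definition find_lca : prog :=
  LCA ::= at0 ROOT;;
  for_edges
    (V ::= NGet QUEUE rev_index;;
     PIf (BEqN (NGet CNT (at0 V)) (at0 TOTAL)) (LCA ::= at0 V) PSkip).

Definition root_tree : prog :=
  clear_stars;; fill_stars;; queue_leaves;; remove_leaves;; find_lca.

Section RootTree.
Variables (R : realFieldType) (I : instance R).
Hypothesis Hvalid : valid_instance I.
Local Notation state := (state R).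
Local Notation n := (nv I).
Local Notation m := (ne I).
Implicit Types s : state.
Variables (t : 'I_n) (par : 'I_n -> 'I_n) (pe : 'I_n -> 'I_m).
Variable depth : 'I_n -> nat.
Hypothesis HR : rooting (@ends R I) t par pe depth.
Local Notation W := (@positive R I).
Local Notation star := (star par pe).
Local Notation one := (fun (_ : 'I_m) (_ : 'I_n) => 1).
Local Notation nbr := (fun (_ : 'I_m) (u : 'I_n) => u : nat).
Local Notation inc := (fun (e : 'I_m) (_ : 'I_n) => e : nat).
Local Notation counted := (counted t par W).
Local Notation descendants := (descendants par W).

Lemma clear_starsP s (v : 'I_n) : reads I s ->
  let s' := sem clear_stars s in
  [/\ nmem s' DEG v = 0, nmem s' NBR v = 0, nmem s' INC v = 0 &
      nmem s' CNT v = W v].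
Proof.
move=> Hs /=.
pose Inv j s' := forall v : 'I_n, j <= v ->
  [/\ nmem s' DEG v = 0, nmem s' NBR v = 0, nmem s' INC v = 0 &
      nmem s' CNT v = W v].
suff : Inv 0 (sem clear_stars s) by exact.
rewrite /clear_stars; apply: (@for_ind _ Inv) => //.
  by move=> u; rewrite (read_nv Hs) leqNgt ltn_ord.
move=> j s'; rewrite (read_nv Hs) => Hj un EJ H u ju.
have Hs' : reads I s' by exact: reads_unchanged un Hs.
rewrite /= !EJ (read_wgt Hs' (Ordinal Hj)).
have [Eu|uj] := eqVneq (u : nat) j.
  have -> : Ordinal Hj = u by exact: val_inj.
  by rewrite /positive ltNge; case: ifP => _ /=; rewrite Eu !eqxx.
have [] : [/\ nmem s' DEG u = 0, nmem s' NBR u = 0, nmem s' INC u = 0 &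
      nmem s' CNT u = W u] by apply: H; rewrite ltn_neqAle eq_sym uj.
by case: ifP => _ /=; rewrite (negPf uj).
Qed.

Lemma fill_starsP s (v : 'I_n) : reads I s ->
  (forall v : 'I_n,
    [/\ nmem s DEG v = 0, nmem s NBR v = 0 & nmem s INC v = 0]) ->
  let s' := sem fill_stars s in
  [/\ nmem s' DEG v = star one [set~ t] v, nmem s' NBR v = star nbr [set~ t] v &
      nmem s' INC v = star inc [set~ t] v].
Proof.
move=> Hs H0 /=.
pose sum_to j (F : 'I_m -> 'I_n -> nat) (v : 'I_n) := \sum_(e < m | j <= e)
  (((ends e).1 == v) * F e (ends e).2 + ((ends e).2 == v) * F e (ends e).1).
pose Inv j s' := forall v : 'I_n, [/\ nmem s' DEG v = sum_to j one v,
  nmem s' NBR v = sum_to j nbr v & nmem s' INC v = sum_to j inc v].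
suff : Inv 0 (sem fill_stars s).
  move=> /(_ v)[-> -> ->]; rewrite !(star_edges HR).
  by split; apply: eq_bigl => e.
rewrite /fill_stars; apply: (@for_ind _ Inv) => //.
  by move=> u; rewrite /sum_to !(read_ne Hs) !sum_from_end; exact: H0.
move=> j s'; rewrite (read_ne Hs) => Hj un EJ H u.
have Hs' : reads I s' by exact: reads_unchanged un Hs.
have [D N E] := H u; rewrite /sum_to in D N E; set e := Ordinal Hj.
have [D1 N1 E1] := H (ends e).1; have [D2 N2 E2] := H (ends e).2.
have ne12 : (ends e).1 != (ends e).2.
  by case: (valid_tree Hvalid) => -[].
rewrite /= EJ (read_end1 Hs' e) (read_end2 Hs' e).
rewrite /sum_to !(sum_from _ Hj) -/e -D -N -E.
rewrite -!val_eqE /= !(eq_sym (nat_of_ord (ends e).1)) !(eq_sym (nat_of_ord (ends e).2)).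
have [u1|u1] := eqVneq (u : nat) (ends e).1.
  have u2 : (u == (ends e).2 :> nat) = false.
    by rewrite u1 val_eqE (negPf ne12).
  by rewrite -u1 u2 /=; split; lia.
by have [->|u2] := eqVneq (u : nat) (ends e).2; rewrite ?val_eqE ?(negPf ne12) /=;
   split; lia.
Qed.

Definition queued s (q : seq 'I_n) : Prop := nmem s TAIL 0 + size q = m /\
  forall i, i < size q -> nmem s QUEUE (nmem s TAIL 0 + i) = nth t q i.

(** The queue never overflows: it holds distinct vertices other than the root,
    and there are as many of these as edges. *)
Lemma size_nonroot (q : seq 'I_n) : uniq (t :: q) -> size q <= m.
Proof.
move=> /card_uniqP H; have := max_card (mem (t :: q)).
by rewrite H card_ord /= [X in _ < X](card_edges HR).
Qed.

Lemma push_if_leafP k s (q : seq 'I_n) (u : 'I_n) :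
  let s' := sem (push_if_leaf k) s in
  k \notin [:: QUEUE; TAIL] ->
  nmem s k 0 = u -> nmem s ROOT 0 = t -> queued s q -> uniq (t :: q) ->
  u \notin q ->
  queued s' (if (u != t) && (nmem s DEG u == 1) then u :: q else q).
Proof.
rewrite /push_if_leaf /= => kq Ek Et [Eq Hq] Uq uq.
rewrite Ek Et -!eqn_leq val_eqE andbC; case: ifP => [/andP[ut _]|_]; last by [].
have T0 : 0 < nmem s TAIL 0.
  have := @size_nonroot (u :: q).
  move: Uq; rewrite /= inE negb_or eq_sym ut uq => /andP[-> ->] /(_ isT).
  lia.
move: kq; rewrite !inE negb_or => /andP[_ kT].
rewrite /queued /= (negPf kT) /=.
split; first lia.
case=> [|i]; first by rewrite addn0 eqxx.
rewrite ltnS => /Hq /= <-.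
case: eqP; first lia.
by move=> _; congr (nmem s _ _); lia.
Qed.

(** The memory during the removal of leaves: [r] has been removed, [l] is the
    queue of leaves, and [j] vertices besides the root remain. *)
Definition rest (r : seq 'I_n) : {set 'I_n} := [set x | x \notin t :: r].

Record removing j s (l r : seq 'I_n) : Prop := Removing {
  rem_queue : queued s (l ++ r);
  rem_size : j + size r = m;
  rem_uniq : uniq (t :: l ++ r);
  rem_leaves : forall v, (v \in l) = (v \in rest r) && childless par (rest r) v;
  rem_up : forall v, v \in rest r -> par v != t -> par v \in rest r;
  rem_order : pairwise (fun v x => par v != x) r;
  rem_deg : forall v, v \notin r -> nmem s DEG v = star one (rest r) v;
  rem_nbr : forall v, v \notin r -> nmem s NBR v = star nbr (rest r) v;
  rem_inc : forall v, v \notin r -> nmem s INC v = star inc (rest r) v;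
  rem_cnt : forall v : 'I_n, nmem s CNT v = counted (rest r) v;
  rem_par : forall v, v \in r -> nmem s PAR v = par v /\ nmem s PE v = pe v
}.

Lemma rest_nil : rest [::] = [set~ t].
Proof. by apply/setP => x; rewrite !inE. Qed.

Lemma rest_cons v r : rest (v :: r) = rest r :\ v.
Proof. by apply/setP => x; rewrite !inE !negb_or; do 2!case: eqP. Qed.

Lemma queue_leavesP s : reads I s -> nmem s ROOT 0 = t ->
  (forall v : 'I_n, [/\ nmem s DEG v = star one [set~ t] v,
     nmem s NBR v = star nbr [set~ t] v, nmem s INC v = star inc [set~ t] v &
     nmem s CNT v = W v]) ->
  exists l, removing m (sem queue_leaves s) l [::].
Proof.
move=> Hs Et Hv; have [un _] := sem_unchanged queue_leaves s.
rewrite /queue_leaves sem_seq; set s0 := sem _ s.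
have H0 : reads I s0 by exact: reads_sem Hs.
pose P j := [pred v : 'I_n | [&& v != t, j <= v & childless par [set~ t] v]].
pose Inv j s' := exists l, [/\ queued s' l, uniq (t :: l) & l =i P j].
have [l [Ql Ul El]] : Inv 0 (sem (for_vertices (push_if_leaf J)) s0).
  apply: (@for_ind _ Inv) => //.
    exists [::]; split=> // [|v]; last by rewrite (read_nv H0) /P !inE leqNgt ltn_ord andbF.
    by split=> //=; rewrite addn0 (read_ne Hs).
  move=> j s'; rewrite (read_nv H0) => Hj un' EJ [l [Ql Ul El]].
  set v := Ordinal Hj.
  have Dv : nmem s' DEG v = star one [set~ t] v.
    by rewrite un'.1 //=; case: (Hv v).
  have Rt : nmem s' ROOT 0 = t by rewrite un'.1.
  have vl : v \notin l by rewrite El /P !inE ltnn andbF.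
  have := push_if_leafP (k := J) (u := v) isT EJ Rt Ql Ul vl.
  rewrite Dv; case: ifP => [/andP[vt D1] Qv|nv Qv]; eexists; split; try exact: Qv.
  - by move: Ul; rewrite /= inE negb_or eq_sym vt vl => /andP[-> ->].
  - move=> x; rewrite !inE El /P !inE; have [->|xv] := eqVneq x v.
      rewrite vt leqnn /=.
      by rewrite -(star_eq1 par pe) ?inE.
    by rewrite ltn_neqAle (eq_sym j) -[j]/(nat_of_ord v) val_eqE xv.
  - by [].
  move=> x; rewrite El /P !inE; have [->|xv] := eqVneq x v.
    rewrite ltnn leqnn andbF /=; case: eqVneq nv => //= vt.
    by rewrite (star_eq1 par pe) ?inE // => ->.
  by rewrite ltn_neqAle (eq_sym j) -[j]/(nat_of_ord v) val_eqE xv.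
have R0 := rest_nil.
exists l; split; rewrite ?cats0 ?addn0 ?R0 //.
- by move=> v; rewrite El /P !inE.
- by move=> v _; rewrite !inE.
- by move=> v _; rewrite un //; case: (Hv v).
- by move=> v _; rewrite un //; case: (Hv v).
- by move=> v _; rewrite un //; case: (Hv v).
by move=> v; rewrite un // counted_all; case: (Hv v).
Qed.

(** The queue does not run empty before all vertices have been removed, since
    what remains always has a leaf besides the root. *)
Lemma removing_next j s l r : removing j.+1 s l r ->
  exists l' v, l = rcons l' v.
Proof.
move=> H; case: (lastP l) H => [|l' v] H; last by exists l', v.
have [v vS cv] : exists2 v, v \in rest r & childless par (rest r) v.
  apply: (exists_childless HR); first by rewrite !inE eqxx.
  rewrite -[rest r]setCK cardsCs setCK card_ord.
  have -> : ~: rest r = [set x in t :: r] by apply/setP => x; rewrite !inE negbK.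
  have := card_size (t :: r); rewrite cardsE /=.
  rewrite subn_gt0 => /leq_ltn_trans; apply.
  by have := card_edges HR; have := rem_size H; lia.
by have := rem_leaves H v; rewrite vS cv.
Qed.

Lemma remove_leaf_mem s j (v : 'I_n) : v != t -> nmem s J 0 = j ->
  nmem s QUEUE j = v -> nmem s NBR v = par v -> nmem s INC v = pe v ->
  let s' := sem remove_leaf s in
  [/\ nmem s' U 0 = par v, nmem s' PAR v = par v /\ nmem s' PE v = pe v,
    forall x : 'I_n, x != v ->
      nmem s' PAR x = nmem s PAR x /\ nmem s' PE x = nmem s PE x,
    forall x : 'I_n, x != v ->
      [/\ nmem s' DEG x = nmem s DEG x - (par v == x),
          nmem s' NBR x = nmem s NBR x - (par v == x) * v &
          nmem s' INC x = nmem s INC x - (par v == x) * pe v] &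
    forall x : 'I_n, nmem s' CNT x = nmem s CNT x + (par v == x) * nmem s CNT v].
Proof.
move=> vt EJ EQ EN EI; rewrite /remove_leaf /= !EJ !EQ !EN !EI eqxx.
split=> // x; try by rewrite -val_eqE => /negPf->.
  move=> xv; rewrite (eq_sym (par v)) -!val_eqE /=.
  by have [->|_] := eqVneq (x : nat) (par v); split; lia.
rewrite (eq_sym (par v)) -!val_eqE /=.
by have [->|_] := eqVneq (x : nat) (par v); lia.
Qed.

(** Removing the leaf [v] turns at most its parent into a leaf, and this parent
    was not in the queue because [v] was its child. *)
Lemma remove_leavesP j s l r : reads I s -> nmem s ROOT 0 = t ->
  nmem s J 0 = j -> removing j.+1 s l r ->
  exists l' r', removing j (sem (remove_leaf;; push_if_leaf U) s) l' r'.
Proof.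
move=> Hs Et EJ H; have [l' [v El]] := removing_next H.
have vl : v \in l by rewrite El mem_rcons mem_head.
have := rem_leaves H v; rewrite vl => /esym/andP[vS cv].
have vt : v != t by move: vS; rewrite !inE => /norP[].
have vr : v \notin r by move: vS; rewrite !inE => /norP[].
have Uall := rem_uniq H.
have [Qt Qn] := rem_queue H.
have Ej : nmem s QUEUE j = v.
  have := Qn (size l'); rewrite El size_cat size_rcons addSn ltnS leq_addr.
  rewrite cat_rcons nth_cat ltnn subnn => /(_ isT) /= <-; congr (nmem s _ _).
  have := rem_size H; have := Qt; rewrite El size_cat size_rcons; lia.
have En : nmem s NBR v = par v.
  by rewrite (rem_nbr H) // star_childless // vS mul1n.
have Ei : nmem s INC v = pe v.
  by rewrite (rem_inc H) // star_childless // vS mul1n.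
case: (remove_leaf_mem vt EJ Ej En Ei) => EU [Ep Ee] Eo Es Ec.
rewrite sem_seq; set s1 := sem remove_leaf s in EU Ep Ee Eo Es Ec *.
have un : unchanged remove_leaf s s1 by exact: sem_unchanged.
clearbody s1.
have Qs1 : queued s1 (l' ++ v :: r).
  rewrite -cat_rcons -El; split; first by rewrite un.1.
  by move=> i Hi; rewrite !un.1 // Qn.
have Uq : uniq (t :: l' ++ v :: r) by rewrite -cat_rcons -El.
have upS : par v != t -> par v \in rest r by exact: (rem_up H vS).
have lS x : x \in l' -> (x \in rest r) && childless par (rest r) x.
  by move=> xl; rewrite -(rem_leaves H) El mem_rcons inE xl orbT.
have uq : par v \notin l' ++ v :: r.
  have [->|ut] := eqVneq (par v) t; first by have /andP[] := Uq.
  rewrite mem_cat inE !negb_or (par_neq HR vt) /=.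
  have := upS ut; rewrite !inE => /norP[_ ->]; rewrite andbT.
  by apply/negP => /lS/andP[_ /forall_inP/(_ v vS)]; rewrite eqxx.
have Rt1 : nmem s1 ROOT 0 = t by rewrite un.1.
have := push_if_leafP (k := U) isT EU Rt1 Qs1 Uq uq.
set b := _ && _; set s2 := sem (push_if_leaf U) s1 => Q2.
have un2 : unchanged (push_if_leaf U) s1 s2 by exact: sem_unchanged.
clearbody s2.
have stars x : x \notin v :: r ->
    [/\ nmem s1 DEG x = star one (rest (v :: r)) x,
        nmem s1 NBR x = star nbr (rest (v :: r)) x &
        nmem s1 INC x = star inc (rest (v :: r)) x].
  rewrite inE negb_or => /andP[xv xr]; have [-> -> ->] := Es x xv.
  rewrite (rem_deg H) // (rem_nbr H) // (rem_inc H) // rest_cons.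
  by rewrite !(star_remove _ _ _ vS xv) muln1 !addKn.
have Eb : b = (par v != t) && childless par (rest (v :: r)) (par v).
  rewrite /b; case: eqVneq => //= ut.
  have xr : par v \notin v :: r by move: uq; rewrite mem_cat negb_or => /andP[].
  have [-> _ _] := stars _ xr; apply: star_eq1.
  by rewrite in_set inE negb_or ut.
exists (if b then par v :: l' else l'), (v :: r); split.
- by case: (b) Q2.
- by rewrite /= addnS -addSn; exact: rem_size H.
- case: (boolP b) => Hb //; move: Uq Hb; rewrite Eb /= inE negb_or uq eq_sym.
  by move=> /andP[-> ->] /andP[->].
- move=> x; have chE : x != par v ->
      childless par (rest (v :: r)) x = childless par (rest r) x.
    move=> xu; apply/forall_inP/forall_inP => F y.
      have [->|yv] := eqVneq y v; first by rewrite eq_sym.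
      by move=> yS; apply: F; rewrite rest_cons in_setD1 yv.
    by rewrite rest_cons in_setD1 => /andP[_]; exact: F.
  have El' : x != par v -> (x \in l') =
      (x \in rest (v :: r)) && childless par (rest (v :: r)) x.
    move=> xu; rewrite chE // rest_cons in_setD1 -andbA -(rem_leaves H) El.
    rewrite mem_rcons inE; case: eqVneq => //= ->.
    by apply/negP => vl'; move: Uq; rewrite /= cat_uniq /= (has_sym) /= vl' !andbF.
  have [Ex|xu] := eqVneq x (par v); last first.
    by rewrite -El' //; case: ifP; rewrite // in_cons (negPf xu).
  have ul' : par v \notin l' by move: uq; rewrite mem_cat => /norP[].
  have Su : (par v \in rest (v :: r)) = (par v != t).
    rewrite in_set in_cons negb_or andbC.
    by move: uq; rewrite mem_cat negb_or => /andP[_ ->].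
  by rewrite Ex Su -Eb; case: ifP => _; rewrite ?in_cons ?eqxx ?(negPf ul').
- move=> x; rewrite !rest_cons !in_setD1 => /andP[xv xS] pt.
  rewrite (rem_up H) // andbT.
  by apply: contraTneq cv => <-; apply/forall_inP => /(_ x xS); rewrite eqxx.
- rewrite /= (rem_order H) andbT; apply/allP => x xr.
  have xt : x != t.
    apply: contraTneq xr => ->; apply/negP => tr.
    by move: Uall; rewrite /= mem_cat tr orbT.
  apply/eqP => Ex; move: upS; rewrite Ex => /(_ xt).
  by rewrite !inE xr orbT.
- by move=> x xr; rewrite un2.1 //; case: (stars x xr).
- by move=> x xr; rewrite un2.1 //; case: (stars x xr).
- by move=> x xr; rewrite un2.1 //; case: (stars x xr).
- move=> x; rewrite un2.1 // Ec !(rem_cnt H) rest_cons (counted_remove _ _ _ vt vS).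
  by rewrite (counted_childless HR W cv) addnC.
move=> x; rewrite inE => /orP[/eqP->|xr]; rewrite !un2.1 //.
have xv : x != v by apply: contraNneq vr => <-.
by have [-> ->] := Eo x xv; exact: rem_par H x xr.
Qed.

(** The memory holds the rooting at [t] and, in array QUEUE, the vertices other
    than [t] in an order [r] where parents precede their children. *)
Record rooted s (r : seq 'I_n) : Prop := Rooted {
  rt_size : size r = m;
  rt_uniq : uniq (t :: r);
  rt_queue : forall i, i < m -> nmem s QUEUE i = nth t r i;
  rt_order : pairwise (fun v x => par v != x) r;
  rt_par : forall v : 'I_n, nmem s PAR v = par v;
  rt_pe : forall v : 'I_n, v != t -> nmem s PE v = pe v
}.

Lemma rooted_mem s r v : rooted s r -> v != t -> v \in r.
Proof.
move=> H vt; have Ut := rt_uniq H.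
have /(_ v) : t :: r =i predT.
  apply/subset_cardP; last exact/subsetP.
  by rewrite (card_uniqP Ut) /= (rt_size H) cardT size_enum_ord (card_edges HR).
by rewrite !inE (negPf vt).
Qed.

(** A parent that came later in [r] would have been removed before its child. *)
Lemma rooted_parent_first s r i : rooted s r -> i < m ->
  par (nth t r i) = t \/ exists2 k, k < i & par (nth t r i) = nth t r k.
Proof.
move=> H im; have [|pt] := eqVneq (par (nth t r i)) t; [by left|right].
have pr := rooted_mem H pt; have sr := rt_size H.
exists (index (par (nth t r i)) r); last by rewrite nth_index.
have kr : index (par (nth t r i)) r < size r by rewrite index_mem.
rewrite ltnNge leq_eqVlt; apply/negP => /orP[/eqP E|ik].
  have it : nth t r i != t.
    apply: contraTneq (rt_uniq H) => Et; rewrite /= -{1}Et mem_nth //.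
    by rewrite sr.
  by have := par_neq HR it; rewrite {2}E nth_index // eqxx.
have := rt_order H => /(pairwiseP t)/(_ _ _ _ kr ik).
by rewrite !inE sr => /(_ im); rewrite nth_index // eqxx.
Qed.

Lemma rooted_unchanged p s s' r : {subset nwrites p <= [predC [:: QUEUE; PAR; PE]]} ->
  unchanged p s s' -> rooted s r -> rooted s' r.
Proof.
move=> sub [un _] H; have u k i : k \in [:: QUEUE; PAR; PE] ->
    nmem s' k i = nmem s k i.
  by move=> kin; apply: un; apply: contraL kin => /sub; rewrite inE.
split; try by [exact: rt_size H|exact: rt_uniq H|exact: rt_order H].
- by move=> i im; rewrite u // (rt_queue H).
- by move=> v; rewrite u // (rt_par H).
- by move=> v vt; rewrite u // (rt_pe H).
Qed.

Lemma remove_all_leavesP s l : reads I s -> nmem s ROOT 0 = t ->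
  removing m s l [::] ->
  let s' := sem remove_leaves s in
  (exists r, rooted s' r) /\ forall v : 'I_n, nmem s' CNT v = descendants v.
Proof.
move=> Hs Et H; cbv zeta.
set lp := PFor J SIZES 1 (remove_leaf;; push_if_leaf U).
rewrite /remove_leaves sem_seq -/lp.
pose Inv j s' := exists l r, removing j s' l r.
have [l' [r H']] : Inv 0 (sem lp s).
  apply: (@for_ind _ Inv) => //; last first.
  - move=> j s'; rewrite (read_ne Hs) => Hj un EJ [l1 [r1 H1]].
    have Hs' : reads I s' by exact: reads_unchanged un Hs.
    by apply: remove_leavesP H1; rewrite // un.1.
  - move=> j x s' [l1 [r1 H1]]; exists l1, r1.
    by case: H1; split.
  by rewrite (read_ne Hs); exists l, [::]; case: H; split.
have Rt : nmem (sem lp s) ROOT 0 = t by rewrite (sem_unchanged lp s).1.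
move: H' Rt; set s1 := sem lp s; clearbody s1 => H' Rt.
have Sr : size r = m by rewrite -(rem_size H').
have l0 : l' = [::].
  by have [] := rem_queue H'; rewrite size_cat Sr; case: (l') => //= *; lia.
have Ur : uniq (t :: r) by have := rem_uniq H'; rewrite l0.
have in_r v : v != t -> v \in r.
  move=> vt; have /(_ v) : t :: r =i predT.
    apply/subset_cardP; last exact/subsetP.
    by rewrite (card_uniqP Ur) /= Sr cardT size_enum_ord (card_edges HR).
  by rewrite !inE (negPf vt).
split.
  exists r; split=> //=.
  - move=> i im; have [T0 Q] := rem_queue H'; move: T0 Q.
    rewrite l0 /= Sr => T0 /(_ i im) <-; congr (nmem s1 _ _); lia.
  - exact: rem_order H'.
  - move=> v; rewrite Rt; have [->|vt] := eqVneq v t.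
      by rewrite eqxx (par_root HR).
    by rewrite val_eqE (negPf vt); case: (rem_par H' (in_r v vt)).
  - by move=> v vt; case: (rem_par H' (in_r v vt)).
move=> v /=; rewrite (rem_cnt H'); have -> : rest r = set0.
  apply/setP => x; rewrite !inE negb_or; case: eqVneq => //= /in_r ->.
  by [].
exact: (counted_none HR).
Qed.

Lemma rev_indexE s j : reads I s -> nmem s J 0 = j ->
  nmem s SIZES 1 - 1 - nmem s J 0 = m - 1 - j.
Proof. by move=> Hs ->; rewrite (read_ne Hs). Qed.

(** In an order where parents come first, the last vertex with all of [W] below
    it has no child with this property. *)
Lemma find_lcaP s r : reads I s -> nmem s ROOT 0 = t -> rooted s r ->
  (forall v : 'I_n, nmem s CNT v = descendants v) ->
  nmem s TOTAL 0 = \sum_v W v -> (exists v, W v) ->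
  exists2 c : 'I_n, nmem (sem find_lca s) LCA 0 = c & gate (@ends R I) (@wgt R I) c t.
Proof.
move=> Hs Et Hr Hc Htot exW; rewrite /find_lca sem_seq.
set lp := PFor _ _ _ _; set s0 := sem _ s.
have H0 : reads I s0 by exact: reads_sem Hs.
have sr := rt_size Hr.
pose Inv j s' := exists c : 'I_n, [/\ nmem s' LCA 0 = c,
  descendants c = \sum_v W v &
  forall i, i < m - j -> descendants (nth t r i) = \sum_v W v ->
     par (nth t r i) != c].
have [c [Ec Dc Hch]] : Inv 0 (sem lp s0).
  apply: (@for_ind _ Inv) => //.
    rewrite (read_ne H0); exists t; split=> //; last by rewrite subnn.
    by apply/eqP; rewrite descendants_full; apply/forallP => y;
       rewrite (root_anc HR) implybT.
  move=> j s'; rewrite (read_ne H0) => jm un EJ [c [Ec Dc Hch]].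
  have Hs' : reads I s' by exact: reads_unchanged un H0.
  set v := nth t r (m - 1 - j).
  have Ev : nmem s' QUEUE (m - 1 - j) = v.
    by rewrite un.1 //= (rt_queue Hr) //; lia.
  have Ctot : nmem s' TOTAL 0 = \sum_v W v by rewrite un.1.
  have Cv : nmem s' CNT v = descendants v by rewrite un.1 //; exact: Hc.
  have split_i i : i < m - j -> i < m - j.+1 \/ i = m - 1 - j by lia.
  rewrite /= (rev_indexE Hs' EJ) Ev Cv Ctot -eqn_leq.
  have [Dv|nDv] := eqVneq (descendants v) _; last first.
    exists c; split=> //= i /split_i[/Hch//|-> E].
    by rewrite E eqxx in nDv.
  exists v; split=> //= i /split_i[im _|-> _]; last first.
    apply: (par_neq HR); apply: contraTneq (rt_uniq Hr) => /= <-.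
    by rewrite mem_nth // sr; lia.
  have := rt_order Hr => /(pairwiseP t)/(_ i (m - 1 - j)).
  by rewrite !inE sr; apply; lia.
exists c => //; apply: (gate_lca (valid_tree Hvalid) HR).
- by [].
- move=> v Wv; move/eqP: Dc; rewrite descendants_full => /forallP/(_ v).
  by rewrite /positive Wv.
move=> x xt xc; have xr := rooted_mem Hr xt.
have ix : index x r < m - 0 by rewrite subn0 -sr index_mem.
have := Hch _ ix; rewrite nth_index // xc eqxx => nD.
have /forallPn[v] : ~~ [forall y, W y ==> fconnect par y x].
  by rewrite -descendants_full; apply/eqP => /nD.
by rewrite negb_imply => /andP[Wv nv]; exists v.
Qed.

Lemma root_treeP s : reads I s -> nmem s ROOT 0 = t ->
  nmem s TOTAL 0 = \sum_v W v -> (exists v, W v) ->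
  let s' := sem root_tree s in
  (exists r, rooted s' r) /\
  (exists2 c : 'I_n, nmem s' LCA 0 = c & gate (@ends R I) (@wgt R I) c t).
Proof.
move=> Hs Et Htot exW; cbv zeta; rewrite /root_tree 4!sem_seq.
have clear_s := fun v => clear_starsP v Hs.
have un1 := sem_unchanged clear_stars s; move: clear_s un1.
move: (sem clear_stars s) => s1 C1 un1.
have H1 : reads I s1 by exact: reads_unchanged un1 Hs.
have fill v := @fill_starsP s1 v H1.
have un2 := sem_unchanged fill_stars s1; move: fill un2.
move: (sem fill_stars s1) => s2 C2 un2.
have H2 : reads I s2 by exact: reads_unchanged un2 H1.
have Et2 : nmem s2 ROOT 0 = t by rewrite un2.1 // un1.1.
have stars2 (v : 'I_n) : [/\ nmem s2 DEG v = star one [set~ t] v,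
     nmem s2 NBR v = star nbr [set~ t] v, nmem s2 INC v = star inc [set~ t] v &
     nmem s2 CNT v = W v].
  have [|-> -> ->] := C2 v; first by move=> u; case: (C1 u).
  by rewrite un2.1 //; case: (C1 v).
have [l] := queue_leavesP H2 Et2 stars2.
have un3 := sem_unchanged queue_leaves s2; move: un3.
move: (sem queue_leaves s2) => s3 un3 Hl.
have H3 : reads I s3 by exact: reads_unchanged un3 H2.
have Et3 : nmem s3 ROOT 0 = t by rewrite un3.1.
have [] := remove_all_leavesP H3 Et3 Hl.
have un4 := sem_unchanged remove_leaves s3; move: un4.
move: (sem remove_leaves s3) => s4 un4 [r Hr] Hcnt.
have H4 : reads I s4 by exact: reads_unchanged un4 H3.
split.
  exists r; apply: rooted_unchanged _ (sem_unchanged find_lca s4) Hr.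
  by apply/allP.
apply: find_lcaP Hr Hcnt _ exW => //; first by rewrite un4.1.
by rewrite un4.1 // un3.1 // un2.1 // un1.1.
Qed.

End RootTree.

(** * Testing a threshold in linear time *)

Notation EDGE := 23 (only parsing).
Notation GATEA := 24 (only parsing).
Notation GATEB := 25 (only parsing).
Notation FOUND := 34 (only parsing).
Notation OK := 35 (only parsing).
Notation C1 := 36 (only parsing).
Notation T1 := 37 (only parsing).
Notation C2 := 38 (only parsing).
Notation T2 := 39 (only parsing).
Notation ANCA := 40 (only parsing).
Notation ANCB := 41 (only parsing).
Notation ANCC1 := 42 (only parsing).
Notation ANCT1 := 43 (only parsing).
Notation ANCC2 := 44 (only parsing).
Notation CHANGE := 4 (only parsing).
Notation THETA := 7 (only parsing).
Notation POT1 := 8 (only parsing).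
Notation POT2 := 9 (only parsing).
Notation NEWLEN := 10 (only parsing).

(* The root is its own parent, so [n] steps upwards visit all ancestors of [c]
   and may linger at the root. *)
Definition mark_ancestors (c : nexp) (k : nat) : prog :=
  for_vertices (PN k (at0 J) (NConst 0));; V ::= c;;
  for_vertices (PN k (at0 V) (NConst 1);; V ::= NGet PAR (at0 V)).

Definition shrink_edge : prog :=
  PIf (BLeR (RGet 2 (at0 EDGE)) (RGet 1 (at0 EDGE)))
      (PR CHANGE (at0 EDGE) (RGet 2 (at0 EDGE)))
      (PR CHANGE (at0 EDGE) (RGet 1 (at0 EDGE)));;
  PR NEWLEN (NConst 0) (RSub (RGet 1 (at0 EDGE)) (RGet CHANGE (at0 EDGE))).

Definition grow_edge : prog :=
  PR CHANGE (at0 EDGE) (RGet 2 (at0 EDGE));;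
  PR NEWLEN (NConst 0) (RAdd (RGet 1 (at0 EDGE)) (RGet CHANGE (at0 EDGE))).

(* The edge above [V] lies on the path between two vertices exactly when one of
   them is below [V]; this is why marks of ancestors are compared. *)
Definition plan_edge : prog :=
  PR CHANGE (at0 EDGE) RZero;; PR NEWLEN (NConst 0) (RGet 1 (at0 EDGE));;
  PIf (BLeR (RGet 3 (at0 EDGE)) (RGet THETA (NConst 0)))
    (PIf (BEqN (NGet ANCA (at0 V)) (NGet ANCB (at0 V)))
       (PIf (BEqN (NGet ANCC1 (at0 V)) (NGet ANCT1 (at0 V))) shrink_edge PSkip)
       (PIf (BEqN (NGet ANCC1 (at0 V)) (NGet ANCT1 (at0 V))) PSkip grow_edge))
    PSkip.

Definition potential_step (anc pot : nat) : prog :=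
  PIf (BLeN (NConst 1) (NGet anc (at0 V)))
      (PR pot (at0 V) (RSub (RGet pot (at0 U)) (RGet NEWLEN (NConst 0))))
      (PR pot (at0 V) (RAdd (RGet pot (at0 U)) (RGet NEWLEN (NConst 0)))).

Definition potentials : prog :=
  PR POT1 (at0 ROOT) RZero;; PR POT2 (at0 ROOT) RZero;;
  for_edges
    ((V ::= NGet QUEUE rev_index;; U ::= NGet PAR (at0 V);;
      EDGE ::= NGet PE (at0 V));;
     plan_edge;; potential_step ANCC1 POT1;; potential_step ANCC2 POT2).

Definition compare_potentials : prog :=
  OK ::= NConst 1;;
  for_vertices
    (PIf (BAnd (BLeR (RGet POT1 (at0 J)) (RGet POT1 (at0 T1)))
               (BLeR (RGet POT2 (at0 J)) (RGet POT2 (at0 T2))))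
         PSkip (OK ::= NConst 0)).

(* Both paths of a goal have the same edges, which the marks of [c1] and [t1]
   identify; the potentials use the marks of [c1] and [c2]. *)
Definition test_goal : prog :=
  mark_ancestors (NGet SIZES (NConst 2)) ANCA;;
  mark_ancestors (NGet SIZES (NConst 3)) ANCB;;
  mark_ancestors (at0 C1) ANCC1;;
  mark_ancestors (at0 T1) ANCT1;;
  mark_ancestors (at0 C2) ANCC2;;
  potentials;; compare_potentials.

Definition attempt (c1 t1 c2 t2 : nexp) : prog :=
  C1 ::= c1;; T1 ::= t1;; C2 ::= c2;; T2 ::= t2;; test_goal;; FOUND ::= at0 OK.

Definition test_threshold : prog :=
  let a := NGet SIZES (NConst 2) in let b := NGet SIZES (NConst 3) in
  attempt (at0 GATEB) b (at0 GATEB) b;;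
  PIf (BLeN (NConst 1) (at0 FOUND)) PSkip (attempt (at0 GATEA) a (at0 GATEA) a);;
  PIf (BLeN (NConst 1) (at0 FOUND)) PSkip (attempt a b b a).

Section TestThreshold.
Variables (R : realFieldType) (I : instance R).
Hypothesis Hvalid : valid_instance I.
Local Notation state := (state R).
Local Notation n := (nv I).
Local Notation m := (ne I).
Implicit Types s : state.
Variables (t : 'I_n) (par : 'I_n -> 'I_n) (pe : 'I_n -> 'I_m).
Variable depth : 'I_n -> nat.
Hypothesis HR : rooting (@ends R I) t par pe depth.
Variable r : seq 'I_n.
Local Notation rooted s := (rooted t par pe s r).
Local Notation anc v c := (fconnect par c v).
Local Notation A := (root_edges t par pe).
Local Notation P := (path_set (@ends R I)).

Lemma traject_fconnect c v : (v \in traject par c n) = anc v c.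
Proof.
apply/trajectP/idP => [[i _ ->]|cv]; first exact: fconnect_iter.
exists (findex par c v); last by rewrite iter_findex.
apply: leq_trans (findex_max cv) _.
by have := max_card (fconnect par c); rewrite card_ord.
Qed.

Lemma mark_ancestorsP s (e : nexp) k (c v : 'I_n) : reads I s ->
  (forall v : 'I_n, nmem s PAR v = par v) -> k \notin [:: SIZES; J; V; PAR] ->
  neval (sem (for_vertices (PN k (at0 J) (NConst 0))) s) e = c ->
  nmem (sem (mark_ancestors e k) s) k v = anc v c.
Proof.
move=> Hs Hpar; rewrite !inE => /norP[kz /norP[kj /norP[kv kp]]] Ec.
have jk : (J == k) = false by rewrite eq_sym (negPf kj).
have vk : (V == k) = false by rewrite eq_sym (negPf kv).
have pk : (PAR == k) = false by rewrite eq_sym (negPf kp).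
have zk : (SIZES == k) = false by rewrite eq_sym (negPf kz).
pose Inv0 j s' := forall v : 'I_n, j <= v -> nmem s' k v = 0.
have : Inv0 0 (sem (for_vertices (PN k (at0 J) (NConst 0))) s).
  apply: (@for_ind _ Inv0).
  - by rewrite inE jk.
  - by move=> u; rewrite (read_nv Hs) leqNgt ltn_ord.
  - by move=> j x s' H u ju /=; rewrite (negPf kj) H.
  move=> j s'; rewrite (read_nv Hs) => Hj un EJ H u ju /=.
  rewrite EJ !eqxx /=; have [//|uj] := eqVneq (u : nat) j.
  by rewrite H // ltn_neqAle eq_sym uj.
rewrite /mark_ancestors 2!sem_seq; move: Ec.
have := sem_unchanged (for_vertices (PN k (at0 J) (NConst 0))) s.
move: (sem (for_vertices (PN k (at0 J) (NConst 0))) s) => s1 un1 Ec Z.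
set s2 := sem (V ::= e) s1.
have Hn : nmem s2 SIZES 0 = n.
  by rewrite /= un1.1 /= ?(read_nv Hs) // !inE zk.
have Hp2 (u : 'I_n) : nmem s2 PAR u = par u.
  by rewrite /= un1.1 /= ?Hpar // !inE pk.
pose Inv j s' := nmem s' V 0 = iter (n - j) par c /\
  forall v : 'I_n, nmem s' k v = (v \in traject par c (n - j)).
have [_ ->] : Inv 0 (sem (for_vertices
    (PN k (at0 V) (NConst 1);; V ::= NGet PAR (at0 V))) s2).
  apply: (@for_ind _ Inv).
  - by rewrite !inE jk.
  - rewrite Hn /Inv subnn /= Ec; split=> // u.
    by rewrite (negPf kj) (negPf kv) /= Z.
  - by move=> j x s' [H1 H2]; split=> //= u; rewrite (negPf kj) /= H2.
  move=> j s'; rewrite Hn => Hj un EJ [H1 H2].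
  have Hp (u : 'I_n) : nmem s' PAR u = par u.
    by rewrite un.1 ?Hp2 // !inE pk.
  rewrite /Inv; have -> : n - j = (n - j.+1).+1 by lia.
  split=> [|u] /=; first by rewrite vk pk /= H1 Hp.
  rewrite (negPf kv) eqxx /= H1 H2 -trajectS trajectSr mem_rcons inE -val_eqE.
  by case: eqP.
by rewrite subn0 traject_fconnect.
Qed.

Definition marked s k (c : 'I_n) := forall v : 'I_n, nmem s k v = anc v c.

Variables (theta : R) (g : goal I).
Local Notation change := (plan theta g).
Local Notation newlen := (new_len change).

Lemma path_edge_anc (u c v : 'I_n) : v != t ->
  (pe v \in P u c) = anc v u (+) anc v c.
Proof.
move=> vt; have Htree := valid_tree Hvalid.
by rewrite (mem_path_set_root Htree HR) !(mem_root_edges HR).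
Qed.

Lemma plan_edgeP s (v : 'I_n) : reads I s -> v != t ->
  marked s ANCA (pa I) -> marked s ANCB (pb I) ->
  marked s ANCC1 g.1.1 -> marked s ANCT1 g.1.2 ->
  rmem s THETA 0 = theta -> nmem s V 0 = v -> nmem s EDGE 0 = pe v ->
  let s' := sem plan_edge s in
  [/\ rmem s' CHANGE (pe v) = change (pe v), rmem s' NEWLEN 0 = newlen (pe v) &
      forall e : 'I_m, e != pe v -> rmem s' CHANGE e = rmem s CHANGE e].
Proof.
move=> Hs vt Ma Mb Mc Mt Et Ev Ee /=.
rewrite !Ev !Ee !Ma !Mb !Mc !Mt Et !(read_cst Hs) !(read_len Hs) !(read_ubd Hs).
rewrite /new_len /plan !path_edge_anc //.
have other (e : 'I_m) : e != pe v -> (e == pe v :> nat) = false.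
  by rewrite val_eqE => /negPf.
case: (_ <= theta)%R => /=; last first.
  rewrite eqxx addr0 subr0 if_same; split=> // e /other ->; by [].
rewrite minEle; case: (ubd (pe v) <= len (pe v))%R;
  case: (anc v (pa I)); case: (anc v (pb I)); case: (anc v g.1.1);
  case: (anc v g.1.2); rewrite /= ?Ee ?(read_len Hs) ?eqxx ?addr0 ?subr0;
  by split=> // e /other ->.
Qed.

(** The distance from [c] to [v] minus the distance from [c] to the root: going
    down an edge brings one nearer to [c] exactly on the way from the root to
    [c]. *)
Definition potential (c v : 'I_n) : R :=
  (\sum_(e in A v) (if e \in A c then - newlen e else newlen e))%R.

Lemma potential_root c : potential c t = 0%R.
Proof. by rewrite /potential (root_edges_root HR) big_set0. Qed.

Lemma potential_par c v : v != t -> potential c v =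
  if anc v c then (potential c (par v) - newlen (pe v))%R
  else (potential c (par v) + newlen (pe v))%R.
Proof.
move=> vt; have Av : A v = pe v |: A (par v).
  by apply/setP => e; rewrite !inE (root_edges_par HR _ vt).
rewrite /potential Av big_setU1 ?(pe_notin_root_edges HR) //= addrC.
by rewrite (mem_root_edges HR) //; case: ifP.
Qed.

Lemma tdist_potential c v : tdist (@ends R I) newlen c v =
  (potential c v + \sum_(e in A c) newlen e)%R.
Proof.
rewrite tdist_if /potential [X in (X + _)%R]big_mkcond.
rewrite [X in (_ + X)%R]big_mkcond -big_split; apply: eq_bigr => e _ /=.
rewrite (mem_path_set_root (valid_tree Hvalid) HR).
by case: (e \in A v); case: (e \in A c) => /=; lra.
Qed.

Lemma farthest_potential c u : farthest (@ends R I) newlen c u <->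
  forall v, (potential c v <= potential c u)%R.
Proof.
by split=> H v; have := H v; rewrite !tdist_potential lerD2r.
Qed.

Lemma potential_stepP s k p (c v : 'I_n) : v != t -> marked s k c ->
  nmem s V 0 = v -> nmem s U 0 = par v -> rmem s NEWLEN 0 = newlen (pe v) ->
  rmem s p (par v) = potential c (par v) ->
  let s' := sem (potential_step k p) s in
  rmem s' p v = potential c v /\
  forall u : 'I_n, u != v -> rmem s' p u = rmem s p u.
Proof.
move=> vt Mk Ev Eu El Ep; rewrite (potential_par c vt) /= Ev Mk Eu El Ep.
by case: (anc v c) => /=; rewrite !eqxx /=; split=> // u;
   rewrite -val_eqE /= => /negPf ->.
Qed.

Lemma potentialsP s : reads I s -> nmem s ROOT 0 = t -> rooted s ->
  marked s ANCA (pa I) -> marked s ANCB (pb I) -> marked s ANCC1 g.1.1 ->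
  marked s ANCT1 g.1.2 -> marked s ANCC2 g.2.1 -> rmem s THETA 0 = theta ->
  let s' := sem potentials s in
  [/\ forall v : 'I_n, rmem s' POT1 v = potential g.1.1 v,
      forall v : 'I_n, rmem s' POT2 v = potential g.2.1 v &
      forall e : 'I_m, rmem s' CHANGE e = change e].
Proof.
move=> Hs Et Hr Ma Mb Mc Mt Md Eth; cbv zeta; rewrite /potentials 2!sem_seq.
set s0 := sem (PR POT2 _ _) _; set lp := PFor _ _ _ _.
have Z1 : rmem s0 POT1 t = 0%R by rewrite /= Et eqxx.
have Z2 : rmem s0 POT2 t = 0%R by rewrite /= Et eqxx.
have un0 : unchanged (PSeq (PR POT1 (at0 ROOT) RZero) (PR POT2 (at0 ROOT) RZero)) s s0.
  exact: sem_unchanged.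
have H0 : reads I s0 by exact: reads_unchanged un0 Hs.
clearbody s0; have sr := rt_size Hr.
pose v_ i := nth t r i.
have vt i : i < m -> v_ i != t.
  move=> im; apply: contraTneq (rt_uniq Hr) => /= <-.
  by rewrite mem_nth // sr.
pose Inv j s' := [/\ rmem s' POT1 t = 0%R, rmem s' POT2 t = 0%R &
  forall i, i < m - j -> [/\ rmem s' POT1 (v_ i) = potential g.1.1 (v_ i),
    rmem s' POT2 (v_ i) = potential g.2.1 (v_ i) &
    rmem s' CHANGE (pe (v_ i)) = change (pe (v_ i))]].
have [R1 R2 Rall] : Inv 0 (sem lp s0).
  apply: (@for_ind _ Inv) => //.
    by rewrite (read_ne H0) /Inv subnn.
  move=> j s1; rewrite (read_ne H0) => jm un EJ [R1 R2 Rj].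
  have Hs1 : reads I s1 by exact: reads_unchanged un H0.
  set i := m - 1 - j; have im : i < m by rewrite /i; lia.
  have split_i k : k < m - j -> k < m - j.+1 \/ k = i by rewrite /i; lia.
  have vti := vt i im.
  have new k : k < m - j.+1 -> v_ k != v_ i.
    move=> km; rewrite /v_ nth_uniq ?sr //; last by case/andP: (rt_uniq Hr).
      by rewrite neq_ltn /i; apply/orP; left; lia.
    by lia.
  have pars : rmem s1 POT1 (par (v_ i)) = potential g.1.1 (par (v_ i)) /\
              rmem s1 POT2 (par (v_ i)) = potential g.2.1 (par (v_ i)).
    have [->|[k ki ->]] := rooted_parent_first HR Hr im.
      by rewrite !potential_root.
    have [|-> -> //] := Rj k; by rewrite /i in ki; lia.
  rewrite 3!sem_seq.
  set s2 := sem (_ ;; _) s1.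
  have Eq : nmem s1 QUEUE i = v_ i by rewrite un.1 // un0.1 // (rt_queue Hr).
  have Epar (v : 'I_n) : nmem s1 PAR v = par v.
    by rewrite un.1 // un0.1 // (rt_par Hr).
  have [EV EU EE] : [/\ nmem s2 V 0 = v_ i, nmem s2 U 0 = par (v_ i) &
      nmem s2 EDGE 0 = pe (v_ i)].
    rewrite /= (rev_indexE Hs1 EJ) Eq; split=> //.
    by rewrite un.1 // un0.1 // (rt_pe Hr).
  have un2 : unchanged (V ::= rev_index;; U ::= rev_index;; EDGE ::= rev_index) s1 s2.
    by split=> k l //=; rewrite !inE !negb_or => /and3P[/negPf-> /negPf-> /negPf->].
  have H2 : reads I s2 by exact: reads_unchanged un2 Hs1.
  have same2 k l : rmem s2 k l = rmem s1 k l by [].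
  clearbody s2.
  have mk k c : marked s k c -> k \notin [:: J; V; U; EDGE] -> marked s2 k c.
    move=> M; rewrite !inE !negb_or => /and4P[kj kv ku ke] u.
    rewrite un2.1; last by rewrite !inE !negb_or kv ku ke.
    rewrite un.1; last by rewrite !inE !negb_or kj kv ku ke.
    by rewrite un0.1 // M.
  have Eth2 : rmem s2 THETA 0 = theta by rewrite same2 un.2 // un0.2.
  have [] := plan_edgeP H2 vti (mk _ _ Ma isT) (mk _ _ Mb isT) (mk _ _ Mc isT)
    (mk _ _ Mt isT) Eth2 EV EE.
  have un3 := sem_unchanged plan_edge s2; move: un3.
  move: (sem plan_edge s2) => s3 un3 X3 Y3 O3.
  have M3 k c : marked s2 k c -> marked s3 k c by move=> M u; rewrite un3.1.
  have [P3 Q3] := pars.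
  have [|||||] := @potential_stepP s3 ANCC1 POT1 g.1.1 (v_ i) vti.
  - exact: M3 (mk _ _ Mc isT).
  - by rewrite un3.1.
  - by rewrite un3.1.
  - exact: Y3.
  - by rewrite un3.2 // same2.
  have un4 := sem_unchanged (potential_step ANCC1 POT1) s3; move: un4.
  move: (sem (potential_step ANCC1 POT1) s3) => s4 un4 P4 O4.
  have M4 k c : marked s3 k c -> marked s4 k c by move=> M u; rewrite un4.1.
  have [|||||] := @potential_stepP s4 ANCC2 POT2 g.2.1 (v_ i) vti.
  - exact: M4 (M3 _ _ (mk _ _ Md isT)).
  - by rewrite un4.1 // un3.1.
  - by rewrite un4.1 // un3.1.
  - by rewrite un4.2.
  - by rewrite un4.2 // un3.2 // same2.
  have un5 := sem_unchanged (potential_step ANCC2 POT2) s4; move: un5.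
  move: (sem (potential_step ANCC2 POT2) s4) => s5 un5 P5 O5.
  split.
  - by rewrite un5.2 // O4 1?eq_sym // un3.2 // same2.
  - by rewrite O5 1?eq_sym // un4.2 // un3.2 // same2.
  move=> k /split_i[km|->].
    have [K1 K2 K3] := Rj k km; have ki := new k km.
    rewrite un5.2 // O4 // un3.2 // same2 K1 O5 // un4.2 // un3.2 // same2 K2.
    rewrite un5.2 // un4.2 // O3 ?same2 ?K3 //.
    apply: contraNneq ki => /(pe_inj HR _ vti)-> //; apply: vt; lia.
  by rewrite un5.2 // P4 P5 un5.2 // un4.2.
have find v : v != t -> exists2 i, i < m - 0 & v_ i = v.
  move=> /(rooted_mem HR Hr) vr; exists (index v r); last exact: nth_index.
  by rewrite subn0 -sr index_mem.
split.
- move=> v; have [->|/find[i im <-]] := eqVneq v t; first by rewrite potential_root.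
  by case: (Rall i im).
- move=> v; have [->|/find[i im <-]] := eqVneq v t; first by rewrite potential_root.
  by case: (Rall i im).
move=> e; have [v vt' ->] := pe_onto HR e; have [i im <-] := find v vt'.
by case: (Rall i im).
Qed.

Lemma compare_potentialsP s (t1 t2 : 'I_n) : reads I s ->
  nmem s T1 0 = t1 -> nmem s T2 0 = t2 ->
  nmem (sem compare_potentials s) OK 0 =
    [forall v : 'I_n, (rmem s POT1 v <= rmem s POT1 t1)%R &&
                      (rmem s POT2 v <= rmem s POT2 t2)%R].
Proof.
move=> Hs E1 E2; rewrite /compare_potentials sem_seq.
set s0 := sem _ s; set lp := PFor _ _ _ _.
have H0 : reads I s0 by exact: reads_sem Hs.
pose good (v : 'I_n) := (rmem s POT1 v <= rmem s POT1 t1)%R &&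
                        (rmem s POT2 v <= rmem s POT2 t2)%R.
pose Inv j s' := nmem s' OK 0 = [forall v : 'I_n, (j <= v) ==> good v].
have -> : [forall v, good v] = [forall v : 'I_n, (0 <= v) ==> good v] by [].
apply: (@for_ind _ Inv) => //.
  rewrite (read_nv H0) /Inv /=; case: forallP => // -[] v.
  by rewrite leqNgt ltn_ord.
move=> j s'; rewrite (read_nv H0) => jn un EJ; rewrite /Inv => E.
rewrite /= EJ !(un.1 T1) ?(un.1 T2) // !un.2 //= E1 E2.
have -> : [forall v : 'I_n, (j <= v) ==> good v] =
    good (Ordinal jn) && [forall v : 'I_n, (j < v) ==> good v].
  apply/forallP/andP => [H|[gj /forallP H] v].
    split; first by have := H (Ordinal jn); rewrite /= leqnn.
    by apply/forallP => v; apply/implyP => /ltnW jv; have := H v; rewrite jv.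
  by rewrite leq_eqVlt; case: eqP => [jv|_] //=; rewrite (_ : v = Ordinal jn) //;
     apply: val_inj.
by rewrite /good /=; case: ifP => _ //=.
Qed.

Definition ready s := [/\ reads I s, nmem s ROOT 0 = t & rooted s].

Definition keeps_ready p :=
  keeps_input p && all (fun k => k \notin [:: QUEUE; PAR; PE; ROOT]) (nwrites p).

Lemma ready_unchanged p s s' : keeps_ready p -> unchanged p s s' ->
  ready s -> ready s'.
Proof.
move=> /andP[kp /allP kr] un [Hs Et Hr]; split.
- exact: reads_unchanged un Hs.
- by rewrite un.1 //; apply/negP => /kr.
apply: rooted_unchanged un Hr => k /kr.
by rewrite !inE !negb_or => /and4P[-> -> -> _].
Qed.

Lemma ready_sem p s : keeps_ready p -> ready s -> ready (sem p s).
Proof. by move=> kp; apply: ready_unchanged kp (sem_unchanged p s). Qed.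

Lemma test_goalP s : ready s ->
  nmem s C1 0 = g.1.1 -> nmem s T1 0 = g.1.2 -> nmem s C2 0 = g.2.1 ->
  nmem s T2 0 = g.2.2 -> rmem s THETA 0 = theta ->
  let s' := sem test_goal s in
  (forall e : 'I_m, rmem s' CHANGE e = change e) /\
  ((nmem s' OK 0 = 1 /\ achieves theta g) \/ (nmem s' OK 0 = 0 /\ ~ achieves theta g)).
Proof.
move=> H E1 F1 E2 F2 Eth; cbv zeta; rewrite /test_goal 6!sem_seq.
have mark s1 k (e : nexp) (c : 'I_n) : keeps_ready (mark_ancestors e k) ->
    k \notin [:: SIZES; J; V; PAR] -> ready s1 ->
    (forall s2 : state, (forall k' i, k' \notin [:: J; k] -> nmem s2 k' i = nmem s1 k' i) ->
       neval s2 e = c) ->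
    let s2 := sem (mark_ancestors e k) s1 in
    [/\ ready s2, marked s2 k c & unchanged (mark_ancestors e k) s1 s2].
  move=> kr kk H1 He; split; [exact: ready_sem| |exact: sem_unchanged].
  case: H1 => [Hs1 _ Hr1] v; apply: mark_ancestorsP => //; first exact: rt_par Hr1.
  by apply: He => k' i Hk'; rewrite (sem_unchanged (for_vertices (PN k _ _)) s1).1.
have [|H1 Ma u1] := mark s ANCA (NGet SIZES (NConst 2)) (pa I) isT isT H.
  by move=> s2 un /=; rewrite un //; case: H => Hs _ _; exact: read_pa.
move: (sem _ s) H1 Ma u1 => s1 H1 Ma u1.
have [|H2 Mb u2] := mark s1 ANCB (NGet SIZES (NConst 3)) (pb I) isT isT H1.
  by move=> s2 un /=; rewrite un //; case: H1 => Hs _ _; exact: read_pb.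
move: (sem _ s1) H2 Mb u2 => s2 H2 Mb u2.
have [|H3 Mc u3] := mark s2 ANCC1 (at0 C1) g.1.1 isT isT H2.
  by move=> s' un /=; rewrite un // u2.1 // u1.1.
move: (sem _ s2) H3 Mc u3 => s3 H3 Mc u3.
have [|H4 Mt u4] := mark s3 ANCT1 (at0 T1) g.1.2 isT isT H3.
  by move=> s' un /=; rewrite un // u3.1 // u2.1 // u1.1.
move: (sem _ s3) H4 Mt u4 => s4 H4 Mt u4.
have [|H5 Md u5] := mark s4 ANCC2 (at0 C2) g.2.1 isT isT H4.
  by move=> s' un /=; rewrite un // u4.1 // u3.1 // u2.1 // u1.1.
move: (sem _ s4) H5 Md u5 => s5 H5 Md u5.
have Ma5 : marked s5 ANCA (pa I).
  by move=> v; rewrite u5.1 // u4.1 // u3.1 // u2.1.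
have Mb5 : marked s5 ANCB (pb I) by move=> v; rewrite u5.1 // u4.1 // u3.1.
have Mc5 : marked s5 ANCC1 g.1.1 by move=> v; rewrite u5.1 // u4.1.
have Mt5 : marked s5 ANCT1 g.1.2 by move=> v; rewrite u5.1.
have Eth5 : rmem s5 THETA 0 = theta.
  by rewrite u5.2 // u4.2 // u3.2 // u2.2 // u1.2.
have F15 : nmem s5 T1 0 = g.1.2 by rewrite u5.1 // u4.1 // u3.1 // u2.1 // u1.1.
have F25 : nmem s5 T2 0 = g.2.2 by rewrite u5.1 // u4.1 // u3.1 // u2.1 // u1.1.
have [Hs5 Et5 Hr5] := H5.
have [] := potentialsP Hs5 Et5 Hr5 Ma5 Mb5 Mc5 Mt5 Md Eth5.
have u6 := sem_unchanged potentials s5; move: u6.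
move: (sem potentials s5) => s6 u6 Pot1 Pot2 Ch.
have Hs6 : reads I s6 by exact: reads_unchanged u6 Hs5.
have F16 : nmem s6 T1 0 = g.1.2 by rewrite u6.1.
have F26 : nmem s6 T2 0 = g.2.2 by rewrite u6.1.
have := compare_potentialsP Hs6 F16 F26.
have u7 := sem_unchanged compare_potentials s6; move: u7.
move: (sem compare_potentials s6) => s7 u7 EOK.
split; first by move=> e; rewrite u7.2.
rewrite EOK; case: forallP => Hall; [left|right]; split=> //.
  split; apply/farthest_potential => v; have /andP[A1 A2] := Hall v.
    by rewrite -!Pot1.
  by rewrite -!Pot2.
case=> /farthest_potential G1 /farthest_potential G2; apply: Hall => v.
by rewrite !Pot1 !Pot2 G1 G2.
Qed.

Lemma attemptP s (c1 t1 c2 t2 : nexp) : ready s -> rmem s THETA 0 = theta ->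
  (forall s' : state,
     (forall k i, k \notin [:: C1; T1; C2; T2] -> nmem s' k i = nmem s k i) ->
     [/\ neval s' c1 = g.1.1, neval s' t1 = g.1.2, neval s' c2 = g.2.1 &
         neval s' t2 = g.2.2]) ->
  let s' := sem (attempt c1 t1 c2 t2) s in
  (nmem s' FOUND 0 = 1 /\ achieves theta g /\
     forall e : 'I_m, rmem s' CHANGE e = change e) \/
  (nmem s' FOUND 0 = 0 /\ ~ achieves theta g).
Proof.
move=> H Eth He; cbv zeta.
set args := C1 ::= c1;; T1 ::= t1;; C2 ::= c2;; T2 ::= t2.
have -> : sem (attempt c1 t1 c2 t2) s = sem (test_goal;; FOUND ::= at0 OK) (sem args s).
  by [].
have H1 : ready (sem args s) by exact: ready_sem H.
have u1 := sem_unchanged args s.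
have [Ec1 _ _ _] := He s (fun _ _ _ => erefl).
have [_ Et1 _ _] := He (sem (C1 ::= c1) s)
  ltac:(by move=> k i; rewrite !inE /= => /norP[/negPf->]).
have [_ _ Ec2 _] := He (sem (C1 ::= c1;; T1 ::= t1) s)
  ltac:(by move=> k i; rewrite !inE /= => /norP[/negPf-> /norP[/negPf->]]).
have [_ _ _ Et2] := He (sem (C1 ::= c1;; T1 ::= t1;; C2 ::= c2) s)
  ltac:(by move=> k i; rewrite !inE /= => /norP[/negPf-> /norP[/negPf-> /norP[/negPf->]]]).
have F1 : nmem (sem args s) C1 0 = g.1.1 by rewrite /= Ec1.
have F2 : nmem (sem args s) T1 0 = g.1.2 by rewrite -Et1.
have F3 : nmem (sem args s) C2 0 = g.2.1 by rewrite -Ec2.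
have F4 : nmem (sem args s) T2 0 = g.2.2 by rewrite -Et2.
have Eth1 : rmem (sem args s) THETA 0 = theta by rewrite u1.2.
move: (sem args s) H1 F1 F2 F3 F4 Eth1 => s1 H1 F1 F2 F3 F4 Eth1.
have [] := test_goalP H1 F1 F2 F3 F4 Eth1.
rewrite sem_seq; move: (sem test_goal s1) => s2 Ch [[EOK ach]|[EOK nach]].
  by left; rewrite /= EOK.
by right; rewrite /= EOK.
Qed.

End TestThreshold.

Section TestGoals.
Variables (R : realFieldType) (I : instance R).
Hypothesis Hvalid : valid_instance I.
Local Notation m := (ne I).
Implicit Types s : state R.
Variables (t : 'I_(nv I)) (par : 'I_(nv I) -> 'I_(nv I)).
Variables (pe : 'I_(nv I) -> 'I_m) (depth : 'I_(nv I) -> nat).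
Hypothesis HR : rooting (@ends R I) t par pe depth.
Variables (r : seq 'I_(nv I)) (ca cb : 'I_(nv I)).

(** The state in which thresholds can be tested: the tree is rooted and both
    gates are known. *)
Definition armed s := [/\ ready t par pe r s, nmem s GATEA 0 = ca & nmem s GATEB 0 = cb].

Definition keeps_armed p :=
  keeps_ready p && all (fun k => k \notin [:: GATEA; GATEB]) (nwrites p).

Lemma armed_unchanged p s s' : keeps_armed p -> unchanged p s s' ->
  armed s -> armed s'.
Proof.
move=> /andP[kp /allP ka] un [Hs Ea Eb]; split.
- exact: ready_unchanged un Hs.
- by rewrite un.1 //; apply/negP => /ka.
- by rewrite un.1 //; apply/negP => /ka.
Qed.

Lemma armed_sem p s : keeps_armed p -> armed s -> armed (sem p s).
Proof. by move=> kp; apply: armed_unchanged kp (sem_unchanged p s). Qed.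

Lemma test_thresholdP s theta : armed s -> rmem s THETA 0 = theta ->
  let s' := sem test_threshold s in
  (nmem s' FOUND 0 = 1 /\ exists g, [/\ g \in goals ca cb, achieves theta g &
     forall e : 'I_m, rmem s' CHANGE e = plan theta g e]) \/
  (nmem s' FOUND 0 = 0 /\ ~ solvable ca cb theta).
Proof.
move=> H Eth; cbv zeta; rewrite /test_threshold 2!sem_seq.
set g1 : goal I := ((cb, pb I), (cb, pb I)).
set g2 : goal I := ((ca, pa I), (ca, pa I)).
set g3 : goal I := ((pa I, pb I), (pb I, pa I)).
have try s1 (g : goal I) (c1 t1 c2 t2 : nexp) : armed s1 ->
    rmem s1 THETA 0 = theta -> keeps_armed (attempt c1 t1 c2 t2) ->
    (forall s', (forall k i, k \notin [:: C1; T1; C2; T2] -> nmem s' k i = nmem s1 k i) ->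
      [/\ neval s' c1 = g.1.1, neval s' t1 = g.1.2, neval s' c2 = g.2.1 &
         neval s' t2 = g.2.2]) ->
    let s' := sem (attempt c1 t1 c2 t2) s1 in
    [/\ armed s', rmem s' THETA 0 = theta &
    (nmem s' FOUND 0 = 1 /\ achieves theta g /\
       forall e : 'I_m, rmem s' CHANGE e = plan theta g e) \/
    (nmem s' FOUND 0 = 0 /\ ~ achieves theta g)].
  move=> H1 Eth1 kp He; split; first exact: armed_sem.
    by rewrite (sem_unchanged _ _).2.
  case: H1 => H1 _ _; exact (attemptP Hvalid HR H1 Eth1 He).
have vals s1 s' : armed s1 ->
    (forall k i, k \notin [:: C1; T1; C2; T2] -> nmem s' k i = nmem s1 k i) ->
    [/\ nmem s' SIZES 2 = pa I, nmem s' SIZES 3 = pb I, nmem s' GATEA 0 = ca &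
        nmem s' GATEB 0 = cb].
  move=> [[Hs _ _] Ea Eb] un.
  by rewrite !un // Ea Eb (read_pa Hs) (read_pb Hs).
have [|] := try s g1 (at0 GATEB) (NGet SIZES (NConst 3)) (at0 GATEB)
  (NGet SIZES (NConst 3)) H Eth isT.
  by move=> s' /(vals _ _ H)[/= _ -> _ ->].
move: (sem _ s) => s1 H1 Eth1 R1.
have conclude s' g : g \in goals ca cb -> nmem s' FOUND 0 = 1 -> achieves theta g ->
    (forall e : 'I_m, rmem s' CHANGE e = plan theta g e) ->
    nmem s' FOUND 0 = 1 /\ exists g, [/\ g \in goals ca cb, achieves theta g &
     forall e : 'I_m, rmem s' CHANGE e = plan theta g e].
  by move=> Hg E ach Ch; split=> //; exists g.
case: R1 => [[F1 [ach Ch]]|[F1 no1]].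
  rewrite !sem_ifT; try by rewrite /= F1.
  left; apply: conclude ach Ch => //.
  by rewrite !inE eqxx.
rewrite [sem (PIf _ _ (attempt (at0 GATEA) _ _ _)) s1]sem_ifF; last by rewrite /= F1.
have [|] := try s1 g2 (at0 GATEA) (NGet SIZES (NConst 2)) (at0 GATEA)
  (NGet SIZES (NConst 2)) H1 Eth1 isT.
  by move=> s' /(vals _ _ H1)[/= -> _ -> _].
move: (sem _ s1) => s2 H2 Eth2 R2.
case: R2 => [[F2 [ach Ch]]|[F2 no2]].
  rewrite sem_ifT; last by rewrite /= F2.
  left; apply: conclude ach Ch => //.
  by rewrite !inE eqxx orbT.
rewrite sem_ifF; last by rewrite /= F2.
have [|] := try s2 g3 (NGet SIZES (NConst 2)) (NGet SIZES (NConst 3))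
  (NGet SIZES (NConst 3)) (NGet SIZES (NConst 2)) H2 Eth2 isT.
  by move=> s' /(vals _ _ H2)[/= -> -> _ _].
move: (sem _ s2) => s3 H3 Eth3 R3.
case: R3 => [[F3 [ach Ch]]|[F3 no3]].
  by left; apply: conclude ach Ch => //; rewrite !inE eqxx !orbT.
right; split=> // -[g]; rewrite !inE => /or3P[]/eqP->.
- exact: no1.
- exact: no2.
- exact: no3.
Qed.

End TestGoals.

(** * Bottom-up merge sort *)

Section MergePass.
Variables (T : eqType) (le : rel T).
Hypothesis le_total : total le.
Implicit Types (s : seq T) (w : nat).

Fixpoint merge_pass_rec w fuel s : seq T :=
  if fuel is fuel'.+1 then
    merge le (take w s) (take w (drop w s)) ++ merge_pass_rec w fuel' (drop (w + w) s)
  else [::].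

(** One pass merges the consecutive blocks of length [w] in pairs, and there are
    at most [size s] pairs. *)
Definition merge_pass w s := merge_pass_rec w (size s) s.

Lemma merge_pass_rec_nil w fuel : merge_pass_rec w fuel [::] = [::].
Proof. by elim: fuel => //= fuel ->. Qed.

Lemma merge_pass_recE w fuel s : 0 < w -> size s <= fuel ->
  merge_pass_rec w fuel s = merge_pass w s.
Proof.
move=> w0; rewrite /merge_pass; have [k] := ubnP (size s).
elim: k fuel s => // k IHk [|fuel] [|x s] //=.
  by rewrite merge_pass_rec_nil.
move=> Hk Hf; have Hd : size (drop (w + w) (x :: s)) <= size s.
  by rewrite size_drop /=; lia.
by rewrite !IHk //; lia.
Qed.

Lemma merge_passE w s : 0 < w -> merge_pass w s =
  merge le (take w s) (take w (drop w s)) ++ merge_pass w (drop (w + w) s).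
Proof.
move=> w0; rewrite -[LHS](@merge_pass_recE w (size s).+1) //=.
by rewrite merge_pass_recE // size_drop leq_subr.
Qed.

Lemma take_drop_cat w s : s = take w s ++ take w (drop w s) ++ drop (w + w) s.
Proof. by rewrite -drop_drop !cat_take_drop. Qed.

Lemma perm_merge_pass w s : 0 < w -> perm_eq (merge_pass w s) s.
Proof.
move=> w0; have [k] := ubnP (size s); elim: k s => // k IHk [|x s] //= Hk.
rewrite merge_passE // [X in perm_eq _ X](take_drop_cat w) catA.
by rewrite perm_cat ?perm_merge // IHk // size_drop /=; lia.
Qed.

Lemma size_merge_pass w s : 0 < w -> size (merge_pass w s) = size s.
Proof. by move=> w0; exact: perm_size (perm_merge_pass s w0). Qed.

Definition runs w s := forall k, sorted le (take w (drop (k * w) s)).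

Lemma take_merge_pass w s : 0 < w -> take (w + w) (merge_pass w s) =
  merge le (take w s) (take w (drop w s)).
Proof.
move=> w0; rewrite merge_passE // take_cat size_merge size_cat !size_take_min size_drop.
case: ltnP => Hw; first by lia.
have [ws|ws] := leqP (w + w) (size s).
  have -> : w + w - (minn w (size s) + minn w (size s - w)) = 0 by lia.
  by rewrite take0 cats0.
by rewrite [drop (w + w) s]drop_oversize 1?ltnW // cats0.
Qed.

Lemma drop_merge_pass w s k : 0 < w ->
  drop (k * (w + w)) (merge_pass w s) = merge_pass w (drop (k * (w + w)) s).
Proof.
move=> w0; elim: k s => [|k IHk] s; first by rewrite mul0n !drop0.
rewrite mulSn addnC -(drop_drop _ _ (w + w)) -(drop_drop s _ (w + w)) -IHk.
congr drop.
have [ws|ws] := leqP (w + w) (size s).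
  rewrite {1}merge_passE // drop_size_cat //.
  by rewrite size_merge size_cat !size_take_min size_drop; lia.
by rewrite !drop_oversize ?size_merge_pass // ltnW.
Qed.

Lemma runs_merge_pass w s : 0 < w -> runs w s -> runs (w + w) (merge_pass w s).
Proof.
move=> w0 H k; rewrite drop_merge_pass // take_merge_pass //.
apply: merge_sorted => //.
  have := H (k + k); by rewrite mulnDl -mulnDr.
by rewrite drop_drop; have := H (k + k).+1; rewrite mulSn mulnDl -mulnDr.
Qed.

Lemma runs1 s : runs 1 s.
Proof. by move=> k; case: (drop _ _) => // x [|y t]. Qed.

Lemma runs_sorted w s : size s <= w -> runs w s -> sorted le s.
Proof. by move=> sw /(_ 0); rewrite mul0n drop0 take_oversize. Qed.

End MergePass.

Notation LOG := 26 (only parsing).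
Notation POWER := 27 (only parsing).
Notation WIDTH := 28 (only parsing).
Notation LEFT := 29 (only parsing).
Notation RIGHT := 30 (only parsing).
Notation MID := 31 (only parsing).
Notation END := 32 (only parsing).
Notation SRC := 5 (only parsing).
Notation DST := 6 (only parsing).

Notation nv_cell := (NGet SIZES (NConst 0)).

Definition power_table : prog :=
  LOG ::= NConst 0;; PN POWER (NConst 0) (NConst 1);;
  for_vertices
    (PIf (BLeN (NGet POWER (at0 LOG)) nv_cell)
       (PN POWER (NAdd (at0 LOG) (NConst 1))
          (NAdd (NGet POWER (at0 LOG)) (NGet POWER (at0 LOG)));;
        incr LOG (NConst 0) (NConst 1))
       PSkip).

Definition next_block : prog :=
  LEFT ::= at0 END;;
  MID ::= NAdd (at0 END) (at0 WIDTH);;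
  PIf (BLeN (at0 MID) nv_cell) PSkip (MID ::= nv_cell);;
  RIGHT ::= at0 MID;;
  END ::= NAdd (at0 MID) (at0 WIDTH);;
  PIf (BLeN (at0 END) nv_cell) PSkip (END ::= nv_cell).

Definition merge_step : prog :=
  let out := NSub (NSub nv_cell (NConst 1)) (at0 J) in
  let take k := PR DST out (RGet SRC (at0 k));; incr k (NConst 0) (NConst 1) in
  PIf (BLeN (at0 MID) (at0 LEFT)) (take RIGHT)
    (PIf (BLeN (at0 END) (at0 RIGHT)) (take LEFT)
       (PIf (BLeR (RGet SRC (at0 LEFT)) (RGet SRC (at0 RIGHT))) (take LEFT) (take RIGHT))).

Definition merge_pass_prog : prog :=
  LEFT ::= NConst 0;; MID ::= NConst 0;; RIGHT ::= NConst 0;; END ::= NConst 0;;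
  for_vertices
    (PIf (BAnd (BLeN (at0 MID) (at0 LEFT)) (BLeN (at0 END) (at0 RIGHT)))
         next_block PSkip;;
     merge_step);;
  for_vertices (PR SRC (at0 J) (RGet DST (at0 J))).

Definition merge_sort_prog : prog :=
  for_vertices (PR SRC (at0 J) (RGet 3 (at0 J)));;
  WIDTH ::= NConst 1;;
  PFor JJ LOG 0 (merge_pass_prog;; incr WIDTH (NConst 0) (at0 WIDTH)).

Section Sort.
Variables (R : realFieldType) (I : instance R).
Local Notation n := (nv I).
Local Notation m := (ne I).
Local Notation state := (state R).
Implicit Types s : state.
Local Notation le := (fun x y : R => (x <= y)%R).
Local Notation pass := (merge_pass le).

(** The loop stops doubling at the first power of two beyond [n], which it reaches
    because [n < 2 ^ n]. *)
Lemma power_tableP s : reads I s -> 0 < n ->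
  let s' := sem power_table s in
  exists k, [/\ nmem s' LOG 0 = k, forall i, i <= k -> nmem s' POWER i = 2 ^ i,
    n < 2 ^ k & k <= (trunc_log 2 n).+1].
Proof.
move=> Hs n0; cbv zeta; rewrite /power_table 2!sem_seq.
set s0 := sem (PN POWER _ _) _; set lp := PFor _ _ _ _.
have H0 : reads I s0.
  by exact: (@reads_sem _ _ (LOG ::= NConst 0;; PN POWER (NConst 0) (NConst 1))).
pose Inv j s' := exists k, [/\ nmem s' LOG 0 = k,
  forall i, i <= k -> nmem s' POWER i = 2 ^ i,
  n < 2 ^ k \/ k = n - j & k = 0 \/ 2 ^ k.-1 <= n].
have [k [Ek Hk Hn Hl]] : Inv 0 (sem lp s0).
  apply: (@for_ind _ Inv) => //.
    rewrite (read_nv H0) /Inv subnn; exists 0; split; auto.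
    by case.
  move=> j s'; rewrite (read_nv H0) => jn un EJ [k [Ek Hk Hn Hl]].
  have Hs' : reads I s' by exact: reads_unchanged un H0.
  rewrite /Inv /= (read_nv Hs') Ek (Hk k) //.
  case: leqP => Hkn; last by exists k; split; auto.
  case: Hn => [|Hn]; first by rewrite ltnNge Hkn.
  exists k.+1; split=> /=; try by [rewrite addn1|right].
    move=> i ik; rewrite addn1; case: eqP => [->|ne]; first by rewrite expnS; lia.
    by apply: Hk; lia.
  by right; lia.
exists k; split=> //.
  by case: Hn => // ->; rewrite subn0 ltn_expl.
case: Hl => [->//|Hl]; have := trunc_log_max (isT : 1 < 2) Hl; lia.
Qed.

Definition cells (k : nat) s : seq R := mkseq (rmem s k) n.

Definition segment (xs : seq R) i k := take (k - i) (drop i xs).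

Lemma segment_cons s i k : i < k -> k <= n ->
  segment (cells SRC s) i k = rmem s SRC i :: segment (cells SRC s) i.+1 k.
Proof.
move=> ik kn; rewrite /segment (drop_nth 0%R); last by rewrite size_mkseq; lia.
by rewrite nth_mkseq ?(leq_trans ik) // (_ : k - i = (k - i.+1).+1); last by lia.
Qed.

Lemma segment_nil xs i k : k <= i -> segment xs i k = [::].
Proof. by rewrite /segment -subn_eq0 => /eqP->; exact: take0. Qed.

Lemma size_segment xs i k : k <= size xs -> size (segment xs i k) = k - i.
Proof. by rewrite /segment size_take_min size_drop; lia. Qed.

(** What is written, what is left of the two current blocks, and the blocks
    still to be merged make up the result of the pass. *)
Record merging (xs : seq R) w j s (i1 i2 mid stop : nat) : Prop := Merging {
  mrg_left : nmem s LEFT 0 = i1;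
  mrg_right : nmem s RIGHT 0 = i2;
  mrg_mid : nmem s MID 0 = mid;
  mrg_end : nmem s END 0 = stop;
  mrg_le1 : i1 <= mid <= i2;
  mrg_le2 : i2 <= stop <= n;
  mrg_out : mkseq (rmem s DST) (n - j) ++
    merge le (segment xs i1 mid) (segment xs i2 stop) ++ pass w (drop stop xs)
    = pass w xs
}.

Lemma mrg_size xs w j s i1 i2 mid stop : 0 < w -> size xs = n -> j <= n ->
  merging xs w j s i1 i2 mid stop -> (mid - i1) + (stop - i2) + (n - stop) = j.
Proof.
move=> w0 sx jn H; have := congr1 size (mrg_out H).
have /andP[L1 L2] := mrg_le1 H; have /andP[L3 L4] := mrg_le2 H.
rewrite !size_cat size_merge size_cat !size_merge_pass // size_drop size_mkseq.
by rewrite !size_segment ?sx; lia.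
Qed.

Lemma next_block_mem s stop w : reads I s -> nmem s END 0 = stop ->
  nmem s WIDTH 0 = w -> let mid := minn (stop + w) n in
  let s' := sem next_block s in
  [/\ nmem s' LEFT 0 = stop, nmem s' MID 0 = mid, nmem s' RIGHT 0 = mid &
      nmem s' END 0 = minn (mid + w) n].
Proof.
move=> Hs Es Ew; cbv zeta; rewrite /next_block /= (read_nv Hs) Es Ew.
case: (leqP (stop + w) n) => L /=; rewrite ?(read_nv Hs);
  case: leqP => L' /=; by split=> //; lia.
Qed.

(** The next two blocks begin where the last two end; cutting them off at [n]
    agrees with what [take] and [drop] do at the end of a list. *)
Lemma next_blockP s w j i1 i2 mid stop : reads I s -> 0 < w ->
  nmem s WIDTH 0 = w -> mid <= i1 -> stop <= i2 ->
  merging (cells SRC s) w j s i1 i2 mid stop ->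
  exists i1 i2 mid stop,
    merging (cells SRC s) w j (sem next_block s) i1 i2 mid stop /\
    (stop < n -> i1 < mid).
Proof.
move=> Hs w0 Ew L1 L2 H.
have En : nmem s SIZES 0 = n := read_nv Hs.
exists stop, (minn (stop + w) n), (minn (stop + w) n), (minn (minn (stop + w) n + w) n).
have /andP[_ stopn] := mrg_le2 H.
have out : mkseq (rmem s DST) (n - j) ++ pass w (drop stop (cells SRC s)) =
    pass w (cells SRC s).
  by rewrite -(mrg_out H) !segment_nil.
have sx : size (cells SRC s) = n by rewrite size_mkseq.
split; last by lia.
have [EL EM ERt EE] := next_block_mem Hs (mrg_end H) Ew.
have [_ un] := sem_unchanged next_block s.
have take_min i k : take (minn (i + k) n - i) (drop i (cells SRC s)) =
    take k (drop i (cells SRC s)).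
  have [ik|ik] := leqP (i + k) n; first by rewrite (addKn i).
  by rewrite !take_oversize // size_drop sx; lia.
have E1 : segment (cells SRC s) stop (minn (stop + w) n) =
    take w (drop stop (cells SRC s)) by rewrite /segment take_min.
have E2 : segment (cells SRC s) (minn (stop + w) n) (minn (minn (stop + w) n + w) n) =
    take w (drop w (drop stop (cells SRC s))).
  rewrite /segment take_min drop_drop.
  have [ik|ik] := leqP (stop + w) n; first by rewrite (addnC w).
  by rewrite !drop_oversize // sx; lia.
have E3 : pass w (drop (minn (minn (stop + w) n + w) n) (cells SRC s)) =
    pass w (drop (w + w) (drop stop (cells SRC s))).
  rewrite drop_drop; have [ik|ik] := leqP (minn (stop + w) n + w) n.
    by have -> : minn (stop + w) n + w = w + w + stop by lia.
  by rewrite !drop_oversize // sx; lia.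
split=> //; first by lia.
  by lia.
rewrite E1 E2 E3 -merge_passE // -out; congr (_ ++ _).
by apply: eq_mkseq => i; rewrite un.
Qed.

Lemma mkseq_emit (f f' : nat -> R) k x A : f' k = x ->
  (forall i, i != k -> f' i = f i) ->
  mkseq f' k.+1 ++ A = mkseq f k ++ x :: A.
Proof.
move=> Ex Ef; rewrite mkseqS -cats1 -catA Ex /=; congr (_ ++ _).
apply/eq_in_map => i; rewrite mem_iota => /andP[_ ik].
by apply: Ef; rewrite neq_ltn ik.
Qed.

Lemma merge_stepP s w j i1 i2 mid stop : reads I s -> nmem s J 0 = j -> j < n ->
  (i1 < mid) || (i2 < stop) ->
  merging (cells SRC s) w j.+1 s i1 i2 mid stop ->
  exists i1 i2, merging (cells SRC s) w j (sem merge_step s) i1 i2 mid stop.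
Proof.
move=> Hs EJ jn ne H; have En : nmem s SIZES 0 = n := read_nv Hs.
have Eo : n - 1 - j = n - j.+1 by lia.
have /andP[L1 L2] := mrg_le1 H; have /andP[L3 L4] := mrg_le2 H.
have El := mrg_left H; have Er := mrg_right H.
have Em := mrg_mid H; have Ee := mrg_end H.
have out := mrg_out H.
have nj : n - j = (n - j.+1).+1 by lia.
have goleft s' : nmem s' LEFT 0 = i1.+1 -> nmem s' RIGHT 0 = i2 ->
    nmem s' MID 0 = mid -> nmem s' END 0 = stop -> i1 < mid ->
    rmem s' DST (n - j.+1) = rmem s SRC i1 ->
    (forall i, i != n - j.+1 -> rmem s' DST i = rmem s DST i) ->
    (i2 < stop -> (rmem s SRC i1 <= rmem s SRC i2)%R) ->
    merging (cells SRC s) w j s' i1.+1 i2 mid stop.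
  move=> F1 F2 F3 F4 lt1 Fx Fo Hle; split=> //; try by lia.
  rewrite nj (mkseq_emit _ Fx Fo) -out; congr (_ ++ _); rewrite -cat_cons.
  congr (_ ++ _); rewrite (@segment_cons s i1) //; last by lia.
  have [lt2|ge2] := ltnP i2 stop; last first.
    by rewrite (segment_nil _ ge2) /= /merge; case: (segment _ _ _).
  by rewrite (@segment_cons s i2) //= Hle.
have goright s' : nmem s' LEFT 0 = i1 -> nmem s' RIGHT 0 = i2.+1 ->
    nmem s' MID 0 = mid -> nmem s' END 0 = stop -> i2 < stop ->
    rmem s' DST (n - j.+1) = rmem s SRC i2 ->
    (forall i, i != n - j.+1 -> rmem s' DST i = rmem s DST i) ->
    (i1 < mid -> ~~ (rmem s SRC i1 <= rmem s SRC i2)%R) ->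
    merging (cells SRC s) w j s' i1 i2.+1 mid stop.
  move=> F1 F2 F3 F4 lt2 Fx Fo Hle; split=> //; try by lia.
  rewrite nj (mkseq_emit _ Fx Fo) -out; congr (_ ++ _); rewrite -cat_cons.
  congr (_ ++ _); rewrite [in RHS](@segment_cons s i2) //.
  have [lt1|ge1] := ltnP i1 mid; last by rewrite (segment_nil _ ge1).
  rewrite (@segment_cons s i1) //=; last by lia.
  by rewrite (negPf (Hle lt1)).
rewrite /merge_step /= El Er Em Ee En EJ Eo.
case: leqP => [ge1|lt1] /=.
  have lt2 : i2 < stop by move: ne; rewrite ltnNge ge1.
  exists i1, i2.+1; apply: goright => //=; try by rewrite ?addn1 ?eqxx.
    by move=> i /negPf->.
  by rewrite ltnNge ge1.
case: leqP => [ge2|lt2] /=.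
  exists i1.+1, i2; apply: goleft => //=; try by rewrite ?addn1 ?eqxx.
    by move=> i /negPf->.
  by rewrite ltnNge ge2.
case: ifP => Hle /=.
  exists i1.+1, i2; apply: goleft => //=; try by rewrite ?addn1 ?eqxx.
  by move=> i /negPf->.
exists i1, i2.+1; apply: goright => //=; try by rewrite ?addn1 ?eqxx.
  by move=> i /negPf->.
by rewrite Hle.
Qed.

Lemma merge_pass_progP s w : reads I s -> nmem s WIDTH 0 = w -> 0 < w ->
  cells SRC (sem merge_pass_prog s) = pass w (cells SRC s).
Proof.
move=> Hs Ew w0; rewrite /merge_pass_prog 5!sem_seq.
set s0 := sem (END ::= _) _; set lp := PFor _ _ _ (PSeq _ _).
have un0 : unchanged (LEFT ::= NConst 0;; MID ::= NConst 0;; RIGHT ::= NConst 0;;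
    END ::= NConst 0) s s0 by exact: sem_unchanged.
have H0 : reads I s0 by exact: reads_unchanged un0 Hs.
set xs := cells SRC s; have sx : size xs = n by rewrite size_mkseq.
pose Inv j s' := exists i1 i2 mid stop, merging xs w j s' i1 i2 mid stop.
have E0 : Inv n s0.
  exists 0, 0, 0, 0; split=> //; rewrite subnn /= drop0.
  by rewrite !segment_nil.
clearbody s0.
have [i1 [i2 [mid [stop H]]]] : Inv 0 (sem lp s0).
  have keep j x s' : Inv j s' -> Inv j (setn J 0 x s').
    by move=> [i1 [i2 [mid [stop H]]]]; exists i1, i2, mid, stop; case: H; split.
  apply: (@for_ind _ Inv) => //; first by rewrite (read_nv H0); exact: keep.
  move=> j s1; rewrite (read_nv H0) => jn un EJ [i1 [i2 [mid [stop H]]]].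
  have H1 : reads I s1 by exact: reads_unchanged un H0.
  have Exs : cells SRC s1 = xs.
    by apply: eq_mkseq => i; rewrite un.2 // un0.2.
  rewrite -Exs in H; rewrite sem_seq.
  have Ew1 : nmem s1 WIDTH 0 = w by rewrite un.1 // un0.1.
  have [s2 [-> H2 EJ2 Exs2 [k1 [k2 [mid' [stop' [M ne]]]]]]] : exists s2,
     [/\ sem (PIf (BAnd (BLeN (at0 MID) (at0 LEFT)) (BLeN (at0 END) (at0 RIGHT)))
            next_block PSkip) s1 = s2, reads I s2, nmem s2 J 0 = j,
         cells SRC s2 = cells SRC s1 &
         exists k1 k2 mid stop, merging (cells SRC s1) w j.+1 s2 k1 k2 mid stop /\
           (k1 < mid) || (k2 < stop)].
    have jn' : j.+1 <= n := jn.
    have [/andP[ge1 ge2]|] := boolP ((mid <= i1) && (stop <= i2)).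
      exists (sem next_block s1); split.
      - by rewrite sem_ifT //= (mrg_left H) (mrg_right H) (mrg_mid H) (mrg_end H) ge1.
      - exact: reads_sem.
      - by rewrite (sem_unchanged next_block s1).1.
      - by apply: eq_mkseq => i; rewrite (sem_unchanged next_block s1).2.
      have [k1 [k2 [mid' [stop' [M ne]]]]] := next_blockP H1 w0 Ew1 ge1 ge2 H.
      exists k1, k2, mid', stop'; split=> //.
      have := mrg_size w0 _ jn' M; rewrite size_mkseq => /(_ erefl) Hsz.
      by apply/orP; move: ne Hsz; lia.
    rewrite negb_and -!ltnNge => ne; exists s1; split=> //; last first.
      by exists i1, i2, mid, stop.
    rewrite sem_ifF //= (mrg_left H) (mrg_right H) (mrg_mid H) (mrg_end H).
    by rewrite negb_and -!ltnNge.
  rewrite -Exs2 in M.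
  have [k1' [k2' M']] := merge_stepP H2 EJ2 jn ne M.
  by rewrite Exs2 Exs in M'; exists k1', k2', mid', stop'.
have out := mrg_out H; have := mrg_size w0 sx (leq0n n) H.
have /andP[L1 L2] := mrg_le1 H; have /andP[L3 L4] := mrg_le2 H => Hsz.
have Edst : cells DST (sem lp s0) = pass w xs.
  rewrite -out subn0 !segment_nil; try by lia.
  by rewrite drop_oversize ?sx ?cats0 //; lia.
have H1 : reads I (sem lp s0) by exact: reads_sem H0.
rewrite -Edst; move: (sem lp s0) H1 => s1 H1.
pose Inv2 j s' := forall i, j <= i -> i < n -> rmem s' SRC i = rmem s1 DST i.
have C : Inv2 0 (sem (for_vertices (PR SRC (at0 J) (RGet DST (at0 J)))) s1).
  apply: (@for_ind _ Inv2) => //.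
    by move=> i; rewrite (read_nv H1) leqNgt => /negPf->.
  move=> j s'; rewrite (read_nv H1) => jn un EJ C i ji im.
  rewrite /= EJ; case: eqVneq => [->|ij]; first by rewrite un.2.
  by apply: C => //; rewrite ltn_neqAle eq_sym ij.
by apply/eq_in_map => i; rewrite mem_iota => /andP[_ im]; rewrite C.
Qed.

(** The list of costs followed by 0: an array holds 0 beyond its end, and there
    is one edge less than there are vertices. *)
Definition threshold_list := mkseq (array_of 0%R (@cst R I)) n.

Lemma merge_sort_progP s : reads I s -> n < 2 ^ nmem s LOG 0 ->
  let s' := sem merge_sort_prog s in
  perm_eq (cells SRC s') threshold_list /\ sorted le (cells SRC s').
Proof.
move=> Hs Hk; cbv zeta; rewrite /merge_sort_prog 2!sem_seq.
set ld := PFor _ _ _ (PR _ _ _); set lp := PFor _ _ _ (PSeq _ _).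
pose Inv0 j s' := forall i, j <= i -> i < n -> rmem s' SRC i = array_of 0%R (@cst R I) i.
have C : Inv0 0 (sem ld s).
  apply: (@for_ind _ Inv0) => //.
    by move=> i; rewrite (read_nv Hs) leqNgt => /negPf->.
  move=> j s'; rewrite (read_nv Hs) => jn un EJ C i ji im.
  rewrite /= EJ; case: eqVneq => [->|ij]; first by rewrite un.2 // Hs.2.
  by apply: C => //; rewrite ltn_neqAle eq_sym ij.
have un := sem_unchanged ld s; have H1 : reads I (sem ld s) by exact: reads_sem Hs.
have E1 : cells SRC (sem ld s) = threshold_list.
  by apply/eq_in_map => i; rewrite mem_iota => /andP[_ im]; rewrite C.
have Ek : nmem (sem ld s) LOG 0 = nmem s LOG 0 by rewrite un.1.
move: (sem ld s) H1 E1 Ek {un C} => s1 H1 E1 Ek.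
rewrite -Ek in Hk; set k := nmem s1 LOG 0 in Hk.
set s2 := sem (WIDTH ::= _) s1.
have H2 : reads I s2 by exact: reads_sem H1.
pose Inv j s' := [/\ reads I s', nmem s' WIDTH 0 = 2 ^ (k - j),
  perm_eq (cells SRC s') threshold_list & runs le (2 ^ (k - j)) (cells SRC s')].
have keep j x s' : Inv j s' -> Inv j (setn JJ 0 x s').
  by move=> [[R1 R2] W P S]; split=> //; split=> // -[|[|[|k']]] i // k3;
    exact: R1.
have [_ _ P S] : Inv 0 (sem lp s2).
  apply: (@for_ind _ Inv) => //.
    apply: keep; have -> : nmem s2 LOG 0 = k by [].
    split; rewrite ?subnn //; first by rewrite -E1.
    exact: runs1.
  move=> j s'; have -> : nmem s2 LOG 0 = k by [].
  move=> jk un EJ [Hs' W P S]; rewrite sem_seq.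
  have w0 : 0 < 2 ^ (k - j.+1) by rewrite expn_gt0.
  have E := merge_pass_progP Hs' W w0.
  have un3 := sem_unchanged merge_pass_prog s'.
  have H3 : reads I (sem merge_pass_prog s') by exact: reads_sem Hs'.
  move: (sem merge_pass_prog s') E un3 H3 => s3 E un3 H3.
  have kj : 2 ^ (k - j) = 2 ^ (k - j.+1) + 2 ^ (k - j.+1).
    by rewrite addnn -mul2n -expnS; congr (2 ^ _); lia.
  split.
  - exact: reads_sem.
  - by rewrite /= un3.1 // W kj.
  - have -> : cells SRC (sem (incr WIDTH (NConst 0) (at0 WIDTH)) s3) = cells SRC s3 by [].
    by rewrite E; apply: perm_trans P; exact: perm_merge_pass.
  have -> : cells SRC (sem (incr WIDTH (NConst 0) (at0 WIDTH)) s3) = cells SRC s3 by [].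
  rewrite E kj; apply: runs_merge_pass => //.
  by move=> x y; exact: le_total.
split; first exact: P.
apply: runs_sorted S; rewrite subn0 size_mkseq; exact: ltnW.
Qed.

Lemma threshold_listP (theta : R) : n = m.+1 ->
  reflect (threshold I theta) (theta \in threshold_list).
Proof.
move=> nm; apply: (iffP mapP) => [[i]|].
  rewrite mem_iota => /andP[_]; rewrite add0n nm ltnS leq_eqVlt => /orP[/eqP->|im] ->.
    by left; rewrite /array_of insubN // ltnn.
  by right; exists (Ordinal im); rewrite -[i]/(nat_of_ord (Ordinal im)) array_of_ord.
case=> [->|[e ->]].
  by exists m; rewrite ?mem_iota ?nm ?add0n //= /array_of insubN // ltnn.
exists (e : nat); last by rewrite array_of_ord.
by rewrite mem_iota add0n nm ltnS /= ltnW.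
Qed.

End Sort.

(** * The algorithm *)

Notation POS := 33 (only parsing).

Definition binary_search : prog :=
  let stop := NAdd (at0 POS) (NGet POWER (at0 JJ)) in
  POS ::= NConst 0;;
  PFor JJ LOG 0
    (PIf (BLeN stop nv_cell)
       (PR THETA (NConst 0) (RGet SRC (NSub stop (NConst 1)));;
        test_threshold;;
        PIf (BLeN (NConst 1) (at0 FOUND)) PSkip (POS ::= stop))
       PSkip).

Definition answer : prog :=
  PIf (BLeN nv_cell (at0 POS)) PSkip
    (PR THETA (NConst 0) (RGet SRC (at0 POS));; test_threshold;; FLAG ::= at0 FOUND).

Definition find_gates : prog :=
  (ROOT ::= NGet SIZES (NConst 2);; root_tree;; GATEA ::= at0 LCA);;
  (ROOT ::= NGet SIZES (NConst 3);; root_tree;; GATEB ::= at0 LCA).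

Definition prepare : prog := power_table;; count_positive.

Definition solve : prog :=
  PIf (BLeN (at0 TOTAL) (NConst 0)) (FLAG ::= NConst 1)
    (find_gates;; merge_sort_prog;; binary_search;; answer).

Section Algorithm.
Variables (R : realFieldType) (I : instance R).
Hypothesis Hvalid : valid_instance I.
Local Notation n := (nv I).
Local Notation m := (ne I).
Local Notation a := (pa I).
Local Notation b := (pb I).
Implicit Types s : state R.

Section Search.
Variables (t : 'I_n) (par : 'I_n -> 'I_n) (pe : 'I_n -> 'I_m) (depth : 'I_n -> nat).
Hypothesis HR : rooting (@ends R I) t par pe depth.
Variables (r : seq 'I_n) (ca cb : 'I_n).
Hypotheses (Ga : gate (@ends R I) (@wgt R I) ca a)
           (Gb : gate (@ends R I) (@wgt R I) cb b).
Local Notation armed s := (armed t par pe r ca cb s).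
Local Notation solvable := (solvable ca cb).
Variable ys : nat -> R.
Hypothesis ys_sorted : forall i j, i <= j -> j < n -> (ys i <= ys j)%R.
Hypothesis ys_threshold : forall theta, threshold I theta <->
  exists2 i, i < n & theta = ys i.

Lemma ys_ge0 i : i < n -> (0 <= ys i)%R.
Proof. by move=> im; apply: (threshold_ge0 Hvalid); apply/ys_threshold; exists i. Qed.

(** When [j] steps remain and the position is [p], all values before [p] have
    failed, and the value at [p + 2 ^ j - 1] is good or lies beyond the list. *)
Lemma binary_searchP s k : armed s -> nmem s LOG 0 = k -> n < 2 ^ k ->
  (forall i, i < k -> nmem s POWER i = 2 ^ i) ->
  (forall i, i < n -> rmem s SRC i = ys i) ->
  exists p, [/\ nmem (sem binary_search s) POS 0 = p, p <= n,
    forall i, i < p -> ~ solvable (ys i) & p < n -> solvable (ys p)].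
Proof.
move=> H Ek nk Hpow Hys; rewrite /binary_search sem_seq.
set s0 := sem _ s; set lp := PFor _ _ _ _.
have H0 : armed s0 by exact: armed_sem H.
pose Inv j s' := exists p, [/\ armed s', nmem s' POS 0 = p, p <= n,
  forall i, i < p -> ~ solvable (ys i) &
  p + 2 ^ j <= n -> solvable (ys (p + 2 ^ j - 1))].
have keep j x s' : Inv j s' -> Inv j (setn JJ 0 x s').
  move=> [p [A Ep pn no yes]]; exists p; split=> //.
  by apply: (@armed_unchanged _ _ _ _ _ _ _ _ (JJ ::= NConst 0)) A;
     [|split=> // k' i; rewrite inE => /negPf /= ->].
have [p [_ Ep pn no yes]] : Inv 0 (sem lp s0).
  apply: (@for_ind _ Inv) => //.
    apply: keep; rewrite [nmem s0 LOG 0]Ek; exists 0; split=> //.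
    by rewrite add0n leqNgt nk.
  move=> j s1; rewrite [nmem s0 LOG 0]Ek => jk un EJ [p [A Ep pn no yes]].
  have Epow : nmem s1 POWER j = 2 ^ j by rewrite un.1 //= Hpow.
  have En : nmem s1 SIZES 0 = n by case: A => [[Hs _ _] _ _]; exact: read_nv Hs.
  have p2 : 0 < 2 ^ j by rewrite expn_gt0.
  have [le_n|gt_n] := leqP (p + 2 ^ j) n; last first.
    rewrite sem_ifF; last by rewrite /= Ep EJ Epow En -ltnNge.
    by exists p; split=> //; rewrite leqNgt gt_n.
  rewrite sem_ifT; last by rewrite /= Ep EJ Epow En.
  rewrite 2!sem_seq; set s2 := sem (PR _ _ _) s1.
  have A2 : armed s2 by exact: armed_sem A.
  have Eth : rmem s2 THETA 0 = ys (p + 2 ^ j - 1).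
    by rewrite /= Ep EJ Epow un.2 //= Hys //; lia.
  have [E2 EJ2 Epow2] : [/\ nmem s2 POS 0 = p, nmem s2 JJ 0 = j & nmem s2 POWER j = 2 ^ j].
    by split.
  have := test_thresholdP Hvalid HR A2 Eth.
  have un3 := sem_unchanged test_threshold s2.
  have A3 : armed (sem test_threshold s2) by exact: armed_sem A2.
  clearbody s2; move: (sem test_threshold s2) un3 A3 => s3 un3 A3.
  case=> [[F [g [Hg ach _]]]|[F nsol]].
    rewrite sem_ifT; last by rewrite /= F.
    by exists p; split=> //; [rewrite un3.1|move=> _; exists g].
  rewrite sem_ifF; last by rewrite /= F.
  have E4 : nmem (sem (POS ::= NAdd (at0 POS) (NGet POWER (at0 JJ))) s3) POS 0 = p + 2 ^ j.
    by rewrite /= !un3.1 // E2 EJ2 Epow2.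
  exists (p + 2 ^ j); split=> //; first exact: armed_sem A3.
    move=> i ip sol; apply: nsol.
    apply: (solvable_mono Hvalid _ _ sol); first by apply: ys_ge0; lia.
    by apply: ys_sorted; lia.
  by rewrite -addnA addnn -mul2n -expnS.
exists p; split=> // pn'; move: yes.
by rewrite addn1 subn1; exact.
Qed.

Lemma answerP s p : armed s -> nmem s POS 0 = p -> p <= n -> nmem s FLAG 0 = 0 ->
  (forall i, i < n -> rmem s SRC i = ys i) ->
  (forall i, i < p -> ~ solvable (ys i)) -> (p < n -> solvable (ys p)) ->
  solved_by I (sem answer s).
Proof.
move=> A Ep pn F0 Hys no yes; rewrite /answer.
have En : nmem s SIZES 0 = n by case: A => [[Hs _ _] _ _]; exact: read_nv Hs.
have [np|pn'] := leqP n p.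
  rewrite sem_ifT; last by rewrite /= En Ep.
  right; split=> // x; apply: (unsolvable_infeasible Hvalid Ga Gb).
  move=> theta /ys_threshold[i im ->]; apply: no; exact: leq_trans im np.
rewrite sem_ifF; last by rewrite /= En Ep -ltnNge.
rewrite 2!sem_seq; set s2 := sem (PR _ _ _) s.
have A2 : armed s2 by exact: armed_sem A.
have Eth : rmem s2 THETA 0 = ys p by rewrite /= Ep Hys.
have := test_thresholdP Hvalid HR A2 Eth; move: (sem test_threshold s2) => s3.
case=> [[F [g [Hg ach Ch]]]|[F nsol]]; last by case: (nsol (yes pn')).
left; split; first by rewrite /= F.
apply: (achieves_optimal Hvalid Ga Gb Hg ach).
- by move=> e; rewrite Ch.
- by apply/ys_threshold; exists p.
move=> theta /ys_threshold[i im ->] lt; apply: no.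
by rewrite ltnNge; apply: contraTN lt => pi; rewrite -leNgt ys_sorted.
Qed.

End Search.

(** The tree is rooted twice, since each gate is a lowest common ancestor for
    another root; the second rooting remains in memory for the tests. *)
Lemma find_gatesP s : reads I s ->
  nmem s TOTAL 0 = \sum_(v < n) positive v -> (exists v : 'I_n, positive v) ->
  exists par pe depth r ca cb, [/\ rooting (@ends R I) b par pe depth,
    gate (@ends R I) (@wgt R I) ca a, gate (@ends R I) (@wgt R I) cb b &
    armed b par pe r ca cb (sem find_gates s)].
Proof.
move=> Hs Et exW; have Htree := valid_tree Hvalid; have m0 := valid_ne0 Hvalid.
rewrite /find_gates; set half_b := (ROOT ::= NGet SIZES (NConst 3);; _).
rewrite 3!sem_seq.
have H1 : reads I (sem (ROOT ::= NGet SIZES (NConst 2)) s) by exact: reads_sem Hs.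
have R1 : nmem (sem (ROOT ::= NGet SIZES (NConst 2)) s) ROOT 0 = a.
  by rewrite /= (read_pa Hs).
have T1' : nmem (sem (ROOT ::= NGet SIZES (NConst 2)) s) TOTAL 0 = \sum_(v < n) positive v.
  by [].
move: (sem (ROOT ::= _) s) H1 R1 T1' => s1 H1 R1 T1'.
have [parA [peA [depthA HRa]]] := rooting_exists a Htree m0.
have [_] := root_treeP Hvalid HRa H1 R1 T1' exW.
have un1 := sem_unchanged root_tree s1.
have H2 : reads I (sem root_tree s1) by exact: reads_sem H1.
move: (sem root_tree s1) un1 H2 => s2 un1 H2 [ca Eca Ga].
have H3 : reads I (sem (GATEA ::= at0 LCA) s2) by exact: reads_sem H2.
have Ea3 : nmem (sem (GATEA ::= at0 LCA) s2) GATEA 0 = ca by rewrite /= Eca.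
have T3 : nmem (sem (GATEA ::= at0 LCA) s2) TOTAL 0 = \sum_(v < n) positive v.
  by rewrite /= un1.1.
move: (sem (GATEA ::= _) s2) H3 Ea3 T3 => s3 H3 Ea3 T3.
rewrite /half_b 2!sem_seq.
have H4 : reads I (sem (ROOT ::= NGet SIZES (NConst 3)) s3) by exact: reads_sem H3.
have R4 : nmem (sem (ROOT ::= NGet SIZES (NConst 3)) s3) ROOT 0 = b.
  by rewrite /= (read_pb H3).
have T4 : nmem (sem (ROOT ::= NGet SIZES (NConst 3)) s3) TOTAL 0 = \sum_(v < n) positive v.
  by [].
have Ea4 : nmem (sem (ROOT ::= NGet SIZES (NConst 3)) s3) GATEA 0 = ca by [].
move: (sem (ROOT ::= _) s3) H4 R4 T4 Ea4 => s4 H4 R4 T4 Ea4.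
have [parB [peB [depthB HRb]]] := rooting_exists b Htree m0.
have [] := root_treeP Hvalid HRb H4 R4 T4 exW.
have un5 := sem_unchanged root_tree s4.
have H5 : reads I (sem root_tree s4) by exact: reads_sem H4.
move: (sem root_tree s4) un5 H5 => s5 un5 H5 [r Hr] [cb Ecb Gb].
exists parB, peB, depthB, r, ca, cb; split=> //.
split; [split| |].
- exact: reads_sem H5.
- by rewrite /= un5.1.
- by apply: rooted_unchanged (sem_unchanged (GATEB ::= at0 LCA) s5) Hr; apply/allP.
- by rewrite /= un5.1.
- by rewrite /= Ecb.
Qed.

Lemma solveP s : reads I s -> nmem s FLAG 0 = 0 ->
  (forall e : 'I_m, rmem s CHANGE e = 0%R) ->
  nmem s TOTAL 0 = \sum_(v < n) positive v ->
  (forall i, i <= nmem s LOG 0 -> nmem s POWER i = 2 ^ i) ->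
  n < 2 ^ nmem s LOG 0 ->
  solved_by I (sem solve s).
Proof.
move=> Hs F0 X0 Et Hpow Hlog; rewrite /solve.
have [T0|Tpos] := posnP (nmem s TOTAL 0).
  rewrite sem_ifT; last by rewrite /= T0.
  left; split=> //; apply: (weightless_optimal Hvalid) => // v.
  move/eqP: T0; rewrite Et sum_nat_eq0 => /forallP/(_ v).
  by rewrite /positive; case: (_ < _)%R.
rewrite sem_ifF; last by rewrite /= -ltnNge.
have exW : exists v : 'I_n, positive v.
  apply/existsP; rewrite -[X in is_true X]negbK; apply/negP => /existsPn no.
  by move: Tpos; rewrite Et big1 // => v _; have := no v; case: positive.
have [par [pe [depth [r [ca [cb [HR Ga Gb]]]]]]] := find_gatesP Hs Et exW.
rewrite 3!sem_seq; have un1 := sem_unchanged find_gates s.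
move: (sem find_gates s) un1 => s1 un1 A1.
have H1 : reads I s1 by case: A1 => -[].
have Hlog1 : n < 2 ^ nmem s1 LOG 0 by rewrite un1.1.
have [P S] := merge_sort_progP H1 Hlog1.
have un2 := sem_unchanged merge_sort_prog s1.
have A2 : armed b par pe r ca cb (sem merge_sort_prog s1) by exact: armed_sem A1.
move: (sem merge_sort_prog s1) un2 A2 P S => s2 un2 A2 P S.
pose ys i := rmem s2 SRC i.
have nm : n = m.+1 := card_edges HR.
have ys_sorted i j : i <= j -> j < n -> (ys i <= ys j)%R.
  move=> ij jn; have := sorted_leq_nth (@le_trans _ _) (@lexx _ _) 0%R S.
  move=> /(_ i j); rewrite !inE size_mkseq jn (leq_ltn_trans ij jn).
  by rewrite !nth_mkseq ?(leq_ltn_trans ij jn) //; apply.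
have ys_threshold theta : threshold I theta <-> exists2 i, i < n & theta = ys i.
  split=> [/(threshold_listP theta nm)|[i im ->]].
    rewrite -(perm_mem P) => /mapP[i]; rewrite mem_iota => /andP[_ im] ->.
    by exists i.
  apply/(threshold_listP _ nm); rewrite -(perm_mem P); apply/mapP.
  by exists i; rewrite // mem_iota.
have Ek : nmem s2 LOG 0 = nmem s LOG 0 by rewrite un2.1 // un1.1.
have Hp2 i : i < nmem s LOG 0 -> nmem s2 POWER i = 2 ^ i.
  by move=> /ltnW ik; rewrite un2.1 // un1.1 // Hpow.
have [p [Ep pn no yes]] := binary_searchP HR ys_sorted ys_threshold A2 Ek Hlog Hp2
  (fun i _ => erefl).
have un3 := sem_unchanged binary_search s2.
have A3 : armed b par pe r ca cb (sem binary_search s2) by exact: armed_sem A2.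
move: (sem binary_search s2) un3 A3 Ep => s3 un3 A3 Ep.
apply: (answerP HR Ga Gb ys_sorted ys_threshold A3 Ep pn _ _ no yes).
  by rewrite un3.1 // un2.1 // un1.1.
by move=> i _; rewrite un3.2.
Qed.

End Algorithm.

Lemma weight_prepare env n : env SIZES 0 = n -> 0 < n -> weight env prepare <= n.
Proof. by move=> En n0; rewrite /= En !geq_max ?muln1 ?leqnn ?n0. Qed.

(** Loops of linear length occur inside a loop only in the merge sort and in the
    binary search, where the outer loop runs over the exponents of the table of
    powers. *)
Lemma weight_solve env n k : env SIZES 0 = n -> env SIZES 1 = n -> env LOG 0 = k ->
  0 < n -> 0 < k -> weight env solve <= k * n.
Proof.
move=> En Em Ek n0 k0.
have nkn : n <= k * n by rewrite leq_pmull.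
have kn0 : 0 < k * n by rewrite muln_gt0 k0.
have W1 : weight env test_threshold <= n.
  by rewrite /= En Em !geq_max !muln1 ?leqnn ?n0.
have W2 : weight env merge_pass_prog <= n.
  by rewrite /= En !geq_max ?muln1 ?leqnn ?n0.
have W3 : weight env find_gates <= n.
  by rewrite /= En Em !geq_max ?muln1 ?leqnn ?n0.
have W4 : weight env binary_search <= k * n.
  rewrite -[weight _ _]/(maxn 1 (env LOG 0 * maxn (maxn 1 (maxn
    (weight env test_threshold) (maxn 1 1))) 1)) Ek.
  move: (weight env test_threshold) W1 => w W1.
  by rewrite geq_max kn0 leq_mul2l !geq_max W1 n0 orbT.
have W5 : weight env merge_sort_prog <= k * n.
  rewrite -[weight _ _]/(maxn (env SIZES 0 * 1) (maxn 1
    (env LOG 0 * maxn (weight env merge_pass_prog) 1))).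
  move: (weight env merge_pass_prog) W2 => w W2.
  by rewrite Ek En !geq_max kn0 muln1 nkn leq_mul2l !geq_max W2 n0 orbT.
have W6 : weight env answer <= n.
  rewrite -[weight _ _]/(maxn 1 (maxn 1 (maxn (weight env test_threshold) 1))).
  move: (weight env test_threshold) W1 => w W1.
  by rewrite !geq_max n0 W1.
rewrite -[weight _ _]/(maxn 1 (maxn (weight env find_gates) (maxn (weight env merge_sort_prog)
  (maxn (weight env binary_search) (weight env answer))))).
move: (weight env find_gates) (weight env merge_sort_prog) (weight env binary_search)
  (weight env answer) W3 W4 W5 W6 => w3 w5 w4 w6 W3 W4 W5 W6.
by rewrite !geq_max kn0 W4 W5 !(leq_trans _ nkn).
Qed.

Theorem theorem4 (R : realFieldType) :
  exists (p : cmd) (C : nat), forall I : instance R, valid_instance I ->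
    exists (s : state R) (t : nat),
      [/\ exec p (input I) s t,
          (t <= C * (nv I * trunc_log 2 (nv I)))%N &
          solved_by I s].
Proof.
pose unit_time := time_bound (fun _ _ => 1).
exists (code (prepare;; solve)), (2 * (unit_time prepare + unit_time solve)) => I Hvalid.
set n := nv I; set lg := trunc_log 2 n.
have n2 : 1 < n.
  by have := max_card (pred2 (pa I) (pb I)); rewrite card2 (valid_ab Hvalid) card_ord.
have n0 : 0 < n := ltnW n2.
have lg0 : 0 < lg by rewrite trunc_log_gt0.
have [par [pe [depth HR]]] := rooting_exists (pb I) (valid_tree Hvalid) (valid_ne0 Hvalid).
have nm : n = (ne I).+1 := card_edges HR.
have H0 : reads I (input I) by [].
have [t1 e1 l1] := @code_exec R prepare (input I) isT isT.
have [k [Ek Hpow Hlog Hk]] := power_tableP H0 n0.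
have un1 := sem_unchanged power_table (input I).
have H1 : reads I (sem power_table (input I)) by exact: reads_sem H0.
have Etot := count_positiveP H1.
have un2 := sem_unchanged count_positive (sem power_table (input I)).
have H2 : reads I (sem prepare (input I)) by rewrite /prepare sem_seq; exact: reads_sem H1.
have [t2 e2 l2] := @code_exec R solve (sem prepare (input I)) isT isT.
rewrite [sem prepare _]sem_seq in e1 e2 l2 H2.
move: (sem power_table (input I)) un1 H1 Etot Ek Hpow un2 e1 e2 l2 H2 => s1 un1 H1.
move: (sem count_positive s1) => s2 Etot Ek Hpow un2 e1 e2 l2 H2.
have Ek2 : nmem s2 LOG 0 = k by rewrite un2.1.
exists (sem solve s2), (t1 + t2); split; first exact: ExecSeq e1 e2.
  have w1 : t1 <= n * unit_time prepare.
    apply: leq_trans l1 _.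
    pose env' (k i : nat) :=
      if (k == 0) && (i == 0) then n else (nmem (input I) k i).+1.
    apply: leq_trans (@time_bound_weight _ env' prepare _ _) _.
    - by move=> k' i _; rewrite /env'; case: ifP => [/andP[/eqP-> /eqP->]|_].
    - by move=> k' i; rewrite /env'; case: ifP.
    by rewrite leq_mul2r weight_prepare ?orbT.
  have w2 : t2 <= (lg.+1 * n) * unit_time solve.
    apply: leq_trans l2 _.
    pose env' (k i : nat) := if (k == LOG) && (i == 0) then lg.+1
      else if (k == SIZES) && (i <= 1) then n else (nmem s2 k i).+1.
    apply: leq_trans (@time_bound_weight _ env' solve _ _) _.
    - move=> k' i _; rewrite /env'; case: ifP => [/andP[/eqP-> /eqP->]|_].
        by rewrite Ek2.
      case: ifP => [/andP[/eqP->]|//]; case: i => [|[|i]] // _.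
        by rewrite (read_nv H2).
      by rewrite (read_ne H2) -/n nm.
    - by move=> k' i; rewrite /env'; do 2?case: ifP.
    by rewrite leq_mul2r weight_solve ?orbT.
  have : n * lg.+1 <= 2 * (n * lg) by nia.
  move: (unit_time prepare) (unit_time solve) w1 w2 => u1 u2 w1 w2 Hlg.
  rewrite -/n -/lg; move: Hlg w1 w2; set N := n * lg.
  have : n <= N by rewrite /N leq_pmulr.
  move=> nN Hlg w1 w2.
  have : lg.+1 * n * u2 <= 2 * N * u2 by rewrite leq_mul2r mulnC Hlg orbT.
  have : n * u1 <= N * u1 by rewrite leq_mul2r nN orbT.
  clearbody N; nia.
apply: (solveP Hvalid H2).
- by rewrite un2.1 // un1.1.
- by move=> e; rewrite un2.2 // un1.2.
- exact: Etot.
- by move=> i; rewrite Ek2 => ik; rewrite un2.1 // Hpow.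
- by rewrite Ek2.
Qed.
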